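(* In the lattice setting described in the context, let $V$ be a generalized module over the lattice vertex superalgebra $\mathfrak V_\Lambda$, with representation map $\pi:\mathfrak V_\Lambda\to\mathcal F\{V\}$, such that $\pi(\tilde h)\in\mathcal F\{V\}^{[\lambda]}$ for every $h\in\mathfrak h^{[\lambda]}$. (Then the coefficients of the series $\pi(\tilde h)$ make $V$ a module over the twisted Heisenberg algebra $H$ with $\mathsf c=\mathrm{id}$.) Assume that $V$ is $\mathfrak h^{[0]}$-diagonalizable. Then there is a unique action of the extended lattice $\widehat\Lambda$ on $V$ (with the central $\mathbb C^\times$ acting by scalars), i.e. a unique $R$-module structure given by operators $e(\alpha):V\to V$, $\alpha\in\Lambda$, making $V$ together with its $H$-action a module over $U(H)\,\tilde\otimes\,R$, such that for every $\alpha\in\Lambda$ the highest weight vector $X_\alpha\in\mathfrak V_\alpha$ acts on $V$ by the vertex operator $$\pi(X_\alpha)(z)=e(\alpha)E_-(\alpha,z)E_+(\alpha,z)\,z^{\alpha(0)}z^{-(\alpha'|\alpha')/2}.$$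
   Context: Ground field $\mathbb C$. Lattice data. $\mathfrak h$ is a complex vector space of finite dimension $l$ with a nondegenerate symmetric bilinear form $(\cdot|\cdot)$; $p\ge1$ is an integer; $\mathfrak h=\bigoplus_{\lambda\in\{0,\frac1p,\dots,\frac{p-1}p\}}\mathfrak h^{[\lambda]}$ with $(\mathfrak h^{[\lambda]}|\mathfrak h^{[\mu]})=0$ unless $\lambda+\mu\in\mathbb Z$. For $n\in\frac1p\mathbb Z$, $\mathfrak h^{[n]}$ is the component of class $n\bmod\mathbb Z$, $h^{[n]}$ the projection of $h$ to it; $h'=h-h^{[0]}$. $\sigma:\mathfrak h\to\mathfrak h$ acts on $\mathfrak h^{[\lambda]}$ by $e^{2\pi i\lambda}$; $\omega=e^{2\pi i/p}$. $\Lambda\subset\mathfrak h$ is the $\mathbb Z$-span of a $\mathbb C$-basis of $\mathfrak h$ such that $m_s=m_s(\alpha,\beta)=(\sigma^{-s}\alpha|\beta)\in\mathbb Z$ for all $\alpha,\beta\in\Lambda$, $0\le s\le p-1$. $\varepsilon:\Lambda\times\Lambda\to\mathbb C^\times$ is a 2-cocycle with $\varepsilon(\alpha,\beta)\varepsilon(\beta,\alpha)^{-1}=(-1)^{(\alpha|\alpha)(\beta|\beta)+p(\alpha^{[0]}|\beta^{[0]})}\omega^{-\sum_{s=1}^{p-1}sm_s}$. $\widehat\Lambda$ is the corresponding central extension of $\Lambda$ by $\mathbb C^\times$, with section $e$, and $R=\mathbb C[\widehat\Lambda]/\langle\text{central }\mathbb C^\times\text{ identified with scalars}\rangle$ is the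 algebra with basis $e(\alpha)$ and $e(\alpha)e(\beta)=\varepsilon(\alpha,\beta)e(\alpha+\beta)$. Heisenberg algebra. $H$ is the Lie algebra spanned by a central $\mathsf c$ and symbols $a(n)$, $n\in\frac1p\mathbb Z$, $a\in\mathfrak h^{[n]}$, with $[a(m),b(n)]=\delta_{m+n,0}m(a|b)\mathsf c$; for general $a\in\mathfrak h$, $a(n)=a^{[n]}(n)$. A $U(H)\,\tilde\otimes\,R$-module is a space with $H$- and $R$-module structures such that $[h(n),e(\alpha)]=\delta_{n,0}(h|\alpha)e(\alpha)$ for $h\in\mathfrak h^{[n]}$. $V$ is $\mathfrak h^{[0]}$-diagonalizable if $V=\bigoplus_{\xi\in(\mathfrak h^{[0]})^*}V_\xi$ with $h(0)=\xi(h)$ on $V_\xi$ for $h\in\mathfrak h^{[0]}$; $z^{\alpha(0)}$ acts on $V_\xi$ as $z^{\xi(\alpha^{[0]})}$. $E_\pm(\alpha,z)=\exp\sum_{n\in\frac1p\mathbb Z,\ n\gtrless0}-\frac{\alpha(n)}nz^{-n}$. Lattice vertex superalgebra. $\mathfrak V_\Lambda=\bigoplus_{\alpha\in\Lambda}\mathfrak V_\alpha$ is the vertex superalgebra ($\mathfrak V_\alpha$ of parity $(\alpha|\alpha)\bmod2$) containing even elements $\tilde h$ ($h\in\mathfrak h$, linear in $h$) and elements $X_\alpha\in\mathfrak V_\alpha$, with $X_0=\varepsilon(0,0)\mathbf 1$, $\tilde a_{(n)}\tilde b=\delta_{n,1}(a|b)\mathbf 1$ for $n\ge0$, $\tilde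 h_{(n)}X_\alpha=\delta_{n,0}(h|\alpha)X_\alpha$ for $n\ge0$, $DX_\alpha=\tilde\alpha_{(-1)}X_\alpha$; $\mathfrak V_\alpha$ has as a basis the monomials in the commuting operators $\tilde h_{i\,(-n)}$ ($n\ge1$, $h_i$ a basis of $\mathfrak h$) applied to $X_\alpha$; and $$X_\alpha{}_{(-(\alpha|\beta)-n-1)}X_\beta=\varkappa(\alpha,\beta)\tfrac1{n!}(D-\tilde\beta_{(-1)})^nX_{\alpha+\beta}\ (n\ge0),\quad X_\alpha{}_{(n)}X_\beta=0\ (n\ge-(\alpha|\beta)),$$ with $\varkappa(\alpha,\beta)=\varepsilon(\alpha,\beta)p^{-(\alpha|\beta)}\prod_{s=1}^{p-1}(1-\omega^s)^{m_s}$. (Up to isomorphism it is the usual lattice vertex superalgebra.) Vertex superalgebra has its standard meaning (products $a_{(n)}b$, $n\in\mathbb Z$; vacuum $\mathbf 1$; $Da=a_{(-2)}\mathbf 1$). Generalized modules. $\mathcal F\{V\}$ is the linear span of series $\sum_{n\in\lambda+\mathbb Z}\alpha(n)z^{-n-1}$ ($\lambda\in\mathbb C$, $\alpha(n)\in\mathfrak{gl}(V)$) such that for each $v\in V$, $\alpha(\lambda+j)v=0$ for integers $j\gg0$; those with exponents in the class of $\lambda$ form $\mathcal F\{V\}^{[\lambda]}=z^{-\lambda}\mathcal F(V)$, $\mathcal F(V)=\mathcal F\{V\}^{[0]}$; $\mathbf 1$ is the constant series $\mathrm{id}$. Elements $\alpha,\beta$ with given parities are local if $(z-w)^N(\alpha(w)\beta(z)-(-1)^{p(\alpha)p(\beta)}\beta(z)\alpha(w))=0$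 for some $N\ge0$. For local $\alpha_0,\beta_0\in\mathcal F(V)$, $n\in\mathbb Z$: $(\alpha_0{}_{(n)}\beta_0)(m)=\sum_{s\ge0}(-1)^s\binom ns\alpha_0(n-s)\beta_0(m+s)-(-1)^{p(\alpha_0)p(\beta_0)}\sum_{s\le n}(-1)^s\binom n{n-s}\beta_0(m+s)\alpha_0(n-s)$; for $\alpha=z^\lambda\alpha_0,\beta=z^\mu\beta_0$: $\alpha_{(n)}\beta=\sum_{j\ge0}\binom\lambda j(\alpha_0{}_{(n+j)}\beta_0)z^{\lambda+\mu-j}$, extended bilinearly. A generalized module over a vertex superalgebra $\mathfrak A$ is a vector space $V$ with a linear map $\pi:\mathfrak A\to\mathcal F\{V\}$ such that $\pi(a),\pi(b)$ are local (with the parities of $a,b$), $\pi(a_{(n)}b)=\pi(a)_{(n)}\pi(b)$ for all $n\in\mathbb Z$, and $\pi(\mathbf 1)=\mathbf 1$. *)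

(* Defs.v *)
From HB Require Import structures.
From mathcomp Require Import all_boot all_order all_algebra.
From mathcomp Require Import finmap multiset.
From mathcomp Require Import boolp classical_sets cardinality fsbigop.
From mathcomp Require Import reals trigo.
From mathcomp Require Import complex.

Set Implicit Arguments.
Unset Strict Implicit.
Unset Printing Implicit Defensive.

Import Order.TTheory GRing.Theory Num.Theory.

Local Open Scope classical_set_scope.
Local Open Scope ring_scope.

(* All infinite sums below are the finite-support sums [\sum_(i \in A) F i] of
   [fsbigop]: they are used only where all but finitely many terms vanish. *)

Section LinearAlgebra.
Context {K : fieldType} {V : lmodType K}.

Definition subspace (W : set V) : Prop :=
  W 0 /\ forall (c : K) (u v : V), W u -> W v -> W (c *: u + v).

Definition direct_sum (I : choiceType) (W : I -> set V) : Prop :=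
  (forall i, subspace (W i)) /\
  forall v : V, exists! w : I -> V,
    [/\ forall i, W i (w i),
        finite_set [set i | w i != 0]
      & v = \sum_(i \in [set: I]) w i].

Definition family_basis (I : choiceType) (W : set V) (f : I -> V) : Prop :=
  (forall i, W (f i)) /\
  forall w : V, W w -> exists! c : I -> K,
    finite_set [set i | c i != 0] /\ w = \sum_(i \in [set: I]) c i *: f i.

End LinearAlgebra.

Section Complex.
Variable R : realType.
Local Notation C := R[i].

Definition gbinom (x : C) (j : nat) : C :=
  (\prod_(i < j) (x - i%:R)) / (j`!)%:R.

(* The integer equal to x, when x is an integer. *)
Definition to_int (x : C) : int := Num.floor (complex.Re x).

Definition omega (p : nat) : C :=
  Complex (cos (2 * pi / p%:R)) (sin (2 * pi / p%:R)).

End Complex.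

Section Lattice.
Variable R : realType.
Local Notation C := R[i].

Record graded_space := GradedSpace {
  hsort :> vectType C;
  form : hsort -> hsort -> C;
  form_linear : forall y, scalar (form^~ y);
  form_sym : forall x y, form x y = form y x;
  form_nondeg : forall x, (forall y, form x y = 0) -> x = 0;
  period : nat;
  period_gt0 : (0 < period)%N;
  (* [grading i] is the component of class i / period *)
  grading : 'I_period -> {vspace hsort};
  grading_direct : directv (\sum_i grading i);
  grading_full : (\sum_i grading i)%VS = fullv;
  form_grading : forall (i j : 'I_period) x y,
    x \in grading i -> y \in grading j ->
    ~~ (period %| i + j)%N -> form x y = 0 }.

Variable h : graded_space.
Local Notation p := (period h).

Lemma int_class_subproof (k : int) : (`|(k %% p)%Z| < p)%N.
Proof.
have p0 : p%:Z != 0 by rewrite eqz_nat -lt0n; exact: period_gt0.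
by rewrite -ltz_nat gez0_abs ?modz_ge0 // ltz_pmod // ltz_nat; exact: period_gt0.
Qed.

Definition int_class (k : int) : 'I_p := Ordinal (int_class_subproof k).

(* Elements of (1/p)Z are represented by their multiples k = p n : int. *)
Definition hcomp (k : int) : {vspace h} := grading (int_class k).

Definition hproj (k : int) (x : h) : h :=
  sumv_pi (\sum_i @grading h i)%VS (int_class k) x.

(* sigma ^ s, as sigma acts on the component k by omega ^ k *)
Definition sigma_pow (s : int) (x : h) : h :=
  \sum_(k < p) (omega R p ^ (s * k%:Z)) *: hproj k%:Z x.

(* The lattice is represented by integer coordinates in [lbasis]. *)
Definition lattice_type := 'rV[int]_(\dim (fullv : {vspace h})).

Record lattice_data := LatticeData {
  lbasis : (\dim (fullv : {vspace h})).-tuple h;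
  lbasis_basis : basis_of fullv lbasis;
  lembed : lattice_type -> h :=
    fun a => \sum_i (a ord0 i)%:~R *: tnth lbasis i;
  lattice_integral : forall (s : nat) (a b : lattice_type), (s < p)%N ->
    exists m : int, form (sigma_pow (- s%:Z) (lembed a)) (lembed b) = m%:~R;
  mexp : nat -> lattice_type -> lattice_type -> int :=
    fun s a b => to_int (form (sigma_pow (- s%:Z) (lembed a)) (lembed b));
  cocycle : lattice_type -> lattice_type -> C;
  cocycle_neq0 : forall a b, cocycle a b != 0;
  cocycleP : forall a b c,
    cocycle a b * cocycle (a + b) c = cocycle a (b + c) * cocycle b c;
  cocycle_comm : forall a b,
    cocycle a b / cocycle b a =
      (-1) ^ (to_int (form (lembed a) (lembed a)) *
              to_int (form (lembed b) (lembed b)) +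
              to_int (p%:R * form (hproj 0 (lembed a)) (hproj 0 (lembed b))))
      * omega R p ^ (- \sum_(1 <= s < p) s%:Z * mexp s a b) }.

Variable L : lattice_data.

Definition varkappa (a b : lattice_type) : C :=
  cocycle L a b * p%:R ^ (- to_int (form (lembed L a) (lembed L b))) *
  \prod_(1 <= s < p) (1 - omega R p ^+ s) ^ mexp L s a b.

End Lattice.

Section VertexSuperalgebra.
Variable R : realType.
Local Notation C := R[i].

(* [true] is the odd parity; [nprod n a b] is a_(n) b. *)
Record vertex_superalgebra := VertexSuperalgebra {
  vsort :> lmodType C;
  parity : bool -> set vsort;
  parity_direct : direct_sum parity;
  vacuum : vsort;
  vacuum_even : parity false vacuum;
  nprod : int -> vsort -> vsort -> vsort;
  nprod_linear_l : forall n b, linear (fun a => nprod n a b);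
  nprod_linear_r : forall n a, linear (nprod n a);
  nprod_parity : forall n x y a b,
    parity x a -> parity y b -> parity (x (+) y) (nprod n a b);
  nprod_trunc : forall a b,
    exists N : int, forall n : int, N <= n -> nprod n a b = 0;
  vacuum_l : forall n a, nprod n vacuum a = if n == -1 then a else 0;
  vacuum_r : forall a, nprod (-1) a vacuum = a;
  vacuum_r0 : forall (n : int) a, 0 <= n -> nprod n a vacuum = 0;
  borcherds : forall (m n k : int) x y a b c, parity x a -> parity y b ->
    \sum_(j \in [set: nat])
       gbinom (m%:~R : C) j *: nprod (m + k - j%:Z) (nprod (n + j%:Z) a b) c =
    \sum_(j \in [set: nat])
       ((-1) ^+ j * gbinom (n%:~R : C) j) *:
         (nprod (m + n - j%:Z) a (nprod (k + j%:Z) b c)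
          - ((-1) ^ n * (-1) ^+ (x && y)%B) *:
              nprod (n + k - j%:Z) b (nprod (m + j%:Z) a c)) }.

Definition vD (A : vertex_superalgebra) (a : A) : A := nprod (-2) a (vacuum A).

Variables (h : graded_space R) (L : lattice_data h).
Local Notation emb := (lembed L).
Local Notation int_form a b := (to_int (form (emb a) (emb b))).

Record lattice_structure (A : vertex_superalgebra) := LatticeStructure {
  component : lattice_type h -> set A;
  component_direct : direct_sum component;
  component_parity : forall a v,
    component a v -> parity (odd `|int_form a a|) v;
  tilde : h -> A;
  tilde_linear : linear tilde;
  tilde_even : forall x, parity false (tilde x);
  X : lattice_type h -> A;
  X_component : forall a, component a (X a);
  X_0 : X 0 = cocycle L 0 0 *: vacuum A;
  tilde_tilde : forall (n : int) x y, 0 <= n ->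
    nprod n (tilde x) (tilde y) = if n == 1 then form x y *: vacuum A else 0;
  tilde_X : forall (n : int) x a, 0 <= n ->
    nprod n (tilde x) (X a) = if n == 0 then form x (emb a) *: X a else 0;
  D_X : forall a, vD (X a) = nprod (-1) (tilde (emb a)) (X a);
  (* The pair (i, n) in a multiset stands for the operator h_i (-(n+1)). *)
  component_basis : forall (b : (\dim (fullv : {vspace h})).-tuple h) a,
    basis_of fullv b ->
    family_basis (component a)
      (fun M : {mset ('I_(\dim (fullv : {vspace h})) * nat)%type}%mset =>
         foldr (fun u v => nprod (- (u.2.+1)%:Z) (tilde (tnth b u.1)) v)
               (X a) (enum_mset M));
  X_X : forall a b (n : nat),
    nprod (- int_form a b - n%:Z - 1) (X a) (X b) =
      (varkappa L a b / (n`!)%:R) *: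
        iter n (fun v => vD v - nprod (-1) (tilde (emb b)) v) (X (a + b));
  X_X0 : forall a b (n : int), - int_form a b <= n ->
    nprod n (X a) (X b) = 0 }.

End VertexSuperalgebra.

Section GeneralizedModule.
Variables (R : realType) (V : lmodType R[i]).
Local Notation C := R[i].

(* [f : gseries] stands for the sum over n of f(n) z^(-n-1) *)
Definition gseries := C -> V -> V.

(* F{V}, the span of the truncated series with exponents in one class mod Z *)
Definition is_field (f : gseries) : Prop :=
  [/\ forall n, linear (f n),
      exists s : seq C, forall n : C,
        (forall (l : C) (k : int), l \in s -> n <> l + k%:~R) ->
        forall v, f n v = 0
    & forall (n : C) v, exists N : nat, forall j : nat, (N <= j)%N ->
        f (n + j%:R) v = 0].

(* F{V}^[l] *)
Definition is_field_class (l : C) (f : gseries) : Prop :=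
  is_field f /\
  forall n : C, (forall k : int, n <> l + k%:~R) -> forall v, f n v = 0.

Definition one_series : gseries := fun n v => if n == -1 then v else 0.

(* coefficientwise form of
   (z-w)^N (f(w) g(z) - (-1)^(xy) g(z) f(w)) = 0 *)
Definition local (x y : bool) (f g : gseries) : Prop :=
  exists N : nat, forall (m n : C) v,
    \sum_(s < N.+1) ((-1) ^+ s * ('C(N, s))%:R) *:
       (f (m + s%:R) (g (n + (N - s)%:R) v)
        - (-1) ^+ (x && y)%B *: g (n + (N - s)%:R) (f (m + s%:R) v)) = 0.

(* f0_(n) g0 for integral series; the second sum, over integers s <= n, is
   indexed by t = n - s. *)
Definition nprod0 (x y : bool) (f0 : int -> V -> V) (n : int)
    (g0 : int -> V -> V) : int -> V -> V :=
  fun m v =>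
    \sum_(s \in [set: nat]) ((-1) ^+ s * gbinom (n%:~R : C) s) *:
       f0 (n - s%:Z) (g0 (m + s%:Z) v)
    - (-1) ^+ (x && y)%B *:
      \sum_(t \in [set: nat]) ((-1) ^ (n - t%:Z) * gbinom (n%:~R : C) t) *:
         g0 (m + n - t%:Z) (f0 t%:Z v).

(* z^l f0(z); the sum has at most one term *)
Definition zmul (l : C) (f0 : int -> V -> V) : gseries :=
  fun m v => \sum_(k \in [set k : int | k%:~R - l = m]) f0 k v.

(* the integral series f0 such that z^l f0(z) is the part of f with exponents
   in l + Z *)
Definition zpart (l : C) (f : gseries) : int -> V -> V :=
  fun k v => f (k%:~R - l) v.

Definition nprodz (x y : bool) (l mu : C) (f0 : int -> V -> V) (n : int)
    (g0 : int -> V -> V) : gseries :=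
  fun m v => \sum_(j \in [set: nat])
    gbinom l j *: zmul (l + mu - j%:R) (nprod0 x y f0 (n + j%:Z) g0) m v.

(* Representatives of C / Z, used to write f and g as sums of series
   z^l f0(z) and extend the product bilinearly; nprodz does not depend on the
   choice of the representatives l, mu for local series. *)
Definition class_reps : set C := [set l | 0 <= complex.Re l < 1].

Definition gnprod (x y : bool) (f : gseries) (n : int) (g : gseries) : gseries :=
  fun m v => \sum_(lm \in class_reps `*` class_reps)
    nprodz x y lm.1 lm.2 (zpart lm.1 f) n (zpart lm.2 g) m v.

Record generalized_module (A : vertex_superalgebra R) := GeneralizedModule {
  gpi : A -> gseries;
  gpi_linear : forall m v, linear (fun a => gpi a m v);
  gpi_field : forall a, is_field (gpi a);
  gpi_local : forall x y a b, parity x a -> parity y b ->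
    local x y (gpi a) (gpi b);
  gpi_nprod : forall x y a b (n : int) m v, parity x a -> parity y b ->
    gpi (nprod n a b) m v = gnprod x y (gpi a) n (gpi b) m v;
  gpi_vacuum : forall m v, gpi (vacuum A) m v = one_series m v }.

End GeneralizedModule.

Section TwistedModules.
Variables (R : realType) (h : graded_space R) (L : lattice_data h).
Variable V : lmodType R[i].
Local Notation C := R[i].
Local Notation p := (period h).
Local Notation emb := (lembed L).

(* [act k a] is the operator a(k/p), [cc] the central element. *)
Definition is_H_module (act : int -> h -> V -> V) (cc : V -> V) : Prop :=
  [/\ forall k a, linear (act k a) /\ act k a =1 act k (hproj k a),
      forall k v, linear (fun a => act k a v),
      linear cc /\ forall k a v, cc (act k a v) = act k a (cc v)
    & forall (k l : int) a b v, a \in hcomp h k -> b \in hcomp h l ->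
        act k a (act l b v) - act l b (act k a v) =
          if k + l == 0 then (k%:~R / p%:R * form a b) *: cc v else 0].

(* Modules over the twisted group algebra of the lattice, whose unit is
   cocycle(0,0)^-1 e(0).  This is the same as an action of the central
   extension of the lattice by C^* in which c e(a) acts by c *: e a. *)
Definition is_R_module (e : lattice_type h -> V -> V) : Prop :=
  [/\ forall a, linear (e a),
      forall v, (cocycle L 0 0)^-1 *: e 0 v = v
    & forall a b v, e a (e b v) = cocycle L a b *: e (a + b) v].

Definition is_HR_module (act : int -> h -> V -> V) (cc : V -> V)
    (e : lattice_type h -> V -> V) : Prop :=
  [/\ is_H_module act cc, is_R_module e
    & forall (k : int) x a v, x \in hcomp h k ->
        act k x (e a v) - e a (act k x v) =
          if k == 0 then form x (emb a) *: e a v else 0].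

Definition weight := 'Hom(subvs_of (hcomp h 0), C^o).

Definition weight_space (act : int -> h -> V -> V) (xi : weight) : set V :=
  [set v | forall x : subvs_of (hcomp h 0), act 0 (vsval x) v = xi x *: v].

Definition h0_diagonalizable (act : int -> h -> V -> V) : Prop :=
  direct_sum (weight_space act).

(* Operator-valued power series in one variable t, with coefficients A k. *)
Definition opmul (A B : nat -> V -> V) : nat -> V -> V :=
  fun k v => \sum_(i < k.+1) A i (B (k - i)%N v).

Definition opone : nat -> V -> V := fun k v => if k == 0%N then v else 0.

(* The exponential of A when A 0 = 0, so that A^r only has terms of degree at
   least r. *)
Definition opexp (A : nat -> V -> V) : nat -> V -> V :=
  fun k v => \sum_(r < k.+1) (r`!)%:R^-1 *: iter r (opmul A) opone k v.

(* coefficients of E_+ in t = z^(-1/p) and of E_- in t = z^(1/p) *)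
Definition E_plus (act : int -> h -> V -> V) (a : lattice_type h) :
    nat -> V -> V :=
  opexp (fun k v => if k == 0%N then 0
                    else - (k%:R / p%:R)^-1 *: act k%:Z (emb a) v).

Definition E_minus (act : int -> h -> V -> V) (a : lattice_type h) :
    nat -> V -> V :=
  opexp (fun k v => if k == 0%N then 0
                    else - (- k%:R / p%:R)^-1 *: act (- k%:Z) (emb a) v).

(* The coefficient of z^(-m-1) in
   e(a) E_-(a,z) E_+(a,z) z^(a(0)) z^(-(a'|a')/2) v  for v of weight xi. *)
Definition vertex_operator (act : int -> h -> V -> V)
    (e : lattice_type h -> V -> V) (a : lattice_type h) (xi : weight)
    (m : C) (v : V) : V :=
  let a0 := hproj 0 (emb a) in
  let a' := emb a - a0 in
  e a (\sum_(ij \in [set ij : nat * nat |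
           (ij.1%:R - ij.2%:R) / p%:R + xi (vsproj (hcomp h 0) a0)
           - form a' a' / 2 = - m - 1])
         E_minus act a ij.1 (E_plus act a ij.2 v)).

End TwistedModules.

(* The action on V of a(k/p), as a coefficient of the series of tilde a. *)
Definition H_action (R : realType) (h : graded_space R) (L : lattice_data h)
    (A : vertex_superalgebra R) (S : lattice_structure L A)
    (V : lmodType R[i]) (M : generalized_module V A) :
    int -> h -> V -> V :=
  fun k a => gpi M (tilde S (hproj k a)) (k%:~R / (period h)%:R).

(* Main.v *)
(* Let X_a(z) = pi(X_a)(z).  The Borcherds products with the currents give
   [h(n), X_a(z)] = (h|a) z^n X_a(z), and D X_a = a_(-1) X_a gives a first-order
   differential equation for X_a(z).  The product X_(-a) X_a, a multiple of 1,
   bounds how far X_a(z) u and X_(-a)(z) u can both vanish when u is nonzero, while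
   the differential equation lowers the bound for X_a(z) each time the highest mode
   a(n), n > 0, that does not kill u is applied to u.  Hence the positive modes of a
   act nilpotently on every weight vector, so E_+(a,z) v is a finite sum.  Then
   E_-(-a,z) X_a(z) commutes with the modes h(n), n > 0, and the differential
   equation shows that it maps v to e(a) E_+(a,z) v up to a power of z; this defines
   e(a).
   Exchanging E_+(a,z) and E_-(b,w) produces prod_s (1 - omega^s t)^(m_s) with
   t = (w/z)^(1/p).  When the residue expressing the product of X_a and X_b is
   computed from it, a contribution of p^(-(a|b)) prod_(s > 0) (1 - omega^s)^(m_s)
   is left, which matches varkappa and yields e(a) e(b) = cocycle(a,b) e(a+b).
   Both this relation and uniqueness use that an operator commuting with the
   modes a(n), n < 0, is determined on v by its values on the coefficients of
   E_-(a,z) E_+(a,z) v. *)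
From HB Require Import structures.
From mathcomp Require Import all_boot all_order all_algebra.
From mathcomp Require Import finmap.
From mathcomp Require Import boolp classical_sets cardinality fsbigop.
From mathcomp Require Import reals trigo complex.
From mathcomp Require Import zify ring lra.
Require Import Defs.

Set Implicit Arguments.
Unset Strict Implicit.
Unset Printing Implicit Defensive.

Import Order.TTheory GRing.Theory Num.Theory.

Local Open Scope ring_scope.

(** * Finite sums and binomial coefficients *)

(** Products of series with fractional exponents are defined through representatives of C/Z, which
    are awkward to compute with. So the coefficients of [f(z) g(w)] with fixed total index are
    treated as one function on C: multiplication by [z - w] is the difference operator, locality is
    equality of N-th differences [G], and the n-th product becomes the finite sum over a of
    [binom(-a-1, N-1-n) G(a)], free of representatives. The same formula explains the constant in
    [X_a X_b]. The exchange factor may have poles, but [(1 - t^p)^N = prod_s (1 - omega^s t)^N]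
    turns it into a polynomial with the factor [(1 - t)^(m_0 + N)]. Pairing with the binomial, whose
    degree in the index is exactly [m_0 + N], leaves [p^(-m_0-N)] times the remaining factors at
    [t = 1], and [prod_(s>0) (1 - omega^s)^N = p^N]. V is not assumed to have a grading bounded
    below, so finiteness of [E_+(a,z) v] has to be earned; hence the nilpotency argument. The
    exponent of z at which e(a) is read off depends on the weight, so e(a) is built on each weight
    space and then glued. *)

Section FiniteSums.
Variable V : zmodType.

Lemma fsum_seq (I : choiceType) (r : seq I) (F : I -> V) : uniq r ->
  (forall i, i \notin r -> F i = 0) ->
  \sum_(i \in [set: I]) F i = \sum_(i <- r) F i.
Proof.
move=> ur F0; rewrite (fsbigE r) //; last by move=> i _; apply: F0.
by apply: eq_bigl => i; rewrite in_setT.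
Qed.

Lemma fsum_inj (I J : choiceType) (r : seq I) (g : I -> J) (F : J -> V) :
  uniq r -> injective g -> (forall j, j \notin map g r -> F j = 0) ->
  \sum_(j \in [set: J]) F j = \sum_(i <- r) F (g i).
Proof.
by move=> ur ig F0; rewrite (fsum_seq _ F0) ?map_inj_uniq // big_map.
Qed.

Lemma fsum_nat (B : nat) (F : nat -> V) : (forall i, (B <= i)%N -> F i = 0) ->
  \sum_(i \in [set: nat]) F i = \sum_(i < B) F i.
Proof.
move=> F0; rewrite (@fsum_seq _ (iota 0 B)) ?iota_uniq //.
  by rewrite -[B in iota _ B]subn0 -/(index_iota 0 B) big_mkord.
by move=> i; rewrite mem_iota add0n /= -leqNgt; apply: F0.
Qed.

Definition int_seq (A B : nat) : seq int :=
  [seq - i.+1%:Z | i <- iota 0 A] ++ [seq i%:Z | i <- iota 0 B].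

Lemma int_seq_uniq A B : uniq (int_seq A B).
Proof.
rewrite cat_uniq !map_inj_uniq ?iota_uniq /= ?andbT.
- by apply/hasPn => _ /mapP[i _ ->]; apply/mapP => -[j _]; lia.
- by move=> i j; lia.
- by move=> i j; lia.
Qed.

Lemma mem_int_seq A B k : (k \in int_seq A B) = (- A%:Z <= k < B%:Z).
Proof.
rewrite mem_cat; apply/orP/idP.
  by case=> /mapP[j]; rewrite mem_iota => ? ->; lia.
case: k => k kAB; [right|left]; apply/mapP; exists k => //.
- by rewrite mem_iota; lia.
- by rewrite mem_iota; lia.
Qed.

Lemma fsum_int (A B : nat) (F : int -> V) :
  (forall k, k < - A%:Z -> F k = 0) -> (forall k, B%:Z <= k -> F k = 0) ->
  \sum_(k \in [set: int]) F k =
  \sum_(i < A) F (- i.+1%:Z) + \sum_(i < B) F i%:Z.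
Proof.
move=> FA FB; rewrite (@fsum_seq _ (int_seq A B)) ?int_seq_uniq //.
  rewrite big_cat !big_map /= -[A in iota _ A]subn0 -/(index_iota 0 A) big_mkord.
  by rewrite -[B in iota _ B]subn0 -/(index_iota 0 B) big_mkord.
move=> k; rewrite mem_int_seq negb_and -leNgt -ltNge => /orP[/FA//|/FB//].
Qed.

Lemma sum_tri (n : nat) (F : nat -> nat -> V) :
  \sum_(i < n) \sum_(j < n - i) F i j = \sum_(k < n) \sum_(i < k.+1) F i (k - i)%N.
Proof.
elim: n => [|n IH]; first by rewrite !big_ord0.
rewrite [RHS]big_ord_recr /= -IH [LHS]big_ord_recr /= subSnn big_ord_recl big_ord0.
rewrite addr0 [in RHS]big_ord_recr /= subnn addrA; congr (_ + _).
rewrite -big_split /=; apply: eq_bigr => i _.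
by rewrite subSn ?big_ord_recr //= ltnW.
Qed.

Lemma sum_tri_exchange (n : nat) (F : nat -> nat -> V) :
  \sum_(i < n) \sum_(j < n - i) F i j = \sum_(j < n) \sum_(i < n - j) F i j.
Proof.
rewrite sum_tri (sum_tri n (fun j i => F i j)); apply: eq_bigr => k _.
rewrite (reindex_inj rev_ord_inj) /=; apply: eq_bigr => i _.
by rewrite subSS subKn // -ltnS.
Qed.

End FiniteSums.

Section Binomial.
Variable R : realType.
Local Notation C := R[i].
Implicit Types (x y : C) (j d : nat).

Lemma natC_neq0 n : (n.+1%:R : C) != 0.
Proof. by rewrite pnatr_eq0. Qed.

Lemma gbinom0 x : gbinom x 0 = 1.
Proof. by rewrite /gbinom big_ord0 fact0 divr1. Qed.

Lemma factC_neq0 n : (n`!%:R : C) != 0.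
Proof. by rewrite pnatr_eq0 -lt0n fact_gt0. Qed.

Lemma gbinomSl x j : j.+1%:R * gbinom x j.+1 = (x - j%:R) * gbinom x j.
Proof.
rewrite /gbinom big_ord_recr /= factS natrM.
move: (natC_neq0 j) (factC_neq0 j); set c := j.+1%:R; set d := _`!%:R.
by move: c d (\prod_(_ < _) _) j%:R => c d z e c0 d0; field; rewrite c0 d0.
Qed.

Lemma gbinomS_absorb x j : j.+1%:R * gbinom (x + 1) j.+1 = (x + 1) * gbinom x j.
Proof.
rewrite /gbinom big_ord_recl /= factS natrM subr0.
under eq_bigr => k _ do rewrite /= /bump /= -natr1 (addrC k%:R) opprD addrA addrK.
move: (natC_neq0 j) (factC_neq0 j); set c := j.+1%:R; set d := _`!%:R.
by move: c d (\prod_(_ < _) _) => c d z c0 d0; field; rewrite c0 d0.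
Qed.

Lemma gbinomS x j : gbinom (x + 1) j.+1 = gbinom x j.+1 + gbinom x j.
Proof.
apply: (mulfI (natC_neq0 j)); rewrite gbinomS_absorb mulrDr gbinomSl -mulrDl.
by congr (_ * _); rewrite -natr1; ring.
Qed.

Lemma gbinom1 x : gbinom x 1 = x.
Proof. by rewrite /gbinom big_ord_recl big_ord0 subr0 mulr1 (_ : 1`! = 1%N) ?divr1. Qed.

Lemma gbinom_nat (n : nat) j : gbinom (n%:R : C) j = 'C(n, j)%:R.
Proof.
elim: n j => [|n IH] [|j]; rewrite ?gbinom0 ?bin0 //.
  by rewrite /gbinom big_ord_recl subr0 !mul0r bin0n.
by rewrite -natr1 gbinomS !IH binS natrD.
Qed.

Lemma gbinomN d j : gbinom (- d.+1%:R : C) j = (-1) ^+ j * 'C(d + j, j)%:R.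
Proof.
elim: j => [|j IH]; first by rewrite gbinom0 bin0 mulr1.
have E : (j.+1%:R : C) * 'C(d + j.+1, j.+1)%:R = (d + j).+1%:R * 'C(d + j, j)%:R.
  by rewrite -!natrM addnS -mul_bin_diag.
apply: (mulfI (natC_neq0 j)); rewrite gbinomSl IH [RHS]mulrCA E exprS.
by rewrite -addSn natrD; ring.
Qed.

(** Induction on d: the factor [d+1] is split as [j + (d+1-j)], each half is lowered by [gbinomSl],
    and the two factors [x - j] and [y - (d-j)] add up to [x + y - d]. *)
Lemma gbinom_Vandermonde x y d :
  \sum_(j < d.+1) gbinom x j * gbinom y (d - j) = gbinom (x + y) d.
Proof.
elim: d => [|d IH]; first by rewrite big_ord_recl big_ord0 !gbinom0 mulr1 addr0.
apply: (mulfI (natC_neq0 d)); rewrite gbinomSl -IH.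
have -> : d.+1%:R * \sum_(j < d.+2) gbinom x j * gbinom y (d.+1 - j) =
  \sum_(j < d.+2) (j%:R * gbinom x j) * gbinom y (d.+1 - j) +
  \sum_(j < d.+2) gbinom x j * ((d.+1 - j)%:R * gbinom y (d.+1 - j)).
  rewrite -big_split mulr_sumr; apply: eq_bigr => j _ /=.
  have jd : (j <= d.+1)%N by rewrite -ltnS.
  by rewrite natrB //; ring.
rewrite big_ord_recl !mul0r add0r [X in _ + X]big_ord_recr subnn /= mul0r mulr0 addr0.
rewrite -big_split mulr_sumr; apply: eq_bigr => j _ /=.
have jd : (j <= d)%N by rewrite -ltnS.
rewrite /bump /= add1n subSS gbinomSl subSn // gbinomSl natrB //.
by ring.
Qed.

End Binomial.

(** * Locality and residues *)

Section Residue.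
Variables (R : realType) (V : lmodType R[i]).
Local Notation C := R[i].

(** On the coefficients of [f(z) g(w)] with fixed total index, this is multiplication by [z - w]. It
    is used both over C and along a class [a + Z], hence the variable ring. *)
Definition fdiff (U : nzRingType) (phi : U -> V) : U -> V :=
  fun a => phi (a + 1) - phi a.

Lemma iter_fdiffE (U : nzRingType) N (phi : U -> V) a :
  iter N (@fdiff U) phi a =
  (-1) ^+ N *: \sum_(s < N.+1) ((-1) ^+ s * ('C(N, s))%:R : C) *: phi (a + s%:R).
Proof.
elim: N a => [|N IH] a.
  by rewrite big_ord_recl big_ord0 /= bin0 mul1r !scale1r !addr0.
rewrite iterS {1}/fdiff !IH -scalerBr.
have -> : \sum_(s < N.+2) ((-1) ^+ s * ('C(N.+1, s))%:R : C) *: phi (a + s%:R) =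
   \sum_(s < N.+1) ((-1) ^+ s * ('C(N, s))%:R : C) *: phi (a + s%:R) -
   \sum_(s < N.+1) ((-1) ^+ s * ('C(N, s))%:R : C) *: phi (a + 1 + s%:R).
  rewrite [LHS]big_ord_recl [X in _ = X - _]big_ord_recl !bin0 -addrA; congr (_ + _).
  rewrite -sumrN.
  under eq_bigr => s _ do rewrite lift0 binS natrD mulrDr scalerDl.
  rewrite big_split /=; congr (_ + _).
    by rewrite big_ord_recr /= bin_small // mulr0 scale0r addr0.
  apply: eq_bigr => s _; rewrite exprS mulN1r mulNr scaleNr.
  by rewrite -[s.+1%:R]natr1 [s%:R + 1]addrC addrA.
by rewrite exprS mulN1r scaleNr -scalerN opprB.
Qed.

Lemma iter_fdiff_int N (phi : C -> V) (a : C) (k : int) :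
  iter N (@fdiff int) (fun j => phi (a + j%:~R)) k =
  iter N (@fdiff C) phi (a + k%:~R).
Proof.
rewrite !iter_fdiffE; congr (_ *: _); apply: eq_bigr => s _.
by rewrite rmorphD /= addrA rmorph_nat.
Qed.

Lemma iter_fdiffB (U : nzRingType) N (phi psi : U -> V) a :
  iter N (@fdiff U) (fun x => phi x - psi x) a =
  iter N (@fdiff U) phi a - iter N (@fdiff U) psi a.
Proof.
rewrite !iter_fdiffE -scalerBr -sumrB; congr (_ *: _).
by apply: eq_bigr => s _; rewrite scalerBr.
Qed.

(** Truncation of g makes [f(z) g(w) v] bounded below in the index of f; truncation of f makes
    [g(w) f(z) v] bounded above. *)
Definition lbounded (phi : int -> V) := exists B, forall a, a < B -> phi a = 0.
Definition ubounded (psi : int -> V) := exists B, forall a, B <= a -> psi a = 0.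

Lemma lbounded_diff phi : lbounded phi -> lbounded (fdiff phi).
Proof.
by case=> B H; exists (B - 1) => a aB; rewrite /fdiff !H ?subr0 //; lia.
Qed.

Lemma ubounded_diff phi : ubounded phi -> ubounded (fdiff phi).
Proof.
by case=> B H; exists B => a aB; rewrite /fdiff !H ?subr0 //; lia.
Qed.

Lemma lbounded_iter N phi : lbounded phi -> lbounded (iter N (@fdiff int) phi).
Proof. by move=> H; elim: N => //= N /lbounded_diff. Qed.

Lemma ubounded_iter N phi : ubounded phi -> ubounded (iter N (@fdiff int) phi).
Proof. by move=> H; elim: N => //= N /ubounded_diff. Qed.

Lemma lbounded_nat phi (k : int) : lbounded phi ->
  exists B : nat, forall i : nat, (B <= i)%N -> phi (k - i%:Z) = 0.
Proof.
by case=> B H; exists `|k - B|.+1%N => i iB; apply: H; lia.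
Qed.

Lemma ubounded_nat psi (k : int) : ubounded psi ->
  exists B : nat, forall i : nat, (B <= i)%N -> psi (k + i%:Z) = 0.
Proof.
by case=> B H; exists `|k - B|%N => i iB; apply: H; lia.
Qed.

(* [Res_z (z - w)^n f(z) g(w)] with the two expansions of [(z - w)^n], in terms
   of the coefficients phi of [f(z) g(w)] and psi of [g(w) f(z)]. *)
Definition nres (n : int) (phi psi : int -> V) : V :=
  \sum_(s \in [set: nat]) ((-1) ^+ s * gbinom (n%:~R : C) s) *: phi (n - s%:Z)
  - \sum_(t \in [set: nat]) ((-1) ^ (n - t%:Z) * gbinom (n%:~R : C) t) *: psi t%:Z.

Lemma fsum_by_parts (c c' : nat -> C) (x : nat -> V) (B : nat) :
  (forall i, (B <= i)%N -> x i = 0) ->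
  c' 0%N = c 0%N -> (forall i, c' i.+1 = c i.+1 - c i) ->
  \sum_(s \in [set: nat]) c s *: (x s - x s.+1) =
  \sum_(s \in [set: nat]) c' s *: x s.
Proof.
move=> x0 c0 cS.
rewrite (@fsum_nat _ B) => [|i iB]; last by rewrite !x0 ?subrr ?scaler0 // leqW.
rewrite (@fsum_nat _ B.+1) => [|i iB]; last by rewrite x0 ?scaler0 // ltnW.
rewrite big_ord_recl c0.
under [in RHS]eq_bigr => i _ do rewrite lift0 cS scalerBl.
under [in LHS]eq_bigr => i _ do rewrite scalerBr.
rewrite !sumrB addrA; congr (_ - _).
by rewrite -(big_ord_recl B (fun i => c i *: x i)) big_ord_recr /= x0 ?scaler0 ?addr0.
Qed.

Lemma exprzN1_subS (n t : int) : (-1) ^ (n - (t + 1)) = - (-1) ^ (n - t) :> C.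
Proof.
have -> : n - t = n - (t + 1) + 1 by lia.
by rewrite [in RHS]exprzDr ?unitrN1 // expr1z mulrN1 opprK.
Qed.

(** [(z - w)^(n+1) = (z - w)^n (z - w)] holds in either expansion. On coefficients this is Pascal's
    rule followed by summation by parts, the bounds removing the boundary terms. *)
Lemma nres_diff n phi psi : lbounded phi -> ubounded psi ->
  nres (n + 1) phi psi = nres n (fdiff phi) (fdiff psi).
Proof.
move=> /(lbounded_nat (n + 1))[B phi0] /(ubounded_nat 0)[B' psi0]; rewrite /nres.
congr (_ - _).
  rewrite -(@fsum_by_parts (fun s => (-1) ^+ s * gbinom (n%:~R : C) s) _
     (fun s => phi (n + 1 - s%:Z)) B) //=.
  - by apply: eq_fsbigr => s _; rewrite /fdiff; congr (_ *: (phi _ - phi _)); lia.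
  - by rewrite !gbinom0.
  - by move=> i; rewrite exprS intrD /= gbinomS; ring.
rewrite -(@fsum_by_parts (fun t => - ((-1) ^ (n - t%:Z) * gbinom (n%:~R : C) t)) _
     (fun s => psi s%:Z) B') //=.
- apply: eq_fsbigr => s _; rewrite /fdiff scaleNr -scalerN opprB.
  by congr (_ *: (psi _ - psi _)); lia.
- by rewrite !gbinom0 !mulr1 !subr0 exprzDr ?unitrN1 // expr1z mulrN1.
- move=> i; rewrite intrD /= gbinomS -[i.+1]addn1 PoszD.
  rewrite (_ : n + 1 - (i%:Z + 1) = n - i%:Z); last by lia.
  rewrite exprzN1_subS; ring.
Qed.

Lemma nres_iter_diff N n phi psi : lbounded phi -> ubounded psi ->
  nres n phi psi =
  nres (n - N%:Z) (iter N (@fdiff int) phi) (iter N (@fdiff int) psi).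
Proof.
move=> Hphi Hpsi; elim: N => [|N IH]; first by rewrite subr0.
rewrite IH /= -nres_diff; [|exact: lbounded_iter|exact: ubounded_iter].
by congr nres; lia.
Qed.

(** For a nonnegative exponent both expansions are the same polynomial, read in opposite orders. *)
Lemma nres_diag_ge0 (n : nat) G : nres n%:Z G G = 0.
Proof.
rewrite /nres !(@fsum_nat _ n.+1).
- rewrite (reindex_inj rev_ord_inj) /= -sumrB big1 // => i _.
  rewrite subSS -pmulrn !gbinom_nat bin_sub -1?ltnS //.
  rewrite subzn ?leq_subr // subKn -1?ltnS // subzn -1?ltnS //.
  by rewrite -exprnP subrr.
- by move=> i ni; rewrite -pmulrn gbinom_nat bin_small // mulr0 scale0r.
- by move=> i ni; rewrite -pmulrn gbinom_nat bin_small // mulr0 scale0r.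
Qed.

(** The two expansions of [(z - w)^(-d-1)] differ by the d-th divided derivative of the delta
    function, whose coefficients are given by one polynomial in the index. *)
Lemma nres_diag_lt0 (d : nat) G : lbounded G -> ubounded G ->
  nres (- d.+1%:Z) G G =
  \sum_(a \in [set: int]) gbinom (- a%:~R - 1 : C) d *: G a.
Proof.
move=> /(lbounded_nat 0)[B HB] /(ubounded_nat 0)[B' HB'].
(* The [d] extra negative places are [a = -1, ..., -d], where [binom(-a-1, d)] vanishes: the
   expansion in powers of w/z only starts at [a = -d-1]. *)
rewrite [RHS](@fsum_int _ (d + B) B').
- rewrite /nres; congr (_ + _).
    rewrite (@fsum_nat _ B) => [|i iB]; last first.
      rewrite (_ : _ - _ = 0 - (d.+1 + i)%:Z); last by lia.
      by rewrite HB ?scaler0 //; lia.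
    rewrite big_split_ord /= [X in X + _]big1 ?add0r => [|i _].
      apply: eq_bigr => i _; rewrite mulrNz -pmulrn gbinomN mulrA -exprD addnn.
      rewrite -[(i.*2)]muln2 mulnC exprM sqrrN !expr1n mul1r.
      rewrite (_ : - (- _)%:~R - 1 = (d + i)%:R :> C); last first.
        by rewrite mulrNz opprK -pmulrn -natr1 addrK.
      rewrite gbinom_nat -[in LHS]bin_sub ?leq_addl // addnK.
      by congr (_ *: G _); lia.
    rewrite (_ : - (- _)%:~R - 1 = i%:R :> C) ?gbinom_nat ?bin_small ?scale0r //.
    by rewrite mulrNz opprK -pmulrn -natr1 addrK.
  rewrite (@fsum_nat _ B') => [|i iB]; last by rewrite -[_%:Z]add0r HB' ?scaler0.
  rewrite -sumrN; apply: eq_bigr => i _; rewrite -scaleNr; congr (_ *: _).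
  rewrite mulrNz -pmulrn gbinomN.
  have -> : - (i%:Z)%:~R - 1 = - (i.+1)%:R :> C by rewrite -pmulrn -opprD natr1.
  rewrite gbinomN.
  rewrite (_ : - d.+1%:Z - i%:Z = - (d.+1 + i)%:Z); last by lia.
  rewrite -exprnN -exprVn invrN1 mulrA -exprD.
  rewrite !addSn exprS mulN1r mulNr opprK -addnA addnn.
  rewrite exprD -[(i.*2)]muln2 mulnC exprM sqrrN !expr1n mulr1.
  by rewrite -[in LHS]bin_sub ?leq_addl // addnK (addnC i d).
- move=> k kB; have -> : k = 0 - `|k|%:Z by lia.
  by rewrite HB ?scaler0 //; lia.
- by move=> k kB; have -> : k = 0 + `|k|%:Z by [lia]; rewrite HB' ?scaler0 //; lia.
Qed.

(** After N differences the two families coincide, hence are bounded on both sides, and the residue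
    with exponent [n - N] is taken on the diagonal: zero for a polynomial, a delta derivative of
    order [N-1-n] otherwise. *)
Lemma nres_local N n phi psi : lbounded phi -> ubounded psi ->
  iter N (@fdiff int) phi =1 iter N (@fdiff int) psi ->
  nres n phi psi = if N%:Z <= n then 0 else
    \sum_(a \in [set: int]) gbinom (- a%:~R - 1 : C) (absz (N%:Z - 1 - n)%R) *:
        iter N (@fdiff int) phi a.
Proof.
move=> Hphi Hpsi /funext E; rewrite (nres_iter_diff N) // -E.
case: ifP => nN.
  by rewrite (_ : n - N%:Z = (absz (n - N%:Z))%:Z) ?nres_diag_ge0 //; lia.
rewrite (_ : n - N%:Z = - (absz (N%:Z - 1 - n)%R).+1%:Z); last by lia.
rewrite nres_diag_lt0 //; first exact: lbounded_iter.
by rewrite E; exact: ubounded_iter.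
Qed.

End Residue.

(** * Products of fields with non-integral exponents *)

Section ClassRepresentatives.
Variable R : realType.
Local Notation C := R[i].

Lemma cReD (x y : C) : complex.Re (x + y) = complex.Re x + complex.Re y.
Proof. by case: x y => [a b] [c d]. Qed.

Lemma cReN (x : C) : complex.Re (- x) = - complex.Re x.
Proof. by case: x. Qed.

Lemma cReB (x y : C) : complex.Re (x - y) = complex.Re x - complex.Re y.
Proof. by rewrite cReD cReN. Qed.

Lemma cReZ (k : int) : complex.Re (k%:~R : C) = k%:~R.
Proof. by rewrite -[k%:~R](rmorph_int (real_complex R)). Qed.

Lemma cRe_nat (n : nat) : complex.Re (n%:R : C) = n%:R.
Proof. by rewrite (cReZ n). Qed.

Definition Zpart_of (c : C) : int := Num.floor (complex.Re c).
Definition rep (c : C) : C := c - (Zpart_of c)%:~R.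

Lemma rep_in c : class_reps (rep c).
Proof.
rewrite /class_reps /= /rep cReB cReZ subr_ge0 floor_le /= ltrBlDr addrC.
by have := floorD1_gt (complex.Re c); rewrite intrD.
Qed.

Lemma intrC_inj : injective (intr : int -> C).
Proof. exact: intr_inj. Qed.

Lemma rep_id l : class_reps l -> rep l = l.
Proof.
rewrite /class_reps /= /rep /Zpart_of => /andP[l0 l1].
by rewrite (_ : Num.floor _ = 0) ?subr0 //; apply: floor_def; rewrite l0 l1.
Qed.

Lemma Zpart_ofD c (k : int) : Zpart_of (c + k%:~R) = Zpart_of c + k.
Proof. by rewrite /Zpart_of cReD cReZ floorDrz ?intrKfloor // intr_int. Qed.

Lemma repD c (k : int) : rep (c + k%:~R) = rep c.
Proof. by rewrite /rep Zpart_ofD intrD; ring. Qed.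

End ClassRepresentatives.

Section GeneralizedProducts.
Variables (R : realType) (V : lmodType R[i]).
Local Notation C := R[i].
Implicit Types (f g : gseries V) (T a m : C) (v : V).

Definition prodf f g T v : C -> V := fun a => f a (g (T - a) v).

Definition prodb (x y : bool) f g T v : C -> V :=
  fun a => (-1) ^+ (x && y)%B *: g (T - a) (f a v).

Definition localN N x y f g := forall T v,
  iter N (@fdiff R V C) (prodf f g T v) =1
  iter N (@fdiff R V C) (prodb x y f g T v).

Lemma local_localN x y f g : local x y f g -> exists N, localN N x y f g.
Proof.
case=> N H; exists N => T v a; apply/eqP; rewrite -subr_eq0 -iter_fdiffB.
rewrite iter_fdiffE; move: (H a (T - a - N%:R) v) => E.
rewrite [X in _ *: X](_ : _ = 0) ?scaler0 // -[RHS]E.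
apply: eq_bigr => s _; congr (_ *: _); rewrite /prodf /prodb.
have sN : (s <= N)%N by rewrite -ltnS.
by rewrite natrB // (_ : T - a - _ + _ = T - (a + s%:R)) //; ring.
Qed.

Lemma localN_le N N' x y f g : (N <= N')%N -> localN N x y f g -> localN N' x y f g.
Proof.
move=> NN' H T v a; rewrite -(subnK NN') !iterD.
by have /funext -> : _ := H T v.
Qed.

Section Field.
Variables (f : gseries V) (Hf : is_field f).

Lemma field_linear n : linear (f n).
Proof. by case: Hf. Qed.

Lemma field0 n : f n 0 = 0.
Proof. by have := field_linear n (-1) 0 0; rewrite scaler0 addr0 scaleN1r addNr. Qed.

Lemma field_trunc n v : exists N : int, forall k : int, N <= k -> f (n + k%:~R) v = 0.
Proof.
case: Hf => _ _ /(_ n v)[N HN]; exists N => k Nk.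
by rewrite (_ : k = `|k|%N) ?HN //; lia.
Qed.

Lemma field_bound v : exists B : R, forall m, B <= complex.Re m -> f m v = 0.
Proof.
case: Hf => _ [s Hs] Htr.
suff [B HB] : exists B : R, forall m (l : C) (k : int), l \in s ->
    m = l + k%:~R -> B <= complex.Re m -> f m v = 0.
  exists B => m mB; case: (pselect (exists l k, l \in s /\ m = l + k%:~R)).
    by case=> l [k [ls E]]; exact: (HB m l k).
  by move=> N; apply: Hs => l k ls E; apply: N; exists l, k.
elim: s {Hs} => [|l s [B HB]]; first by exists 0.
have [N HN] := field_trunc l v.
exists (Num.max B (complex.Re l + N%:~R)) => m l' k; rewrite inE => /orP[/eqP->|ls] E.
  rewrite ge_max E cReD cReZ => /andP[_]; rewrite lerD2l ler_int.
  exact: HN.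
by rewrite ge_max => /andP[mB _]; exact: (HB m l' k).
Qed.

End Field.

Section Product.
Variables (f g : gseries V) (Hf : is_field f) (Hg : is_field g).

Lemma prodf_lbounded T v a : lbounded (fun k : int => prodf f g T v (a + k%:~R)).
Proof.
have [N HN] := field_trunc Hg (T - a) v; exists (- N) => k kN.
rewrite /prodf opprD addrA -mulrNz HN ?field0 //; lia.
Qed.

Lemma prodb_ubounded x y T v a :
  ubounded (fun k : int => prodb x y f g T v (a + k%:~R)).
Proof.
have [N HN] := field_trunc Hf a v; exists N => k kN.
by rewrite /prodb HN // field0 // scaler0.
Qed.

Variables (x y : bool) (N : nat) (HN : localN N x y f g).

Local Notation G T v := (iter N (@fdiff R V C) (prodf f g T v)).

Lemma local_bounds T v a :
  lbounded (fun k : int => G T v (a + k%:~R)) /\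
  ubounded (fun k : int => G T v (a + k%:~R)).
Proof.
split.
  have [B HB] := lbounded_iter N (prodf_lbounded T v a).
  by exists B => k kB; rewrite -iter_fdiff_int HB.
have [B HB] := ubounded_iter N (prodb_ubounded x y T v a).
by exists B => k kB; rewrite HN -iter_fdiff_int HB.
Qed.

(** f meets finitely many classes mod Z. On each of them the N-th difference is bounded below as a
    coefficient of [f(z) g(w)] and above, by locality, as one of [g(w) f(z)]. *)
Lemma local_support T v : exists2 r : seq C, uniq r &
  forall a, a \notin r -> G T v a = 0.
Proof.
case: (Hf) => _ [s Hs] _.
have [r Hr] : exists r : seq C, forall a l (k : int), l \in s -> a = l + k%:~R ->
    a \notin r -> G T v a = 0.
  elim: s {Hs} => [|l s [r Hr]]; first by exists [::].
  have [[B HB] [B' HB']] := local_bounds T v l.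
  exists ([seq l + k%:~R | k <- int_seq `|B| `|B'|] ++ r) => a l' k.
  rewrite inE mem_cat negb_or => /orP[/eqP->|ls] -> /andP[k1 k2].
    case: (ltP k B) => [kB|Bk]; first exact: HB.
    case: (ltP k B') => [kB'|Bk']; last exact: HB'.
    case/negP: k1; apply/mapP; exists k => //; rewrite mem_int_seq; lia.
  exact: (Hr _ l' k).
exists (undup r); first exact: undup_uniq.
move=> a; rewrite mem_undup => ar.
case: (pselect (exists l k, l \in s /\ a = l + k%:~R)) => [[l [k [ls E]]]|Nc].
  exact: (Hr a l k).
rewrite iter_fdiffE big1 ?scaler0 // => j _; rewrite /prodf Hs ?scaler0 // => l k ls E.
by apply: Nc; exists l, (k - j%:Z); rewrite intrB addrA -E addrK.
Qed.

Lemma nprod0E T v l mu n k : T = (k + n)%:~R - l - mu ->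
  nprod0 x y (zpart l f) n (zpart mu g) k v =
  nres n (fun a : int => prodf f g T v (- l + a%:~R))
         (fun a : int => prodb x y f g T v (- l + a%:~R)).
Proof.
move=> ->; rewrite /nprod0 /nres /zpart; congr (_ - _).
  apply: eq_fsbigr => s _; rewrite /prodf; congr (_ *: f _ (g _ _)).
    by rewrite addrC.
  by rewrite !intrD mulrNz; ring.
have [B HB] := field_trunc Hf (- l) v.
have B0 : forall i : nat, (`|B| <= i)%N -> f (- l + (i%:Z)%:~R) v = 0.
  by move=> i iB; apply: HB; lia.
rewrite !(@fsum_nat _ `|B|%N) ?scaler_sumr.
- apply: eq_bigr => t _; rewrite /prodb !scalerA mulrC; congr (_ *: _).
  rewrite [- l + _]addrC; congr (g _ _).
  by rewrite !intrD mulrNz; ring.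
- by move=> i iB; rewrite /prodb B0 // field0 // !scaler0.
- by move=> i iB; rewrite [_ - l]addrC B0 // field0 // !scaler0.
Qed.

(* The change of base point in [z^l]; combined with [nres_local] it shows that
   the products do not depend on the representatives of C / Z. *)
Lemma nres_Vandermonde T v l n :
  \sum_(j \in [set: nat]) gbinom l j *:
     nres (n + j%:Z) (fun a : int => prodf f g T v (- l + a%:~R))
                     (fun a : int => prodb x y f g T v (- l + a%:~R)) =
  if N%:Z <= n then 0 else
    \sum_(a \in [set: int]) gbinom (- (- l + a%:~R) - 1) (absz (N%:Z - 1 - n)%R) *:
       G T v (- l + a%:~R).
Proof.
have E j : nres (n + j%:Z) (fun a : int => prodf f g T v (- l + a%:~R))
              (fun a : int => prodb x y f g T v (- l + a%:~R)) =
    if N%:Z <= n + j%:Z then 0 else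
    \sum_(a \in [set: int]) gbinom (- a%:~R - 1 : C)
       (absz (N%:Z - 1 - (n + j%:Z))%R) *: G T v (- l + a%:~R).
  rewrite (@nres_local _ _ N).
  - by case: ifP => // _; apply: eq_fsbigr => a _; rewrite iter_fdiff_int.
  - exact: prodf_lbounded.
  - exact: prodb_ubounded.
  - by move=> a; rewrite !iter_fdiff_int HN.
under eq_fsbigr => j _ do rewrite E.
case: ifP => nN.
  by apply: fsbig1 => j _; rewrite ifT ?scaler0 //; lia.
set d := absz _; have dE : n = N%:Z - 1 - d%:Z by rewrite /d; lia.
rewrite (@fsum_nat _ d.+1) => [|j jd]; last by rewrite ifT ?scaler0 //; lia.
have [[B HB] [B' HB']] := local_bounds T v (- l).
have A0 : forall k : int, k < - `|B|%:Z -> G T v (- l + k%:~R) = 0.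
  by move=> k kB; apply: HB; lia.
have A1 : forall k : int, `|B'|%:Z <= k -> G T v (- l + k%:~R) = 0.
  by move=> k kB; apply: HB'; lia.
have F (F : int -> C) : \sum_(a \in [set: int]) F a *: G T v (- l + a%:~R) =
    \sum_(a <- int_seq `|B| `|B'|) F a *: G T v (- l + a%:~R).
  rewrite (@fsum_seq _ _ (int_seq `|B| `|B'|)) ?int_seq_uniq // => k.
  rewrite mem_int_seq negb_and -leNgt -ltNge => /orP[kB|kB].
    by rewrite A0 ?scaler0.
  by rewrite A1 ?scaler0.
rewrite F; under eq_bigr => j _.
  rewrite ifF; last by have := ltn_ord j; rewrite dE; lia.
  rewrite F scaler_sumr; over.
rewrite exchange_big /=; apply: eq_bigr => a _.
under eq_bigr => j _ do rewrite scalerA.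
rewrite -scaler_suml; congr (_ *: _).
have -> : - (- l + a%:~R) - 1 = l + (- a%:~R - 1) :> C by ring.
rewrite -gbinom_Vandermonde; apply: eq_bigr => j _; congr (_ * gbinom _ _).
by have := ltn_ord j; rewrite dE; lia.
Qed.

Lemma zmulE l (F : int -> V -> V) m (k : int) v : k%:~R - l = m ->
  zmul l F m v = F k v.
Proof.
move=> <-; rewrite /zmul (_ : mkset _ = [set k]%classic) ?fsbig_set1 //.
by apply/seteqP; split => j /=; [move/addIr/intrC_inj|move->].
Qed.

Lemma zmul0 l (F : int -> V -> V) m v : (forall k : int, k%:~R - l <> m) ->
  zmul l F m v = 0.
Proof. by move=> H; rewrite /zmul fsbig1 // => k /= /H. Qed.

Lemma nprodzE n m v l mu :
  nprodz x y l mu (zpart l f) n (zpart mu g) m v =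
  if `[< exists k : int, k%:~R = m + l + mu >] then
    if N%:Z <= n then 0 else
    \sum_(a \in [set: int]) gbinom (- (- l + a%:~R) - 1) (absz (N%:Z - 1 - n)%R) *:
       G (m + n%:~R) v (- l + a%:~R)
  else 0.
Proof.
rewrite /nprodz; case: asboolP => [[k Ek]|Nk].
  rewrite -nres_Vandermonde; apply: eq_fsbigr => j _; congr (_ *: _).
  rewrite (@zmulE _ _ _ (k - j%:Z)).
    by apply: nprod0E; rewrite !intrD Ek mulrNz; ring.
  by rewrite intrB Ek -pmulrn; ring.
apply: fsbig1 => j _; rewrite zmul0 ?scaler0 // => k Ek; apply: Nk.
by exists (k + j%:Z); rewrite -Ek intrD; ring.
Qed.

Lemma fsum_classes (h : C -> V) (r : seq C) : uniq r ->
  (forall a, a \notin r -> h a = 0) ->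
  \sum_(l \in @class_reps R) \sum_(k \in [set: int]) h (- l + k%:~R) =
  \sum_(a \in [set: C]) h a.
Proof.
move=> ur h0.
pose ls := undup [seq rep (- a) | a <- r].
pose ks := undup [seq - Zpart_of (- a) | a <- r].
have hN l k : class_reps l -> - l + k%:~R \in r -> l \in ls /\ k \in ks.
  move=> Hl lkr; split; rewrite mem_undup; apply/mapP; exists (- l + k%:~R) => //.
    by rewrite opprD opprK -mulrNz repD rep_id.
  rewrite opprD opprK -mulrNz Zpart_ofD opprD opprK.
  suff -> : Zpart_of l = 0 by rewrite oppr0 add0r.
  apply: (@intrC_inj R); rewrite -[LHS]opprK -[X in - X](addKr l) -/(rep l) rep_id //.
  by rewrite addNr oppr0.
have inls l : l \in ls -> class_reps l.
  by rewrite mem_undup => /mapP[a _ ->]; exact: rep_in.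
rewrite (fsbigE ls) ?undup_uniq //; last first.
  move=> l Hl lls; apply: fsbig1 => k _; apply: h0; apply/negP => /(hN _ _ Hl)[].
  by rewrite (negbTE lls).
rewrite -big_filter (_ : [seq l <- ls | _] = ls); last first.
  by apply/all_filterP/allP => l /inls/mem_set.
rewrite (@eq_big_seq _ _ _ _ ls _ (fun l => \sum_(k <- ks) h (- l + k%:~R))); last first.
  move=> l lls; rewrite (@fsum_seq _ _ ks) ?undup_uniq // => k kks.
  by apply: h0; apply/negP => /(hN _ _ (inls _ lls))[_]; rewrite (negbTE kks).
rewrite -(@big_allpairs_dep _ _ _ _ _ _ (fun l k => - l + k%:~R)) -fsum_seq //.
  apply: allpairs_uniq; rewrite ?undup_uniq // => -[l k] [l' k'].
  move=> /allpairsP[[l1 k1] /= [l1s _ [-> ->]]].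
  move=> /allpairsP[[l2 k2] /= [l2s _ [-> ->]]] E.
  have E1 : l1 = l2.
    rewrite -(rep_id (inls _ l1s)) -(rep_id (inls _ l2s)) -(repD l1 (- k1)) -(repD l2 (- k2)).
    by congr rep; rewrite !mulrNz -[LHS]opprK -[RHS]opprK; congr (- _); rewrite !opprD !opprK.
  by move: E; rewrite E1 => /addrI/intrC_inj ->.
move=> a an; apply: h0; apply: contra an => ar.
apply/allpairsP; exists (rep (- a), - Zpart_of (- a)); split.
- by rewrite mem_undup; apply/mapP; exists a.
- by rewrite mem_undup; apply/mapP; exists a.
- by rewrite /rep /= mulrNz; ring.
Qed.

(** Once a class of f is chosen, the index m leaves one class of g, so the double sum over
    representatives is a single one; together with the sum over integers it runs over all of C
    exactly once. *)
Lemma gnprodE n m v : gnprod x y f n g m v =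
  if N%:Z <= n then 0 else
    \sum_(a \in [set: C]) gbinom (- a - 1) (absz (N%:Z - 1 - n)%R) *:
       G (m + n%:~R) v a.
Proof.
rewrite /gnprod; under eq_fsbigr => lm _ do rewrite nprodzE.
case: ifP => nN; first by apply: fsbig1 => lm _; case: ifP.
set d := absz _; pose h a := gbinom (- a - 1) d *: G (m + n%:~R) v a.
have [r ur r0] := local_support (m + n%:~R) v.
rewrite -(@fsum_classes h r) //; last by move=> a /r0; rewrite /h => ->; rewrite scaler0.
(* The only [mu] among the representatives for which [m + l + mu] is an integer. *)
pose q l := (l, rep (- m - l)).
rewrite -(@fsbig_widen _ _ _ _ (q @` @class_reps R)%classic).
- rewrite fsbig_image; last by move=> l l' _ _ [].
  apply: eq_fsbigr => l _; rewrite asboolT //.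
  exists (- Zpart_of (- m - l)); rewrite /q /rep /= mulrNz -opprD.
  by rewrite addrA subrr add0r.
- by move=> _ [l Hl <-]; split => //; exact: rep_in.
- move=> -[l mu] [/= [Hl Hmu] Nq]; rewrite asboolF // => -[k Ek]; apply: Nq.
  exists l => //; rewrite /q -[in RHS](rep_id Hmu) -(repD mu (- k)) mulrNz Ek.
  by congr (_, rep _); ring.
Qed.

(** When f lives in one class, any base point of that class may replace its representative; products
    with a current are computed from the index i/p. *)
Lemma gnprod_class a0 n m v :
  (forall c, (forall k : int, c <> a0 + k%:~R) -> forall v, f c v = 0) ->
  gnprod x y f n g m v =
  \sum_(j \in [set: nat]) gbinom (- a0) j *:
     nres (n + j%:Z) (fun k : int => prodf f g (m + n%:~R) v (a0 + k%:~R))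
                     (fun k : int => prodb x y f g (m + n%:~R) v (a0 + k%:~R)).
Proof.
move=> Hc; rewrite gnprodE; have := nres_Vandermonde (m + n%:~R) v (- a0) n.
under eq_fsbigr => j _ do rewrite opprK.
move=> ->; case: ifP => // nN; rewrite opprK.
set d := absz _; pose h a := gbinom (- a - 1) d *: G (m + n%:~R) v a.
have G0 c : (forall k : int, c <> a0 + k%:~R) -> G (m + n%:~R) v c = 0.
  move=> Nc; rewrite iter_fdiffE big1 ?scaler0 // => j _.
  rewrite /prodf Hc ?scaler0 // => k E; apply: (Nc (k - j%:Z)).
  by rewrite intrB addrA -E addrK.
rewrite -(@fsbig_image _ _ _ _ _ setT (fun k : int => a0 + k%:~R) h); last first.
  by move=> j j' _ _ /addrI/intrC_inj.
apply/esym/fsbig_widen => // c [_ Nc] /=; rewrite /h G0 ?scaler0 // => k E.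
by apply: Nc; exists k.
Qed.

(** The commutator is the residue with exponent 0. Its coefficient [binom(-k-1, N-1)], expanded by
    Vandermonde, regroups into the coefficients [binom(-(a+k)-1, N-1-n)] of the n-th products; [a]
    may be fractional. *)
Lemma field_commutator a T v :
  (forall c, (forall k : int, c <> a + k%:~R) -> forall v, f c v = 0) ->
  (0 < N)%N ->
  prodf f g T v a - prodb x y f g T v a =
  \sum_(n < N) gbinom a n *: gnprod x y f n%:Z g (T - n%:R) v.
Proof.
move=> Hc N0.
have E0 : nres 0 (fun k : int => prodf f g T v (a + k%:~R))
                 (fun k : int => prodb x y f g T v (a + k%:~R)) =
    prodf f g T v a - prodb x y f g T v a.
  rewrite /nres !(@fsum_nat _ 1).
  - by rewrite !big_ord_recl !big_ord0 /= !gbinom0 !addr0 !mulr1 !scale1r.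
  - by move=> [//|i] _; rewrite -[0%:~R]/(0%:R) gbinom_nat bin_small // mulr0 scale0r.
  - by move=> [//|i] _; rewrite -[0%:~R]/(0%:R) gbinom_nat bin_small // mulr0 scale0r.
rewrite -E0 (@nres_local _ _ N).
- rewrite ifF; last by lia.
  have [[B HB] [B' HB']] := local_bounds T v a.
  have F (F : int -> C) : \sum_(k \in [set: int]) F k *: G T v (a + k%:~R) =
      \sum_(k <- int_seq `|B| `|B'|) F k *: G T v (a + k%:~R).
    rewrite (@fsum_seq _ _ (int_seq `|B| `|B'|)) ?int_seq_uniq // => k.
    rewrite mem_int_seq negb_and -leNgt -ltNge => /orP[kB|kB].
      by rewrite HB ?scaler0 //; lia.
    by rewrite HB' ?scaler0 //; lia.
  under eq_fsbigr => k _ do rewrite iter_fdiff_int.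
  rewrite F; apply/esym; under eq_bigr => n _.
    rewrite gnprodE ifF; last by have := ltn_ord n; lia.
    rewrite -pmulrn subrK.
    rewrite (_ : \sum_(c \in _) _ = \sum_(k \in [set: int])
       gbinom (- (a + k%:~R) - 1) (absz (N%:Z - 1 - n%:Z)%R) *: G T v (a + k%:~R)).
      rewrite F scaler_sumr; over.
    set d := absz _; pose h a := gbinom (- a - 1) d *: G T v a.
    have G0 c : (forall k : int, c <> a + k%:~R) -> G T v c = 0.
      move=> Nc; rewrite iter_fdiffE big1 ?scaler0 // => j _.
      rewrite /prodf Hc ?scaler0 // => k E; apply: (Nc (k - j%:Z)).
      by rewrite intrB addrA -E addrK.
    rewrite -(@fsbig_image _ _ _ _ _ setT (fun k : int => a + k%:~R) h); last first.
      by move=> j j' _ _ /addrI/intrC_inj.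
    apply/esym/fsbig_widen => // c [_ Nc] /=; rewrite /h G0 ?scaler0 // => k E.
    by apply: Nc; exists k.
  rewrite exchange_big /=; apply: eq_bigr => k _.
  under eq_bigr => n _ do rewrite scalerA.
  rewrite -scaler_suml; congr (_ *: _).
  case: N N0 {HB HB' F} => // N' _.
  have -> : - k%:~R - 1 = a + (- (a + k%:~R) - 1) :> C by ring.
  rewrite (_ : absz _ = N') ?(addr0, subr0); last by lia.
  rewrite -gbinom_Vandermonde; apply: eq_bigr => j _; congr (_ * gbinom _ _).
  by have := ltn_ord j; lia.
- exact: prodf_lbounded.
- exact: prodb_ubounded.
- by move=> k; rewrite !iter_fdiff_int HN.
Qed.

End Product.

End GeneralizedProducts.

(** * Exponentials of operator series *)

Section OperatorExponentials.
Variables (R : realType) (V : lmodType R[i]).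
Local Notation C := R[i].
Implicit Types (B E A : nat -> V -> V) (v : V) (O : V -> V).

Section LinearMaps.
Variables (U : lmodType C) (O : U -> V).
Hypothesis lO : linear O.

Lemma lin0 : O 0 = 0.
Proof. by have := lO (-1) 0 0; rewrite scaler0 addr0 scaleN1r addNr. Qed.

Lemma linD u w : O (u + w) = O u + O w.
Proof. by have := lO 1 u w; rewrite !scale1r. Qed.

Lemma linZ c u : O (c *: u) = c *: O u.
Proof. by have := lO c u 0; rewrite !addr0 lin0 // addr0. Qed.

Lemma linN u : O (- u) = - O u.
Proof. by rewrite -scaleN1r linZ // scaleN1r. Qed.

Lemma linB u w : O (u - w) = O u - O w.
Proof. by rewrite linD // linN. Qed.

Lemma lin_sum (I : Type) (r : seq I) (P : pred I) (F : I -> U) :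
  O (\sum_(i <- r | P i) F i) = \sum_(i <- r | P i) O (F i).
Proof.
elim/big_rec2: _ => [|i y1 y2 _ <-]; first exact: lin0.
by rewrite linD.
Qed.

End LinearMaps.

(* E = exp (sum of B_i t^i / i), as the solution of t E' = (sum of B_i t^i) E *)
Definition is_opexp B E :=
  (forall v, E 0%N v = v) /\
  forall k v, k%:R *: E k v = \sum_(i < k) B i.+1 (E (k - i.+1)%N v).

Lemma natS_scaleI k (u v : V) : (k.+1%:R : C) *: u = k.+1%:R *: v -> u = v.
Proof. by move/(scalerI (natC_neq0 R k)). Qed.

Lemma is_opexp_unique B E E' : is_opexp B E -> is_opexp B E' ->
  forall k v, E k v = E' k v.
Proof.
move=> [E0 ES] [E'0 E'S] k v; elim/ltn_ind: k => -[|k] IH; first by rewrite E0 E'0.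
apply: (@natS_scaleI k); rewrite ES E'S; apply: eq_bigr => i _.
by rewrite IH // subSS ltnS leq_subr.
Qed.

Lemma is_opexp_linear B E : (forall i, linear (B i)) -> is_opexp B E ->
  forall k, linear (E k).
Proof.
move=> lB [E0 ES] k; elim/ltn_ind: k => -[|k] IH c u v; first by rewrite !E0.
apply: (@natS_scaleI k); rewrite scalerDr scalerA mulrC -scalerA !ES.
rewrite scaler_sumr -big_split /=; apply: eq_bigr => i _.
by rewrite IH ?lB // subSS ltnS leq_subr.
Qed.

Lemma is_opexp_comm B E O : linear O ->
  (forall i v, O (B i.+1 v) = B i.+1 (O v)) ->
  is_opexp B E -> forall k v, O (E k v) = E k (O v).
Proof.
move=> lO OB [E0 ES] k v; elim/ltn_ind: k => -[|k] IH; first by rewrite !E0.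
apply: (@natS_scaleI k); rewrite -(linZ lO) !ES lin_sum //; apply: eq_bigr => i _.
by rewrite OB IH // subSS ltnS leq_subr.
Qed.

(** [t d/dt] is a derivation, so the product satisfies the equation for the sum; commutation serves
    to pull each [B' i] out in front of E. *)
Lemma is_opexp_mul B E B' E' : (forall i, linear (B i)) -> (forall i, linear (B' i)) ->
  (forall i j v, B' i (B j v) = B j (B' i v)) ->
  is_opexp B E -> is_opexp B' E' ->
  is_opexp (fun i v => B i v + B' i v) (opmul E E').
Proof.
move=> lB lB' cBB' HE HE'; have lE := is_opexp_linear lB HE.
have cE i k v : B' i (E k v) = E k (B' i v) by apply: (is_opexp_comm _ _ HE).
case: HE HE' => E0 ES [E'0 E'S]; split=> [v|k v].
  by rewrite /opmul big_ord_recl big_ord0 addr0 E'0 E0.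
have -> : k%:R *: opmul E E' k v =
    \sum_(i < k.+1) (i%:R *: E i (E' (k - i)%N v)) +
    \sum_(i < k.+1) E i ((k - i)%:R *: E' (k - i)%N v).
  rewrite -big_split /opmul scaler_sumr; apply: eq_bigr => i _ /=.
  have ik : (i <= k)%N by rewrite -ltnS.
  by rewrite linZ // -scalerDl -natrD subnKC.
rewrite big_ord_recl scale0r add0r [X in _ + X]big_ord_recr subnn /= scale0r lin0 // addr0.
rewrite [RHS]big_split /=; congr (_ + _).
- under eq_bigr => i _ do rewrite /bump /= add1n ES.
  under [RHS]eq_bigr => i _ do rewrite lin_sum //.
  rewrite (eq_bigr (fun i : 'I_k => \sum_(j < i.+1)
     (fun j i' => B j.+1 (E i' (E' (k - j.+1 - i')%N v))) j (i - j)%N)); last first.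
    move=> i _; apply: eq_bigr => j _; rewrite subSS; congr (B _ (E _ (E' _ _))).
    have ji : (j <= i)%N by rewrite -ltnS.
    by have ik := ltn_ord i; lia.
  rewrite -(sum_tri k (fun j i' => B j.+1 (E i' (E' (k - j.+1 - i')%N v)))).
  apply: eq_bigr => j _.
  by have jk := ltn_ord j; rewrite -[in RHS]subSn ?subSS.
- under eq_bigr => i _ do rewrite E'S lin_sum //.
  under [RHS]eq_bigr => i _ do rewrite lin_sum //.
  rewrite (sum_tri_exchange k (fun i j => E i (B' j.+1 (E' (k - i - j.+1)%N v)))).
  apply: eq_bigr => j _; have jk := ltn_ord j.
  rewrite -[in RHS]subSn ?subSS //; apply: eq_bigr => i _.
  rewrite cE; congr (E _ (B' _ (E' _ _))).
  by rewrite -!subnDA addnC.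
Qed.

(* If [O, B_n] = n s for one n, and O commutes with the other B_i, then
   [O, E] = s t^n E. *)
Lemma is_opexp_commutator B E O (n : nat) (s : C) : (forall i, linear (B i)) -> linear O ->
  (0 < n)%N ->
  (forall i v, O (B i.+1 v) - B i.+1 (O v) = if i.+1 == n then n%:R * s *: v else 0) ->
  is_opexp B E ->
  forall k v, O (E k v) - E k (O v) = if (n <= k)%N then s *: E (k - n)%N v else 0.
Proof.
move=> lB lO n0 OB [E0 ES] k v; elim/ltn_ind: k => -[|k] IH.
  by rewrite !E0 subrr leqNgt n0.
apply: (@natS_scaleI k); rewrite scalerBr -(linZ lO) !ES lin_sum // -sumrB.
have -> : \sum_(i < k.+1) (O (B i.+1 (E (k.+1 - i.+1)%N v)) - B i.+1 (E (k.+1 - i.+1)%N (O v)))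
  = \sum_(i < k.+1) (B i.+1 (if (n <= k.+1 - i.+1)%N then s *: E (k.+1 - i.+1 - n)%N v else 0)) +
    \sum_(i < k.+1) (if i.+1 == n then n%:R * s *: E (k.+1 - i.+1)%N v else 0).
  rewrite -big_split; apply: eq_bigr => i _ /=.
  rewrite -IH; last by rewrite subSS ltnS leq_subr.
  by rewrite -OB (linB (lB _)) [RHS]addrC addrA subrK.
case: leqP => nk; last first.
  rewrite !big1 ?addr0 ?scaler0 // => i _.
    by case: eqP => // Ei; have := ltn_ord i; lia.
  by rewrite leqNgt (_ : _ < _)%N ?lin0 //; lia.
have -> : \sum_(i < k.+1) (if i.+1 == n then n%:R * s *: E (k.+1 - i.+1)%N v else 0) =
   n%:R *: (s *: E (k.+1 - n)%N v).
  have n1k : (n.-1 < k.+1)%N by lia.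
  rewrite (bigD1 (Ordinal n1k)) //= prednK // eqxx scalerA big1 ?addr0 // => i iN.
  by case: eqP => // Ei; case/eqP: iN; apply: val_inj => /=; lia.
rewrite -[in RHS](subnK nk) natrD [in RHS]scalerDl subnK //; congr (_ + _).
rewrite scalerA mulrC -scalerA ES scaler_sumr.
have nk' : (k.+1 - n <= k.+1)%N by rewrite leq_subr.
rewrite (big_ord_widen k.+1 (fun i => s *: B i.+1 (E (k.+1 - n - i.+1)%N v)) nk').
rewrite [RHS]big_mkcond; apply: eq_bigr => i _ /=.
case: (leqP n (k.+1 - i.+1)) => H.
  by rewrite ifT ?linZ -?subnDA 1?addnC //; lia.
by rewrite ifF ?lin0 //; lia.
Qed.

Lemma opmul_pow_gt A r k v : (forall v, A 0%N v = 0) -> (k < r)%N ->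
  (forall i, linear (A i)) -> iter r (opmul A) (@opone R V) k v = 0.
Proof.
move=> A0 + lA; elim: r k => // r IH k kr; rewrite iterS /opmul big1 // => -[i /= ik] _.
by case: i ik => [|i] ik; rewrite ?A0 // IH ?lin0 //; lia.
Qed.

Lemma opmul_pow_linear A r k : (forall i, linear (A i)) ->
  linear (iter r (opmul A) (@opone R V) k).
Proof.
move=> lA; elim: r k => [|r IH] k c u v.
  by rewrite /= /opone; case: ifP => // _; rewrite scaler0 addr0.
rewrite !iterS /opmul scaler_sumr -big_split /=; apply: eq_bigr => i _.
by rewrite IH lA.
Qed.

Lemma opexp_is_opexp A : (forall i, linear (A i)) -> (forall v, A 0%N v = 0) ->
  (forall i j v, A i (A j v) = A j (A i v)) ->
  is_opexp (fun i v => i%:R *: A i v) (opexp A).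
Proof.
move=> lA A0 cA.
pose P r := iter r (opmul A) (@opone R V).
have lP r k : linear (P r k) by apply: opmul_pow_linear.
have PS r k v : P r.+1 k v = \sum_(i < k.+1) A i (P r (k - i)%N v) by [].
(* The power rule [t d/dt A^(r+1) = (r+1) (t dA/dt) A^r], which relies on the [A i] commuting with
   one another. *)
have key r k v : k%:R *: P r.+1 k v =
    r.+1%:R *: \sum_(i < k.+1) i%:R *: A i (P r (k - i)%N v).
  elim: r k v => [|r IH] k v.
    rewrite PS scale1r scaler_sumr; apply: eq_bigr => i _; rewrite /P /= /opone.
    have ik : (i <= k)%N by rewrite -ltnS.
    case: eqP => [ki|_]; last by rewrite lin0 // !scaler0.
    by congr (_%:R *: _); lia.
  rewrite PS scaler_sumr (eq_bigr (fun i : 'I_k.+1 =>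
     i%:R *: A i (P r.+1 (k - i)%N v) + A i ((k - i)%:R *: P r.+1 (k - i)%N v))); last first.
    move=> i _; have ik : (i <= k)%N by rewrite -ltnS.
    by rewrite linZ // -scalerDl -natrD subnKC.
  rewrite big_split /= -[r.+2%:R]natr1 scalerDl scale1r addrC; congr (_ + _).
  under eq_bigr => i _ do rewrite IH linZ // lin_sum // -subSn -1?ltnS //.
  rewrite -scaler_sumr; congr (_ *: _).
  rewrite (sum_tri_exchange k.+1 (fun i j => A i (j%:R *: A j (P r (k - i - j)%N v)))).
  apply: eq_bigr => j _; rewrite /opmul lin_sum // scaler_sumr.
  rewrite -subSn -1?ltnS //; apply: eq_bigr => i _.
  by rewrite linZ // cA; congr (_ *: A _ (A _ (P _ _ _))); rewrite -!subnDA addnC.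
split=> [v|k v].
  by rewrite /opexp big_ord_recl big_ord0 fact0 invr1 scale1r addr0.
have EP j : opexp A j v = \sum_(r < j.+1) (r`!)%:R^-1 *: P r j v by [].
case: k => [|k]; first by rewrite scale0r big_ord0.
rewrite EP big_ord_recl {1}/P /= /opone /= scaler0 add0r scaler_sumr.
rewrite (eq_bigr (fun r : 'I_k.+1 => \sum_(i < k.+1)
   i.+1%:R *: A i.+1 ((r`!)%:R^-1 *: P r (k - i)%N v))); last first.
  move=> r _; rewrite [bump _ _]add1n scalerA mulrC -scalerA.
  rewrite key scalerA factS natrM invfM mulrAC mulVf ?natC_neq0 // mul1r.
  rewrite big_ord_recl scale0r add0r scaler_sumr; apply: eq_bigr => i _.
  by rewrite lift0 subSS (linZ (lA _)) !scalerA mulrC.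
rewrite exchange_big /=; apply: eq_bigr => i _; rewrite subSS EP.
rewrite -scaler_sumr -lin_sum //; congr (_ *: A _ _).
have ik : ((k - i).+1 <= k.+1)%N by rewrite ltnS leq_subr.
rewrite [RHS](big_ord_widen k.+1 (fun r => (r`!)%:R^-1 *: P r (k - i)%N v) ik).
rewrite [RHS]big_mkcond; apply: eq_bigr => r _ /=; case: ifP => // H.
by rewrite {1}/P opmul_pow_gt ?scaler0 //; lia.
Qed.

End OperatorExponentials.

(** * The twisted Heisenberg algebra *)

Section GradedSpace.
Variables (R : realType) (h : graded_space R).
Local Notation C := R[i].
Local Notation p := (period h).
Implicit Types (x y : h) (k l : int).

Lemma p_gt0 : (0 < p)%N. Proof. exact: period_gt0. Qed.

Lemma pC_neq0 : p%:R != 0 :> C.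
Proof. by rewrite pnatr_eq0 -lt0n p_gt0. Qed.

Lemma int_classE k l : (int_class h k == int_class h l) = ((p%:Z %| k - l)%Z).
Proof.
rewrite -val_eqE /= -eqz_mod_dvd; have p0 : p%:Z != 0 by have := p_gt0; lia.
by rewrite -[in RHS](gez0_abs (modz_ge0 k p0)) -[in RHS](gez0_abs (modz_ge0 l p0)) eqz_nat.
Qed.

Lemma int_class_ord (i : 'I_p) : int_class h i%:Z = i.
Proof. by apply: val_inj; rewrite /= modz_nat modn_small. Qed.

Lemma hproj_mem k x : hproj k x \in hcomp h k.
Proof. exact: memv_sum_pi. Qed.

Lemma hproj_linear k : linear (hproj k : h -> h).
Proof. by move=> c x y; rewrite /hproj linearP. Qed.

Lemma hproj_sum x : \sum_(k < p) hproj k%:Z x = x.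
Proof.
under eq_bigr => k _ do rewrite /hproj int_class_ord.
apply: (sumv_pi_sum (Vs := @grading R h)) => //.
by rewrite grading_full memvf.
Qed.

Lemma hproj_class k l : int_class h k = int_class h l -> @hproj R h k = hproj l.
Proof. by move=> E; rewrite /hproj E. Qed.

Lemma hproj_hcomp k l x : x \in hcomp h l ->
  hproj k x = if int_class h k == int_class h l then x else 0.
Proof.
move=> xl.
have /directv_sum_unique H := grading_direct h.
pose us (i : 'I_p) := hproj i%:Z x.
pose vs (i : 'I_p) := if i == int_class h l then x else 0.
have Uu i : true -> us i \in grading i.
  by move=> _; rewrite -{2}(int_class_ord i); exact: hproj_mem.
have Uv i : true -> vs i \in grading i.
  by move=> _; rewrite /vs; case: eqP => [->|_]; rewrite ?mem0v.
have := H us vs Uu Uv.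
rewrite hproj_sum [X in x == X](bigD1 (int_class h l)) //= {1}/vs eqxx.
rewrite [X in _ + X]big1 => [|i iN]; last by rewrite /vs (negbTE iN).
rewrite addr0 eqxx => /esym/forall_inP/(_ (int_class h k) isT)/eqP.
by rewrite /us /vs => <-; congr (_ x); apply: hproj_class; rewrite int_class_ord.
Qed.

Lemma hproj_id k x : x \in hcomp h k -> hproj k x = x.
Proof. by move=> /(hproj_hcomp k) ->; rewrite eqxx. Qed.

Lemma hformZDl c x x' y : form (c *: x + x') y = c * form x y + form x' y.
Proof. exact: form_linear. Qed.

Lemma hform0l y : form 0 y = 0 :> C.
Proof. by have := hformZDl (-1) 0 0 y; rewrite scaler0 addr0 mulN1r addNr. Qed.

Lemma hformDl x x' y : form (x + x') y = form x y + form x' y.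
Proof. by have := hformZDl 1 x x' y; rewrite scale1r mul1r. Qed.

Lemma hformZl c x y : form (c *: x) y = c * form x y.
Proof. by have := hformZDl c x 0 y; rewrite addr0 hform0l addr0. Qed.

Lemma hformNl x y : form (- x) y = - form x y.
Proof. by rewrite -scaleN1r hformZl mulN1r. Qed.

Lemma hform0r x : form x 0 = 0 :> C.
Proof. by rewrite form_sym hform0l. Qed.

Lemma hformDr x y y' : form x (y + y') = form x y + form x y'.
Proof. by rewrite form_sym hformDl !(form_sym _ x). Qed.

Lemma hformNr x y : form x (- y) = - form x y.
Proof. by rewrite form_sym hformNl form_sym. Qed.

Lemma form_suml (I : Type) (r : seq I) (P : pred I) (F : I -> h) y :
  form (\sum_(i <- r | P i) F i) y = \sum_(i <- r | P i) form (F i) y.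
Proof.
elim/big_rec2: _ => [|i y1 y2 _ <-]; first exact: hform0l.
by rewrite hformDl.
Qed.

Lemma form_sumr (I : Type) (r : seq I) (P : pred I) (F : I -> h) x :
  form x (\sum_(i <- r | P i) F i) = \sum_(i <- r | P i) form x (F i).
Proof. by rewrite form_sym form_suml; apply: eq_bigr => i _; rewrite form_sym. Qed.

Lemma dvd_int_class k l : (p %| int_class h k + int_class h l)%N = (p%:Z %| k + l)%Z.
Proof.
have p0 : p%:Z != 0 by have := p_gt0; lia.
have E : (p%:Z %| k + l)%Z = (p%:Z %| (int_class h k : nat)%:Z + (int_class h l : nat)%:Z)%Z.
  rewrite /= !gez0_abs ?modz_ge0 //.
  by rewrite !dvdzE -!/(dvdz _ _) ; apply/idP/idP => /dvdz_mod0P H; apply/dvdz_mod0P;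
    move: H; rewrite modzDm.
by rewrite E -PoszD dvdzE /=.
Qed.

Lemma form_hproj0 k l x y : ~~ (p%:Z %| k + l)%Z -> form (hproj k x) (hproj l y) = 0.
Proof.
by rewrite -dvd_int_class; apply: form_grading; exact: hproj_mem.
Qed.

Lemma form_hprojN k x y : form (hproj k x) (hproj (- k) y) = form (hproj k x) y.
Proof.
rewrite -[in RHS](hproj_sum y) form_sumr (bigD1 (int_class h (- k))) //=.
rewrite big1 ?addr0 => [|i iN].
  by congr (form _ (_ y)); apply: hproj_class; rewrite -[LHS]int_class_ord.
rewrite form_hproj0 //; apply: contra iN => H.
by rewrite -[X in X == _](int_class_ord i) int_classE opprK addrC.
Qed.

Lemma form_hprojC k x y : form (hproj k x) y = form x (hproj (- k) y).
Proof.
by rewrite -form_hprojN form_sym -[X in hproj X x]opprK form_hprojN form_sym.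
Qed.

End GradedSpace.

(** * Additivity of E_+ and E_-, and their commutation with the Heisenberg modes *)

Section HeisenbergExponentials.
Variables (R : realType) (h : graded_space R) (L : lattice_data h).
Local Notation C := R[i].
Local Notation p := (period h).
Local Notation emb := (lembed L).
Implicit Types (a b : lattice_type h) (x y : h).

Lemma embD a b : emb (a + b) = emb a + emb b.
Proof.
rewrite /lembed -big_split; apply: eq_bigr => i _ /=.
by rewrite mxE intrD scalerDl.
Qed.

Lemma emb0 : emb 0 = 0.
Proof. by rewrite /lembed big1 // => i _; rewrite mxE scale0r. Qed.

Lemma embN a : emb (- a) = - emb a.
Proof. by apply/eqP; rewrite -addr_eq0 -embD addNr emb0. Qed.

Variables (V : lmodType C) (act : int -> h -> V -> V).
Hypothesis HH : is_H_module act id.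
Implicit Types v : V.

Lemma act_linear k x : linear (act k x).
Proof. by case: HH => /(_ k x)[]. Qed.

Lemma act_hproj k x v : act k x v = act k (hproj k x) v.
Proof. by case: HH => /(_ k x)[]. Qed.

Lemma act_linear_arg k v : linear (fun x => act k x v).
Proof. by case: HH. Qed.

Lemma act_comm k l x y v : act k x (act l y v) - act l y (act k x v) =
  if k + l == 0 then (k%:~R / p%:R * form (hproj k x) y) *: v else 0.
Proof.
case: HH => _ _ _ /(_ k l (hproj k x) (hproj l y) v) H.
rewrite (act_hproj k x (act l y v)) (act_hproj l y v).
rewrite (act_hproj l y (act k x v)) (act_hproj k x v) H; try exact: hproj_mem.
case: eqP => // kl; congr (_ * _ *: _).
by rewrite (_ : l = - k) ?form_hprojN //; lia.
Qed.

Lemma act_commute k l x y v : k + l != 0 -> act k x (act l y v) = act l y (act k x v).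
Proof. by move=> kl; apply/eqP; rewrite -subr_eq0 act_comm (negbTE kl). Qed.

Lemma is_opexp_ext B B' (E : nat -> V -> V) : (forall i v, B i.+1 v = B' i.+1 v) ->
  is_opexp B E -> is_opexp B' E.
Proof.
by move=> BB' [E0 ES]; split=> // k v; rewrite ES; apply: eq_bigr => i _; rewrite BB'.
Qed.

(** [Bplus] and [Bminus] are [t d/dt] of the exponents: degree i of the exponent is
    [-(i/p)^(-1) a(i/p)], respectively [(i/p)^(-1) a(-i/p)], and the factor i leaves only p up to
    sign. *)
Definition Bplus a (i : nat) v : V := (- p%:R : C) *: act i%:Z (emb a) v.
Definition Bminus a (i : nat) v : V := (p%:R : C) *: act (- i%:Z) (emb a) v.

Lemma scaled_linear (c : C) (O : V -> V) : linear O -> linear (fun v => c *: O v).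
Proof. by move=> lO d u v; rewrite lO scalerDr !scalerA mulrC. Qed.

Lemma Bplus_linear a i : linear (Bplus a i).
Proof. exact/scaled_linear/act_linear. Qed.

Lemma Bminus_linear a i : linear (Bminus a i).
Proof. exact/scaled_linear/act_linear. Qed.

Lemma E_plus_opexp a : is_opexp (Bplus a) (E_plus L act a).
Proof.
rewrite /E_plus; set A := fun _ _ => _.
have lA i : linear (A i).
  rewrite /A; case: i => [|i] c u v /=; first by rewrite scaler0 addr0.
  by rewrite act_linear scalerDr !scalerA mulrC.
apply: is_opexp_ext (opexp_is_opexp lA _ _) => [i v|v|i j v].
- rewrite /A /Bplus /= scalerA; congr (_ *: _).
  rewrite -[in RHS](mulKf (natC_neq0 R i) p%:R) invfM invrK mulrN.
  by rewrite mulrA mulrAC -mulrA; congr (- _); ring.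
- by [].
- rewrite /A; case: i j => [|i] [|j] //=; rewrite ?(lin0 (act_linear _ _)) ?scaler0 //.
  rewrite !(linZ (act_linear _ _)) !scalerA mulrC; congr (_ *: _).
  by apply: act_commute; lia.
Qed.

Lemma E_minus_opexp a : is_opexp (Bminus a) (E_minus L act a).
Proof.
rewrite /E_minus; set A := fun _ _ => _.
have lA i : linear (A i).
  rewrite /A; case: i => [|i] c u v /=; first by rewrite scaler0 addr0.
  by rewrite act_linear scalerDr !scalerA mulrC.
apply: is_opexp_ext (opexp_is_opexp lA _ _) => [i v|v|i j v].
- rewrite /A /Bminus /= scalerA; congr (_ *: _).
  move: (natC_neq0 R i) (pC_neq0 h); rewrite -[1 *- i.+1]/(- i.+1%:R).
  by move: (i.+1%:R) (p%:R) => q d q0 d0; field; rewrite q0 d0.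
- by [].
- rewrite /A; case: i j => [|i] [|j] //=; rewrite ?(lin0 (act_linear _ _)) ?scaler0 //.
  rewrite !(linZ (act_linear _ _)) !scalerA mulrC; congr (_ *: _).
  by apply: act_commute; lia.
Qed.

Lemma E_plus_linear a k : linear (E_plus L act a k).
Proof. exact: is_opexp_linear (Bplus_linear a) (E_plus_opexp a) k. Qed.

Lemma E_minus_linear a k : linear (E_minus L act a k).
Proof. exact: is_opexp_linear (Bminus_linear a) (E_minus_opexp a) k. Qed.

Lemma E_plus0 a v : E_plus L act a 0 v = v.
Proof. by case: (E_plus_opexp a). Qed.

Lemma E_minus0 a v : E_minus L act a 0 v = v.
Proof. by case: (E_minus_opexp a). Qed.

Lemma act_emb0 k v : act k (emb 0) v = 0.
Proof.
by rewrite emb0; have := act_linear_arg k v (-1) 0 0;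
  rewrite scaler0 addr0 scaleN1r addNr.
Qed.

Lemma act_embD k a b v : act k (emb (a + b)) v = act k (emb a) v + act k (emb b) v.
Proof. by rewrite embD; have := act_linear_arg k v 1 (emb a) (emb b); rewrite !scale1r. Qed.

Lemma opone_is_opexp B : (forall i v, B i.+1 v = 0) -> is_opexp B (@opone R V).
Proof.
move=> B0; split=> // -[|k] v; first by rewrite scale0r big_ord0.
by rewrite /opone /= scaler0 big1 // => i _; rewrite B0.
Qed.

Lemma E_plus_lattice0 k v : E_plus L act 0 k v = opone k v.
Proof.
apply: is_opexp_unique (E_plus_opexp 0) (opone_is_opexp _) k v => i v.
by rewrite /Bplus act_emb0 scaler0.
Qed.

Lemma E_minus_lattice0 k v : E_minus L act 0 k v = opone k v.
Proof.
apply: is_opexp_unique (E_minus_opexp 0) (opone_is_opexp _) k v => i v.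
by rewrite /Bminus act_emb0 scaler0.
Qed.

Lemma E_plusD a b k v : E_plus L act (a + b) k v = opmul (E_plus L act a) (E_plus L act b) k v.
Proof.
apply: is_opexp_unique (E_plus_opexp (a + b)) _ k v.
apply: (is_opexp_ext (B := fun i v => Bplus a i v + Bplus b i v)) => [i v|].
  by rewrite /Bplus act_embD scalerDr.
apply: is_opexp_mul; try exact: Bplus_linear; try exact: E_plus_opexp.
move=> i j v; rewrite /Bplus !(linZ (act_linear _ _)); congr (_ *: (_ *: _)).
case: i j => [|i] [|j]; try by apply: act_commute; lia.
by apply/eqP; rewrite -subr_eq0 act_comm mul0r mul0r scale0r.
Qed.

Lemma E_minusD a b k v : E_minus L act (a + b) k v = opmul (E_minus L act a) (E_minus L act b) k v.
Proof.
apply: is_opexp_unique (E_minus_opexp (a + b)) _ k v.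
apply: (is_opexp_ext (B := fun i v => Bminus a i v + Bminus b i v)) => [i v|].
  by rewrite /Bminus act_embD scalerDr.
apply: is_opexp_mul; try exact: Bminus_linear; try exact: E_minus_opexp.
move=> i j v; rewrite /Bminus !(linZ (act_linear _ _)); congr (_ *: (_ *: _)).
case: i j => [|i] [|j]; try by apply: act_commute; lia.
by apply/eqP; rewrite -subr_eq0 act_comm mul0r mul0r scale0r.
Qed.

Lemma E_minus_comm a (O : V -> V) : linear O ->
  (forall (k : nat) v, O (act (- k.+1%:Z) (emb a) v) = act (- k.+1%:Z) (emb a) (O v)) ->
  forall j v, O (E_minus L act a j v) = E_minus L act a j (O v).
Proof.
move=> lO cO; apply: is_opexp_comm (E_minus_opexp a) => // i v.
by rewrite /Bminus (linZ lO) cO.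
Qed.

Lemma E_plus_comm a (O : V -> V) : linear O ->
  (forall (k : nat) v, O (act k.+1%:Z (emb a) v) = act k.+1%:Z (emb a) (O v)) ->
  forall j v, O (E_plus L act a j v) = E_plus L act a j (O v).
Proof.
move=> lO cO; apply: is_opexp_comm (E_plus_opexp a) => // i v.
by rewrite /Bplus (linZ lO) cO.
Qed.

Lemma act_E_plus a (k : nat) x j v :
  act k%:Z x (E_plus L act a j v) = E_plus L act a j (act k%:Z x v).
Proof.
apply: E_plus_comm => [|l u]; first exact: act_linear.
by apply: act_commute; lia.
Qed.

Lemma actN_E_minus a (k : nat) x j v :
  act (- k%:Z) x (E_minus L act a j v) = E_minus L act a j (act (- k%:Z) x v).
Proof.
apply: E_minus_comm => [|l u]; first exact: act_linear.
by apply: act_commute; lia.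
Qed.

(** Extension by zero to integer degrees, so that later shifts of the degree need no side
    conditions. *)
Definition E_minusz a (r : int) v : V := if r is Posz n then E_minus L act a n v else 0.

Lemma E_minusz_linear a r : linear (E_minusz a r).
Proof.
by case: r => n c u v; rewrite /E_minusz ?E_minus_linear // scaler0 addr0.
Qed.

Lemma E_minusz_lt0 a r v : r < 0 -> E_minusz a r v = 0.
Proof. by case: r. Qed.

(** With [n = k+1], the bracket of [x(n/p)] with [p a(-n/p)] is the scalar [n (x|a)], which is the
    shape required by [is_opexp_commutator]. *)
Lemma act_E_minusz a (k : nat) x r v :
  act k.+1%:Z x (E_minusz a r v) =
  E_minusz a r (act k.+1%:Z x v)
  + form (hproj k.+1%:Z x) (emb a) *: E_minusz a (r - k.+1%:Z) v.
Proof.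
case: r => [n|n]; last first.
  rewrite /E_minusz (lin0 (act_linear _ _)) add0r.
  by rewrite (_ : Negz n - _ = Negz (n + k.+1)%N) ?scaler0 //; lia.
apply/eqP; rewrite addrC -subr_eq /=; apply/eqP.
rewrite (@is_opexp_commutator _ _ (Bminus a) (E_minus L act a) _ k.+1
   (form (hproj k.+1%:Z x) (emb a))) //.
- case: (boolP (k.+1 <= n)%N) => kn; last by rewrite E_minusz_lt0 ?scaler0 //; lia.
  by rewrite (_ : n%:Z - k.+1%:Z = (n - k.+1)%N%:Z) //; lia.
- exact: Bminus_linear.
- exact: act_linear.
- move=> i u; rewrite /Bminus (linZ (act_linear _ _)) -scalerBr act_comm.
  have -> : (k.+1%:Z - i.+1%:Z == 0) = (i.+1 == k.+1) by lia.
  case: eqP => // _; last by rewrite scaler0.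
  rewrite scalerA; congr (_ *: _).
  by rewrite mulrA mulrCA divff ?pC_neq0 // mulr1.
- exact: E_minus_opexp.
Qed.

Lemma actN_E_minusz a (k : nat) x r v :
  act (- k%:Z) x (E_minusz a r v) = E_minusz a r (act (- k%:Z) x v).
Proof.
case: r => n /=; first exact: actN_E_minus.
exact: (lin0 (act_linear _ _)).
Qed.

Section Exchange.
Variables (a b : lattice_type h) (c : nat -> C).
Hypothesis c0 : c 0%N = 1.
Hypothesis cS : forall k : nat, k%:R * c k =
  \sum_(i < k) - p%:R * form (hproj i.+1%:Z (emb a)) (emb b) * c (k - i.+1)%N.

(** [c] is the scalar series produced by the exchange, given by [t c' = -p (sum_i (a_i|b) t^i) c].
    In the recursion for [E_plus], moving each mode past E_- yields a commuted term and a scalar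
    term; the scalar terms reassemble into [k c_k]. *)
Lemma E_plus_E_minusz j r v :
  E_plus L act a j (E_minusz b r v) =
  \sum_(k < j.+1) c k *: E_minusz b (r - k%:Z) (E_plus L act a (j - k)%N v).
Proof.
elim/ltn_ind: j => -[|j] IH.
  by rewrite big_ord_recl big_ord0 c0 scale1r !E_plus0 addr0 subr0.
have ES := (E_plus_opexp a).2.
apply: (@natS_scaleI _ _ j); rewrite ES.
rewrite (eq_bigr (fun i : 'I_j.+1 =>
    \sum_(k < j.+1 - i) (c k *: E_minusz b (r - k%:Z)
       (Bplus a i.+1 (E_plus L act a (j - k - i)%N v))) +
    \sum_(k < j.+1 - i) (- p%:R * form (hproj i.+1%:Z (emb a)) (emb b) * c k) *:
       E_minusz b (r - (i + k)%N.+1%:Z) (E_plus L act a (j - (i + k))%N v))); last first.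
  move=> i _; have ij := ltn_ord i.
  rewrite subSS IH ?ltnS ?leq_subr // (lin_sum (Bplus_linear _ _)).
  rewrite -subSn // -big_split /=; apply: eq_bigr => k _.
  rewrite (linZ (Bplus_linear _ _)) {1}/Bplus act_E_minusz !scalerDr.
  congr (_ + _).
    rewrite (linZ (E_minusz_linear _ _)); congr (_ *: (_ *: E_minusz _ _ (act _ _ (E_plus _ _ _ _ _)))).
    by rewrite -!subnDA addnC.
  rewrite !scalerA (_ : r - k%:Z - i.+1%:Z = r - (i + k)%N.+1%:Z) ?subnDA; last by lia.
  by congr (_ *: _); ring.
rewrite big_split /=.
rewrite (sum_tri_exchange j.+1 (fun i k => c k *: E_minusz b (r - k%:Z)
       (Bplus a i.+1 (E_plus L act a (j - k - i)%N v)))).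
rewrite (sum_tri j.+1 (fun i k => (- p%:R * form (hproj i.+1%:Z (emb a)) (emb b) * c k) *:
       E_minusz b (r - (i + k)%N.+1%:Z) (E_plus L act a (j - (i + k))%N v))).
rewrite scaler_sumr [RHS](eq_bigr (fun k : 'I_j.+2 =>
   c k *: E_minusz b (r - k%:Z) ((j.+1 - k)%:R *: (E_plus L act a (j.+1 - k)%N v)) +
   (k%:R * c k) *: E_minusz b (r - k%:Z) (E_plus L act a (j.+1 - k)%N v))); last first.
  move=> k _; rewrite (linZ (E_minusz_linear _ _)) !scalerA -scalerDl.
  by congr (_ *: _); rewrite [k%:R * _]mulrC -mulrDr -natrD subnK 1?mulrC // -ltnS.
rewrite [RHS]big_split /=; congr (_ + _).
  rewrite [RHS]big_ord_recr /= subnn scale0r (lin0 (E_minusz_linear _ _)) scaler0 addr0.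
  apply: eq_bigr => k _; rewrite -scaler_sumr -(lin_sum (E_minusz_linear _ _)).
  congr (_ *: E_minusz _ _ _); rewrite ES; apply: eq_bigr => i _.
  by congr (Bplus _ _ (E_plus _ _ _ _ _)); have := ltn_ord k; lia.
rewrite [RHS]big_ord_recl mul0r scale0r add0r; apply: eq_bigr => n _.
rewrite lift0 cS scaler_suml; apply: eq_bigr => i _.
have ni : (i <= n)%N by rewrite -ltnS.
by rewrite subnKC // !subSS.
Qed.

End Exchange.
End HeisenbergExponentials.

(** * Differences of binomial polynomials and roots of unity *)

Section RootsOfUnity.
Variables (R : realType) (p : nat).
Local Notation C := R[i].
Hypothesis p0 : (0 < p)%N.

Lemma omegaX k : omega R p ^+ k =
  Complex (cos (2 * pi / p%:R * k%:R)) (sin (2 * pi / p%:R * k%:R)).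
Proof.
elim: k => [|k IH]; first by rewrite expr0 mulr0 cos0 sin0.
rewrite exprSr IH /omega. rewrite (_ : 2 * pi / p%:R * k.+1%:R = 2 * pi / p%:R * k%:R + 2 * pi / p%:R :> R).
  by rewrite cosD sinD [sin _ * cos _ + _]addrC.
by rewrite -natr1; ring.
Qed.

(** The order m divides p, and [m < p] is excluded by [cos(2 pi m/p) = 1 - 2 sin(pi m/p)^2], since
    [pi m/p] then lies strictly between 0 and pi. *)
Lemma omega_primitive : p.-primitive_root (omega R p).
Proof.
have pR : (0 : R) < p%:R by rewrite ltr0n.
have wp : omega R p ^+ p = 1.
  rewrite omegaX mulfVK ?gt_eqF // mulrC mulr_natr.
  by rewrite cos2pi sin2pi.
have [m mp md] := prim_order_exists p0 wp.
suff E : p = m by rewrite [X in X.-primitive_root _]E.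
apply/eqP; rewrite eqn_leq [X in _ && X]dvdn_leq // andbT leqNgt; apply/negP => lmp.
have m0 : (0 < m)%N by exact: prim_order_gt0 mp.
have := prim_expr_order mp; rewrite omegaX => -[+ _].
have -> : 2 * pi / p%:R * m%:R = (pi / p%:R * m%:R) *+ 2 :> R.
  by rewrite -mulr_natr; ring.
rewrite cos_mulr2n cos2sin2.
have : 0 < sin (pi / p%:R * m%:R : R).
  apply: sin_gt0_pi; rewrite mulr_gt0 ?divr_gt0 ?pi_gt0 ?ltr0n //=.
  by rewrite mulrAC ltr_pdivrMr // ltr_pM2l ?pi_gt0 // ltr_nat.
move=> s0; have : 0 < sin (pi / p%:R * m%:R : R) ^+ 2 by rewrite exprn_gt0.
by move: (_ ^+ 2) => t t0; rewrite -mulr_natr; lra.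
Qed.

Lemma omega_neq0 : omega R p != 0.
Proof.
apply/eqP => w0; have := prim_expr_order omega_primitive.
by rewrite w0 expr0n gtn_eqF // => /eqP; rewrite eq_sym oner_eq0.
Qed.

Lemma omega_sum (k : int) : \sum_(s < p) omega R p ^ (s%:Z * k) =
  if (p%:Z %| k)%Z then p%:R else 0.
Proof.
have w0 := omega_neq0; set z := omega R p ^ k.
have E (s : 'I_p) : omega R p ^ (s%:Z * k) = z ^+ s.
  by rewrite mulrC -exprz_exp -exprnP.
under eq_bigr => s _ do rewrite E.
have zp : z ^+ p = 1.
  by rewrite exprnP exprz_exp mulrC -exprz_exp -exprnP (prim_expr_order omega_primitive) exp1rz.
have pn0 : (p%:Z != 0)%R by lia.
have zE : (p%:Z %| k)%Z = (z == 1).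
  have -> : z = omega R p ^+ `|(k %% p)%Z|%N.
    rewrite /z {1}(divz_eq k p) expfzDr // (mulrC (k %/ p)%Z) -exprz_exp.
    rewrite -(exprnP _ p) (prim_expr_order omega_primitive) exp1rz mul1r.
    by rewrite exprnP gez0_abs ?modz_ge0.
  rewrite -(prim_order_dvd omega_primitive) -[RHS](dvdzE p%:Z (k %% p)%Z).
  by apply/dvdz_mod0P/dvdz_mod0P; rewrite modz_mod.
rewrite zE; case: eqP => [->|/eqP z1].
  by under eq_bigr => s _ do rewrite expr1n; rewrite sumr_const card_ord.
apply: (mulfI (_ : z - 1 != 0)); first by rewrite subr_eq0.
by rewrite -subrX1 zp subrr mulr0.
Qed.

(** The value at 1 of [(X^p - 1)/(X - 1)], taken from its factorization and from its geometric
    sum. *)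
Lemma prod_1_sub_omega : \prod_(1 <= s < p) (1 - omega R p ^+ s) = p%:R.
Proof.
have E := factor_Xn_sub_1 omega_primitive.
have /(congr1 (fun q => q.[1])) : \prod_(1 <= i < p) ('X - (omega R p ^+ i)%:P) =
    \sum_(i < p) ('X : {poly C}) ^+ i.
  apply: (mulfI (_ : 'X - 1%:P != 0)); first by rewrite polyXsubC_eq0.
  rewrite -[LHS](_ : \prod_(0 <= i < p) ('X - (omega R p ^+ i)%:P) = _).
    by rewrite E -subrX1.
  by rewrite big_ltn // expr0.
rewrite horner_prod horner_sum => E1.
rewrite (eq_bigr (fun s => ('X - (omega R p ^+ s)%:P).[1])); last first.
  by move=> s _; rewrite hornerXsubC.
by rewrite E1; under eq_bigr => s _ do rewrite hornerXn expr1n; rewrite sumr_const card_ord.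
Qed.

End RootsOfUnity.

(** * Finite differences of polynomials, and polynomials with a given logarithmic derivative *)

Section PolynomialDifferences.
Variable R : realType.
Local Notation C := R[i].

Lemma fdiff_comb (V : lmodType C) (U : nzRingType) d n (c : nat -> C) (F : nat -> U -> V) a :
  iter d (@fdiff R V U) (fun x => \sum_(j < n) c j *: F j x) a =
  \sum_(j < n) c j *: iter d (@fdiff R V U) (F j) a.
Proof.
elim: d a => //= d IH a; rewrite {1}/fdiff !IH -sumrB.
by apply: eq_bigr => j _; rewrite -scalerBr.
Qed.

Local Notation diff := (@fdiff R (C^o) C).

Lemma iter_fdiff_Xn d n (a : C) : (n <= d)%N ->
  iter d diff (fun x => x ^+ n) a = if n == d then d`!%:R else 0.
Proof.
elim: d n a => [|d IH] n a nd.
  by move: nd; rewrite leqn0 => /eqP -> /=; rewrite expr0.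
rewrite iterSr.
have -> : diff (fun x => x ^+ n) = (fun x => \sum_(j < n) ('C(n, j)%:R : C) *: (x ^+ j : C^o)).
  apply/funext => x; rewrite /fdiff [x + 1]addrC exprDn big_ord_recr /= subnn expr1n.
  rewrite mul1r binn addrK; apply: eq_bigr => j _.
  by rewrite expr1n mul1r -mulr_natl.
rewrite (@fdiff_comb C^o C d n (fun j => 'C(n, j)%:R) (fun j x => x ^+ j)).
have E (j : 'I_n) : iter d diff (fun x => x ^+ j) a = if j == d :> nat then d`!%:R else 0.
  by apply: IH; have := ltn_ord j; lia.
under eq_bigr => j _ do rewrite E.
case: eqP => [n1|n1]; last first.
  rewrite big1 // => j _; case: eqP => [jd|_]; last by rewrite scaler0.
  by have := ltn_ord j; lia.
subst n; rewrite big_ord_recr /= eqxx big1 ?add0r => [|j _]; last first.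
  by rewrite ltn_eqF ?scaler0.
by rewrite binSn factS natrM.
Qed.

(** In x the binomial has degree d and leading coefficient [b^d / d!]; a d-th difference multiplies
    that coefficient by [d!] and kills the lower terms. *)
Lemma iter_fdiff_gbinom d (t b a : C) :
  iter d diff (fun x => gbinom (t + b * x) d) a = b ^+ d.
Proof.
pose q (n : nat) := \prod_(k < n) ((t - k%:R)%:P + b *: 'X) : {poly C}.
have qS n : (size (q n) <= n.+1)%N /\ (q n)`_n = b ^+ n.
  elim: n => [|n [IH1 IH2]].
    by rewrite /q big_ord0 size_poly1 coefC expr0.
  have -> : q n.+1 = (t - n%:R) *: q n + b *: (q n * 'X).
    rewrite /q big_ord_recr /= mulrDr mulrC mul_polyC; congr (_ + _).
    by rewrite -scalerAr.
  split.
    apply: (leq_trans (size_polyD _ _)); rewrite geq_max.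
    rewrite (leq_trans (size_scale_leq _ _)) ?(leq_trans IH1) //.
    rewrite (leq_trans (size_scale_leq _ _)) //.
    by rewrite (leq_trans (size_polyMleq _ _)) // size_polyX addn2.
  rewrite coefD !coefZ coefMX /= IH2 nth_default ?IH1 // mulr0 add0r.
  by rewrite exprS.
have E : (fun x => gbinom (t + b * x) d) =
   (fun x => \sum_(j < d.+1) ((q d)`_j / d`!%:R) *: (x ^+ j : C^o)).
  apply/funext => x; rewrite /gbinom.
  have -> : \prod_(k < d) (t + b * x - k%:R) = (q d).[x].
    rewrite horner_prod; apply: eq_bigr => k _.
    by rewrite hornerD hornerC hornerZ hornerX; ring.
  rewrite (horner_coef_wide _ (qS d).1) mulr_suml.
  by apply: eq_bigr => j _; rewrite mulrAC.
rewrite E (@fdiff_comb C^o C d d.+1 (fun j => (q d)`_j / d`!%:R) (fun j x => x ^+ j)).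
rewrite big_ord_recr /= big1 ?add0r => [|j _]; last first.
  by rewrite iter_fdiff_Xn ?(ltnW (ltn_ord j)) // ltn_eqF ?scaler0.
rewrite iter_fdiff_Xn // eqxx (qS d).2 /GRing.scale /=.
by rewrite mulfVK // factC_neq0.
Qed.

Lemma coef_1subX (r : C) (P : {poly C}) k :
  ((1 - r *: 'X) * P)`_k = P`_k - r * (if k is j.+1 then P`_j else 0).
Proof.
rewrite mulrBl mul1r coefB -scalerAl coefZ coefXM.
by case: k.
Qed.

(** In the pairing of polynomials with functions on the exponents, multiplication by [1 - X] is
    adjoint to minus the difference; the size bound removes the boundary term. *)
Lemma sum_coef_1subX (Q : {poly C}) n (phi : C -> C) : (size Q < n)%N ->
  \sum_(k < n) ((1 - 'X) * Q)`_k * phi k%:R = - \sum_(k < n) Q`_k * diff phi k%:R.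
Proof.
case: n => // n sQ; rewrite -['X]scale1r.
under eq_bigr => k _ do rewrite coef_1subX mul1r mulrBl.
under [in RHS]eq_bigr => k _ do rewrite /fdiff mulrBr.
rewrite !sumrB opprB; congr (_ - _).
rewrite big_ord_recl mul0r add0r [RHS]big_ord_recr /= [Q`_n]nth_default // mul0r addr0.
by apply: eq_bigr => k _; rewrite /bump /= add1n -natr1.
Qed.

Lemma sum_coef_1subXn d (Q : {poly C}) n (phi : C -> C) : (size Q + d <= n)%N ->
  \sum_(k < n) ((1 - 'X) ^+ d * Q)`_k * phi k%:R =
  (-1) ^+ d * \sum_(k < n) Q`_k * iter d diff phi k%:R.
Proof.
elim: d phi => [|d IH] phi sQ; first by rewrite expr0 !mul1r.
rewrite exprS -mulrA sum_coef_1subX.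
  by rewrite IH ?iterSr ?exprS ?mulN1r ?mulNr // (leq_trans _ sQ) // addnS.
apply: (leq_ltn_trans (size_polyMleq _ _)).
have : (size ((1 - 'X) ^+ d : {poly C})%R <= d.+1)%N.
  have s2 : (size (1 - 'X : {poly C})%R <= 2)%N.
    by rewrite (leq_trans (size_polyD _ _)) // size_polyN size_polyX size_poly1.
  by rewrite (leq_trans (size_poly_exp_leq _ _)) // ltnS -[leqRHS]mul1n leq_mul2r; lia.
by move: sQ; lia.
Qed.

(** The d factors [1 - X] become a d-th difference of a binomial of degree d, that is, the constant
    [(-1/p)^d]. The signs cancel and Q contributes only its value at 1. *)
Lemma sum_coef_gbinom d (Q : {poly C}) n (p : nat) (t : C) : (size Q + d <= n)%N ->
  \sum_(k < n) ((1 - 'X) ^+ d * Q)`_k * gbinom (t - k%:R / p%:R) d =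
  p%:R^-1 ^+ d * Q.[1].
Proof.
move=> sQ.
have := @sum_coef_1subXn d Q n (fun x => gbinom (t + (- p%:R^-1) * x) d) sQ.
rewrite [X in _ = _ * X](eq_bigr (fun k : 'I_n => Q`_k * (- p%:R^-1) ^+ d)); last first.
  by move=> k _; congr (_ * _); exact: iter_fdiff_gbinom.
rewrite -mulr_suml mulrCA -exprMn mulN1r opprK => E.
rewrite [RHS]mulrC (@horner_coef_wide _ n) ?(leq_trans _ sQ) ?leq_addr //.
rewrite [X in _ = X * _](eq_bigr (fun k : 'I_n => Q`_k)); last first.
  by move=> k _; rewrite expr1n mulr1.
rewrite -{}E; apply: eq_bigr => k _.
by congr (_ * gbinom _ _); rewrite mulNr mulrC.
Qed.

(* X P' = - (sum of s_i X^i) P up to degree n *)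
Definition logder (P : {poly C}) (s : nat -> C) n :=
  P`_0 = 1 /\ forall k, (k < n)%N ->
    k%:R * P`_k = - \sum_(i < k) s i.+1 * P`_(k - i.+1).

Lemma logder_unique P Q s n : logder P s n -> logder Q s n ->
  forall k, (k < n)%N -> P`_k = Q`_k.
Proof.
move=> [P0 PS] [Q0 QS]; elim/ltn_ind => -[|k] IH kn; first by rewrite P0 Q0.
apply: (mulfI (natC_neq0 R k)); rewrite PS // QS //; congr (- _).
by apply: eq_bigr => i _; rewrite IH //; lia.
Qed.

(** Logarithmic derivatives add up, and [X d/dX log(1 - r X)] is minus the sum of [r^i X^i] over
    [i > 0]. *)
Lemma logder_factor (r : C) P s n : logder P s n ->
  logder ((1 - r *: 'X) * P) (fun i => s i + r ^+ i) n.
Proof.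
move=> [P0 PS]; split=> [|k kn]; first by rewrite coef_1subX mulr0 subr0.
case: k kn => [|k] kn; first by rewrite mul0r big_ord0 oppr0.
(* The geometric series in [r X] inverts the factor [1 - r X]. *)
have tele j : \sum_(i < j.+1) r ^+ i * ((1 - r *: 'X) * P)`_(j - i) = P`_j.
  elim: j => [|j IH].
    by rewrite big_ord_recl big_ord0 coef_1subX mulr0 subr0 mul1r addr0.
  rewrite big_ord_recl mul1r.
  rewrite (eq_bigr (fun i : 'I_j.+1 => r * (r ^+ i * ((1 - r *: 'X) * P)`_(j - i)))).
    by rewrite -mulr_sumr IH coef_1subX subrK.
  by move=> i _; rewrite lift0 subSS exprS mulrA.
under eq_bigr => i _ do rewrite mulrDl.
rewrite big_split /=.
rewrite [X in _ = - (_ + X)](eq_bigr (fun i : 'I_k.+1 => r * (r ^+ i * ((1 - r *: 'X) * P)`_(k - i)))).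
  2: by move=> i _; rewrite subSS exprS mulrA.
rewrite -mulr_sumr tele.
have -> : \sum_(i < k.+1) s i.+1 * ((1 - r *: 'X) * P)`_(k.+1 - i.+1) =
    \sum_(i < k.+1) s i.+1 * P`_(k.+1 - i.+1) - r * \sum_(i < k) s i.+1 * P`_(k - i.+1).
  under eq_bigr => i _ do rewrite coef_1subX mulrBr.
  rewrite sumrB; congr (_ - _).
  rewrite big_ord_recr /= subnn !mulr0 addr0 mulr_sumr; apply: eq_bigr => i _.
  rewrite subSS mulrCA; congr (_ * (_ * _)).
  by rewrite -subnSK.
have Pk : \sum_(i < k) s i.+1 * P`_(k - i.+1) = - (k%:R * P`_k).
  by rewrite PS ?opprK // ltnW.
have Pk1 : \sum_(i < k.+1) s i.+1 * P`_(k.+1 - i.+1) = - (k.+1%:R * P`_k.+1).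
  by rewrite PS ?opprK.
by rewrite Pk Pk1 coef_1subX -natr1; ring.
Qed.

Lemma logder_ext P s s' n : (forall i, s i = s' i) -> logder P s n -> logder P s' n.
Proof.
move=> ss' [P0 PS]; split=> // k kn; rewrite PS //; congr (- _).
by apply: eq_bigr => i _; rewrite ss'.
Qed.

Lemma logder_pow (r : C) m P s n : logder P s n ->
  logder ((1 - r *: 'X) ^+ m * P) (fun i => s i + m%:R * r ^+ i) n.
Proof.
move=> HP; elim: m => [|m /(logder_factor r) IH].
  by rewrite expr0 mul1r; apply: logder_ext HP => i; rewrite mul0r addr0.
by rewrite exprS -mulrA; apply: logder_ext IH => i; rewrite -natr1; ring.
Qed.

Lemma logder_prod (I : Type) (r : seq I) (rho : I -> C) (e : I -> nat) P s n :
  logder P s n ->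
  logder ((\prod_(j <- r) (1 - rho j *: 'X) ^+ e j) * P)
    (fun i => s i + \sum_(j <- r) (e j)%:R * rho j ^+ i) n.
Proof.
move=> HP; elim: r => [|j r /(logder_pow (rho j) (e j)) IH].
  by rewrite big_nil mul1r; apply: logder_ext HP => i; rewrite big_nil addr0.
rewrite big_cons -mulrA; apply: logder_ext IH => i.
by rewrite big_cons; ring.
Qed.

End PolynomialDifferences.

(** * The exchange factor of E_+ and E_- *)

Section OneMinusXp.
Variables (R : realType) (p : nat).
Local Notation C := R[i].
Hypothesis p0 : (0 < p)%N.

(** Both sides have the same logarithmic derivative: the power sums of the [omega^s] are p in
    degrees divisible by p and 0 elsewhere, as for [1 - X^p]. *)
Lemma prod_1_sub_omegaX :
  \prod_(s < p) (1 - omega R p ^+ s *: 'X) = 1 - 'X^p :> {poly C}.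
Proof.
apply/polyP => k.
have L1 : logder (1 : {poly C}) (fun=> 0) k.+1.
  split=> [|j _]; first by rewrite coefC.
  rewrite big1 ?oppr0 => [|i _]; last by rewrite mul0r.
  by rewrite coefC; case: j => [|j]; rewrite ?mul0r ?mulr0.
have := logder_prod (index_enum 'I_p) (fun s : 'I_p => omega R p ^+ s) (fun=> 1%N) L1.
rewrite mulr1 (eq_bigr (fun s : 'I_p => 1 - omega R p ^+ s *: 'X)) => [L2|s _]; last by rewrite expr1.
pose d : {poly C} := 1 - 'X^p.
have d0 : d`_0 = 1 by rewrite coefB coef1 coefXn (ltn_eqF p0) subr0.
have dp : d`_p = -1 by rewrite coefB coef1 coefXn eqxx (gtn_eqF p0) sub0r.
have dn n : n <> 0%N -> n <> p -> d`_n = 0.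
  by move=> /eqP/negbTE n0 /eqP/negbTE np; rewrite coefB coef1 coefXn n0 np subr0.
apply: (logder_unique L2 _ (ltnSn k)); split=> // j jk.
have sE n : 0 + \sum_(s < p) 1%:R * (omega R p ^+ s) ^+ n =
    if (p %| n)%N then p%:R else 0 :> C.
  rewrite add0r -(omega_sum R p0 n%:Z); apply: eq_bigr => s _.
  by rewrite mul1r -exprM -PoszM.
under eq_bigr => i _ do rewrite sE.
rewrite -/d; case: j jk => [|j] jk; first by rewrite mul0r big_ord0 oppr0.
rewrite big_ord_recr /= subnn d0 mulr1.
case: (ltnP p j.+1) => pj.
  rewrite dn ?mulr0; [|by []|by lia].
  have jp : (j - p < j)%N by lia.
  rewrite (bigD1 (Ordinal jp)) //= (_ : (j.+1 - (j - p).+1 = p)%N); last by lia.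
  rewrite dp big1 ?addr0 => [|i ij]; last first.
    have ij' : (i != j - p :> nat)%N by [].
    by rewrite dn ?mulr0 //; have := ltn_ord i; lia.
  rewrite mulrN1 (_ : (j - p).+1 = (j.+1 - p)%N); last by lia.
  have -> : (p %| j.+1 - p)%N = (p %| j.+1)%N by rewrite dvdn_subl // ltnW.
  by rewrite addNr oppr0.
rewrite big1 ?add0r => [|i _]; last first.
  by rewrite dn ?mulr0 //; have := ltn_ord i; lia.
case: (eqVneq j.+1 p) => [->|/eqP jp]; first by rewrite dvdnn dp mulrN1.
by rewrite dn // mulr0 ifF ?oppr0 // gtnNdvd //; lia.
Qed.

End OneMinusXp.

Section LatticeExchange.
Variables (R : realType) (h : graded_space R) (L : lattice_data h).
Local Notation C := R[i].
Local Notation p := (period h).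
Local Notation w := (omega R p).
Local Notation emb := (lembed L).
Variables a b : lattice_type h.

Lemma to_intK (k : int) : to_int (k%:~R : C) = k.
Proof. by rewrite /to_int cReZ intrKfloor. Qed.

Lemma sigma_pow0 x : sigma_pow (- 0%:Z) x = x :> h.
Proof.
rewrite /sigma_pow -[RHS]hproj_sum; apply: eq_bigr => k _.
by rewrite oppr0 mul0r expr0z scale1r.
Qed.

Lemma mexpE s : (s < p)%N ->
  form (sigma_pow (- s%:Z) (emb a)) (emb b) = (mexp L s a b)%:~R.
Proof.
by move=> sp; rewrite /mexp; have [m ->] := lattice_integral L a b sp; rewrite to_intK.
Qed.

Lemma mexp0 : mexp L 0 a b = to_int (form (emb a) (emb b)).
Proof. by rewrite /mexp sigma_pow0. Qed.

Lemma int_formE : form (emb a) (emb b) = (to_int (form (emb a) (emb b)))%:~R.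
Proof. by rewrite -mexp0 -mexpE ?p_gt0 // sigma_pow0. Qed.

(** Fourier inversion on Z/p, applied to [m_s = sum_k omega^(-s k) (a_k|b)]. *)
Lemma mexp_sum (i : nat) : \sum_(s < p) (mexp L s a b)%:~R * w ^+ (s * i) =
  p%:R * form (hproj i%:Z (emb a)) (emb b).
Proof.
have w0 := omega_neq0 R (p_gt0 h).
rewrite (eq_bigr (fun s : 'I_p => \sum_(k < p)
    form (hproj k%:Z (emb a)) (emb b) * w ^ (s%:Z * (i%:Z - k%:Z)))); last first.
  move=> s _; rewrite -mexpE // /sigma_pow form_suml mulr_suml.
  apply: eq_bigr => k _; rewrite hformZl mulrAC mulrC; congr (_ * _).
  rewrite exprnP -expfzDr //; congr (w ^ _).
  by rewrite PoszM; ring.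
rewrite exchange_big (bigD1 (int_class h i%:Z)) //= [X in _ + X]big1 ?addr0.
  rewrite -mulr_sumr omega_sum ?p_gt0 // -int_classE.
  rewrite ifT; last by rewrite eq_sym -{1}[int_class h i]int_class_ord.
  have E := hproj_class (int_class_ord (int_class h i%:Z)).
  by rewrite E mulrC.
move=> k kN; rewrite -mulr_sumr omega_sum ?p_gt0 // -int_classE int_class_ord.
by rewrite eq_sym (negbTE kN) mulr0.
Qed.

(** The exponential of a scalar series, obtained from [opexp] on the one-dimensional module
    [C^o]. *)
Lemma exchange_seq : exists c : nat -> C, c 0%N = 1 /\
  forall k : nat, k%:R * c k =
  \sum_(i < k) - p%:R * form (hproj i.+1%:Z (emb a)) (emb b) * c (k - i.+1)%N.
Proof.
pose A (i : nat) (v : C^o) : C^o :=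
  (if i is j.+1 then - (p%:R * form (hproj j.+1%:Z (emb a)) (emb b) / j.+1%:R) else 0) * v.
have lA i : linear (A i).
  by move=> c u v; rewrite /A mulrDr /GRing.scale /= mulrCA.
have [|||E0 ES] := @opexp_is_opexp R C^o A.
- exact: lA.
- by move=> v; rewrite /A mul0r.
- by move=> i j v; rewrite /A mulrCA.
have lin := is_opexp_linear (B := fun i v => i%:R *: A i v) _ (conj E0 ES).
exists (fun k => opexp A k 1); split=> [|k]; first exact: E0.
have := ES k 1; rewrite /GRing.scale /= => ->; apply: eq_bigr => i _.
rewrite /A mulrA mulrN mulNr; congr (- _ * _).
by rewrite mulrC mulfVK // natC_neq0.
Qed.

Variable c : nat -> C.
Hypothesis c0 : c 0%N = 1.
Hypothesis cS : forall k : nat, k%:R * c k =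
  \sum_(i < k) - p%:R * form (hproj i.+1%:Z (emb a)) (emb b) * c (k - i.+1)%N.

(** By [mexp_sum], c is the expansion of [prod_s (1 - omega^s t)^(m_s)], where exponents may be
    negative. Multiplying by [(1 - t^p)^N] adds N to each of them and gives the polynomial P. Its
    factor [s = 0] is a power of [1 - t] whose exponent is the degree of the binomial, and the
    others are evaluated at 1; of [p^(-m_0-N) p^N] there remains [p^(-m_0)]. *)
Lemma exchange_poly N : (forall s, (s < p)%N -> - N%:Z <= mexp L s a b) ->
  exists (P : {poly C}) (n0 : nat),
  [/\ forall k, \sum_(s < N.+1) ((-1) ^+ s * ('C(N, s))%:R) *
                   (if (p * s <= k)%N then c (k - p * s)%N else 0) = P`_k,
      forall k, (n0 <= k)%N -> P`_k = 0
    & forall (t : C) n, (n0 <= n)%N ->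
      \sum_(k < n) P`_k * gbinom (t - k%:R / p%:R) (absz (mexp L 0 a b + N%:Z)%R) =
      p%:R ^ (- mexp L 0 a b) * \prod_(1 <= s < p) (1 - w ^+ s) ^ mexp L s a b].
Proof.
move=> HN; pose e s := absz (mexp L s a b + N%:Z)%R.
have eE s : (s < p)%N -> (e s)%:R = (mexp L s a b)%:~R + N%:R :> C.
  move=> sp; rewrite pmulrn /e gez0_abs ?intrD //; have := HN s sp; lia.
have w0 := omega_neq0 R (p_gt0 h).
pose P : {poly C} := \prod_(s < p) (1 - w ^+ s *: 'X) ^+ e s.
pose Q : {poly C} := \prod_(1 <= s < p) (1 - w ^+ s *: 'X) ^+ e s.
have PQ : P = (1 - 'X) ^+ e 0%N * Q.
  rewrite /P -(big_mkord xpredT (fun s => (1 - w ^+ s *: 'X) ^+ e s)).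
  by rewrite big_ltn ?p_gt0 // expr0 scale1r.
exists P, (size P + size Q + e 0%N)%N; split=> [k|k kn|t n nn].
(* [c] is a power series; as only degrees up to k matter, a truncation stands in for it. *)
- pose Cn : {poly C} := \poly_(j < k.+1) c j.
  have LC : logder Cn (fun i => p%:R * form (hproj i%:Z (emb a)) (emb b)) k.+1.
    split=> [|j jk]; first by rewrite coef_poly c0.
    rewrite coef_poly jk cS -sumrN; apply: eq_bigr => i _; rewrite coef_poly ifT; last by lia.
    by rewrite !mulNr.
  have L1 : logder (1 : {poly C}) (fun=> 0) k.+1.
    split=> [|j _]; first by rewrite coefC.
    rewrite big1 ?oppr0 => [|i _]; last by rewrite mul0r.
    by rewrite coefC; case: j => [|j]; rewrite ?mul0r ?mulr0.
  have LN := logder_prod (index_enum 'I_p) (fun s : 'I_p => w ^+ s) (fun=> N) LC.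
  have LP := logder_prod (index_enum 'I_p) (fun s : 'I_p => w ^+ s) (fun s => e s) L1.
  have {}LP := logder_ext _ LP.
  have {LP} := logder_unique LN (LP _ _) (ltnSn k).
  rewrite mulr1 -/P => <-; last first.
    move=> i; rewrite add0r -mexp_sum -big_split; apply: eq_bigr => s _ /=.
    by rewrite eE // mulrDl exprM.
  rewrite prodrXl prod_1_sub_omegaX ?p_gt0 // exprBn mulr_suml coef_sum.
  apply: eq_bigr => s _; rewrite expr1n mulr1 -exprM.
  have -> : ((-1) ^+ s * 'X^(p * s)) *+ 'C(N, s) * Cn =
      ((-1) ^+ s * 'C(N, s)%:R)%:P * ('X^(p * s) * Cn) :> {poly C}.
    by rewrite rmorphM rmorphXn /= rmorphN1 rmorph_nat -mulr_natr; ring.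
  rewrite coefCM coefXnM coef_poly; congr (_ * _).
  by case: leqP => // _; rewrite ifT // ltnS leq_subr.
- by rewrite nth_default // (leq_trans _ kn) // -addnA leq_addr.
- rewrite PQ sum_coef_gbinom; last by apply: leq_trans nn; rewrite -addnA leq_addl.
  have QE : Q.[1] = \prod_(1 <= s < p) (1 - w ^+ s) ^ mexp L s a b * p%:R ^+ N.
    rewrite /Q horner_prod -(prod_1_sub_omega R (p_gt0 h)) -prodrXl -big_split /=.
    rewrite big_nat [RHS]big_nat; apply: eq_bigr => s /andP[s1 sp].
    rewrite horner_exp !hornerE exprnP /e gez0_abs; last by have := HN s sp; lia.
    rewrite expfzDr // subr_eq0 eq_sym -(prim_order_dvd (omega_primitive R (p_gt0 h))).
    by rewrite gtnNdvd.
  rewrite QE mulrCA mulrC; congr (_ * _).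
  rewrite exprVn exprnN gez0_abs; last by have := HN 0%N (p_gt0 h); lia.
  by rewrite exprnP -expfzDr ?pC_neq0 //; congr (_ ^ _); ring.
Qed.

End LatticeExchange.

(** * The fields of the lattice vectors *)

Lemma sum_divmod (V : zmodType) (p B : nat) (F : nat -> V) :
  \sum_(n < B * p) F n = \sum_(s < B) \sum_(r < p) F (s * p + r)%N.
Proof.
rewrite -(big_mkord xpredT F) big_nat_mul big_mkord; apply: eq_bigr => s _.
rewrite -{1}[(s * p)%N]add0n big_addn big_mkord mulSn addnK.
by apply: eq_bigr => r _; rewrite addnC.
Qed.

Lemma subr_eq_swap (U : zmodType) (x c d : U) : x - c = d -> c = x - d.
Proof. by move=> <-; rewrite subKr. Qed.

Section FromRepresentation.
Variables (R : realType) (h : graded_space R) (L : lattice_data h).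
Variables (A : vertex_superalgebra R) (S : lattice_structure L A).
Variables (V : lmodType R[i]) (M : generalized_module V A).
Local Notation C := R[i].
Local Notation p := (period h).
Local Notation emb := (lembed L).
Local Notation pi := (gpi M).
Hypothesis tilde_class : forall (i : 'I_p) (x : h), x \in grading i ->
       is_field_class (i%:R / p%:R) (pi (tilde S x)).
Implicit Types (a b : lattice_type h) (x y : h) (v : V) (m T : C).

Local Notation act := (H_action S M).
Local Notation XX a := (gpi M (X S a)).

Lemma gpi_linE (c : C) (u w : A) m v :
  pi (c *: u + w) m v = c *: pi u m v + pi w m v.
Proof. exact: gpi_linear. Qed.

Lemma gpiZ (c : C) (u : A) m v : pi (c *: u) m v = c *: pi u m v.
Proof. exact (linZ (gpi_linear M m v) c u). Qed.

Lemma gpi0 m v : pi 0 m v = 0.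
Proof. exact (lin0 (gpi_linear M m v)). Qed.

Lemma gpi_sum (I : Type) (r : seq I) (F : I -> A) m v :
  pi (\sum_(j <- r) F j) m v = \sum_(j <- r) pi (F j) m v.
Proof. exact (lin_sum (gpi_linear M m v) _ _ _). Qed.

Lemma gpi_lin (u : A) m : linear (pi u m).
Proof. exact: field_linear (gpi_field M u) m. Qed.

Lemma class_shift (k : int) : exists j : int,
  k%:~R / p%:R = (int_class h k)%:R / p%:R + j%:~R :> C.
Proof.
exists (k %/ p%:Z)%Z; have p0 : p%:Z != 0 by have := p_gt0 h; lia.
have -> : ((int_class h k : nat)%:R : C) = (k %% p)%Z%:~R.
  by rewrite pmulrn /= gez0_abs ?modz_ge0.
rewrite {1}(divz_eq k p) intrD intrM mulrDl mulfK; first exact: addrC.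
exact: pC_neq0.
Qed.

Lemma tilde_off (k : int) x c : x \in hcomp h k ->
  (forall j : int, c <> k%:~R / p%:R + j%:~R) -> forall v, pi (tilde S x) c v = 0.
Proof.
move=> xk Nc; have [_] := tilde_class xk; apply=> j E.
have [j' Ej'] := class_shift k.
by apply: (Nc (j - j')); rewrite Ej' intrB E; ring.
Qed.

Lemma actE (k : int) x v : x \in hcomp h k -> act k x v = pi (tilde S x) (k%:~R / p%:R) v.
Proof. by move=> xk; rewrite /H_action hproj_id. Qed.

Lemma X_parity a : parity (odd `|to_int (form (emb a) (emb a))|) (X S a).
Proof. exact/component_parity/X_component. Qed.

Lemma tilde_localN x (u : A) (y : bool) : parity y u -> exists N,
  localN N false y (pi (tilde S x)) (pi u).
Proof. by move=> pu; apply/local_localN/gpi_local => //; exact: tilde_even. Qed.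

Lemma tilde_commutator (k : int) x (u : A) (y : bool) T v : parity y u -> x \in hcomp h k ->
  (forall n : int, 2 <= n -> nprod n (tilde S x) u = 0) ->
  pi (tilde S x) (k%:~R / p%:R) (pi u (T - k%:~R / p%:R) v)
  - pi u (T - k%:~R / p%:R) (pi (tilde S x) (k%:~R / p%:R) v) =
  pi (nprod 0 (tilde S x) u) T v +
  (k%:~R / p%:R) *: pi (nprod 1 (tilde S x) u) (T - 1) v.
Proof.
move=> pu xk n2; have [N HN] := tilde_localN x pu.
(* The locality exponent is raised by 2 so that the terms n = 0 and n = 1 are always present. *)
have := @field_commutator _ _ _ _ (gpi_field M (tilde S x)) (gpi_field M u)
  _ _ _ (localN_le (leq_addr 2 N) HN) (k%:~R / p%:R) T v (fun c => @tilde_off k x c xk).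
rewrite /prodf /prodb /= scale1r addn2 => -> //.
rewrite big_ord_recl big_ord_recl big1 ?addr0 => [|j _].
  rewrite gbinom0 scale1r gbinom1 subr0 -!gpi_nprod //; exact: tilde_even.
rewrite -gpi_nprod; [|exact: tilde_even|exact: pu].
by rewrite n2 ?gpi0 ?scaler0 // !lift0; lia.
Qed.

Lemma act_H_module : is_H_module act id.
Proof.
split.
- move=> k x; split; first exact: gpi_lin.
  by move=> v; rewrite /H_action [hproj k (hproj k x)]hproj_id // hproj_mem.
- move=> k v c x y; rewrite /H_action.
  by rewrite (hproj_linear k c x y) (tilde_linear S) gpi_linE.
- by split=> // c u v.
- move=> k l x y v xk yl; rewrite !actE //.
  have -> : l%:~R / p%:R = (k + l)%:~R / p%:R - k%:~R / p%:R :> C.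
    by rewrite intrD; ring.
  rewrite (tilde_commutator _ _ (tilde_even S y)) //; last first.
    by move=> n n2; rewrite tilde_tilde ?ifF //; lia.
  rewrite !tilde_tilde //= gpi0 add0r gpiZ gpi_vacuum /one_series scalerA.
  have -> : ((k + l)%:~R / p%:R - 1 == -1 :> C) = (k + l == 0).
    rewrite -{2}[-1]add0r (inj_eq (addIr _)) mulf_eq0 invr_eq0 (negbTE (pC_neq0 h)) orbF.
    by rewrite intr_eq0.
  by case: ifP; rewrite ?scaler0.
Qed.

Lemma X_act (k : int) x a m v :
  act k x (XX a m v) =
  XX a m (act k x v) + form (hproj k x) (emb a) *: XX a (m + k%:~R / p%:R) v.
Proof.
apply/eqP; rewrite addrC -subr_eq; apply/eqP.
rewrite /H_action -{1 2}(addrK (k%:~R / p%:R) m).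
rewrite (@tilde_commutator k _ _ _ _ _ (X_parity a)) ?hproj_mem //.
  rewrite !tilde_X //= gpiZ gpi0 scaler0 addr0 //.
by move=> n n2; rewrite tilde_X ?ifF //; lia.
Qed.

Lemma X_bound a v : exists B : R, forall m, B <= complex.Re m -> XX a m v = 0.
Proof. exact: field_bound (gpi_field M (X S a)) v. Qed.

(** The constant series is local to everything with N = 0, so [gnprodE] has no differences; only
    index [m - 1] survives, with coefficient [binom(-m, 1)]. *)
Lemma X_derivative a m v : pi (vD (X S a)) m v = - m *: XX a (m - 1) v.
Proof.
rewrite /vD (gpi_nprod M _ _ _ (X_parity a) (vacuum_even A)).
have -> : gpi M (vacuum A) = one_series (V := V).
  by apply/funext => n; apply/funext => u; rewrite gpi_vacuum.
have f1 : is_field (one_series (V := V)).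
  rewrite -(_ : gpi M (vacuum A) = one_series (V := V)); first exact: gpi_field.
  by apply/funext => n; apply/funext => u; rewrite gpi_vacuum.
set f := XX a.
have H0 : localN 0 (odd `|to_int (form (emb a) (emb a))|) false f (one_series (V := V)).
  move=> T u c; rewrite /= /prodf /prodb andbF scale1r /one_series.
  by case: ifP => // _; rewrite /f (lin0 (gpi_lin _ _)).
rewrite (@gnprodE _ _ _ _ (gpi_field M (X S a)) f1 _ _ _ H0) /=.
rewrite (@fsum_seq _ _ [:: m - 1]) // => [|c]; last first.
  rewrite inE => cm; rewrite /prodf /one_series ifF ?/f ?(lin0 (gpi_lin _ _)) ?scaler0 //.
  apply: contraNF cm => /eqP E; apply/eqP; move: E; rewrite mulrNz => E.
  by rewrite (subr_eq_swap E) -[2%:~R]/(2%:R); ring.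
rewrite big_seq1 /prodf /one_series ifT ?gbinom1; last first.
  by apply/eqP; rewrite mulrNz -[2%:~R]/(2%:R); ring.
by congr (_ *: _); ring.
Qed.

(** The two sums are the normally ordered product. The last term is the twisting correction
    [binom(-i/p, 1)] times the 0-th product of the current with X_a. *)
Lemma X_current (i : 'I_p) x a m v : x \in grading i ->
  pi (nprod (-1) (tilde S x) (X S a)) m v =
  \sum_(s \in [set: nat]) pi (tilde S x) (i%:R / p%:R - s.+1%:R)
      (XX a (m - 1 - i%:R / p%:R + s.+1%:R) v)
  + \sum_(s \in [set: nat]) XX a (m - 1 - i%:R / p%:R - s%:R)
      (pi (tilde S x) (i%:R / p%:R + s%:R) v)
  - (i%:R / p%:R * form x (emb a)) *: XX a (m - 1) v.
Proof.
move=> xi; have xi' : x \in hcomp h i%:Z by rewrite /hcomp int_class_ord.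
set q := i%:R / p%:R : C.
have [N HN] := tilde_localN x (X_parity a).
rewrite (gpi_nprod M _ _ _ (tilde_even S x) (X_parity a)).
set f := pi (tilde S x); set g := XX a.
have off c : (forall k : int, c <> q + k%:~R) -> forall v, f c v = 0.
  by move=> Nc; apply: (tilde_off xi').
rewrite (@gnprod_class _ _ _ _ (gpi_field M _) (gpi_field M _) _ _ _ HN q _ _ _ off).
set T := m + _; have TE : T = m - 1 by rewrite /T mulrNz.
set phi := fun k : int => _; set psi := fun k : int => prodb _ _ _ _ _ _ _.
have cphi k : phi k - psi k = form x (emb a) *: g T v.
  have := @tilde_commutator (i%:Z + p%:Z * k) x (X S a) _ T v (X_parity a).
  rewrite /phi /psi /prodf /prodb scale1r -/f -/g.
  have -> : (i%:Z + p%:Z * k)%:~R / p%:R = q + k%:~R :> C.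
    rewrite intrD intrM mulrDl; congr (_ + _).
    by rewrite mulrC mulrA mulVf ?mul1r ?pC_neq0.
  move=> ->.
  - by rewrite !tilde_X //= gpiZ gpi0 scaler0 addr0.
  - rewrite /hcomp (_ : int_class h _ = int_class h i%:Z) //.
    by apply/eqP; rewrite int_classE addrAC subrr add0r dvdz_mulr.
  - by move=> n n2; rewrite tilde_X ?ifF //; lia.
have bphi : lbounded phi by exact: prodf_lbounded (gpi_field M _) (gpi_field M _) _ _ _.
have bpsi : ubounded psi by exact: prodb_ubounded (gpi_field M _) (gpi_field M _) _ _ _ _ _.
(* The commutator [phi - psi] does not depend on k, so exponent 1 suffices for locality, and only j
   = 0 and j = 1 contribute. *)
have D1 : iter 1 (@fdiff R V int) phi =1 iter 1 (@fdiff R V int) psi.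
  move=> k /=; rewrite /fdiff; apply/eqP; rewrite -subr_eq0.
  by rewrite opprD opprK addrACA -[- phi k + _]opprK opprD opprK !cphi subrr.
rewrite (@fsum_nat _ 2) => [|[|[|j]] // _]; last first.
  by rewrite (nres_local _ bphi bpsi D1) ?ifT ?scaler0.
rewrite !big_ord_recl big_ord0 addr0 gbinom0 scale1r gbinom1 /=.
have [B1 HB1] := lbounded_nat (-1) bphi; have [B2 HB2] := ubounded_nat 0 bpsi.
have gm1 s : gbinom ((-1)%:~R : C) s = (-1) ^+ s.
  by rewrite (gbinomN R 0 s) add0n binn mulr1.
have -> : nres (-1 + 0%:Z) phi psi = \sum_(s \in [set: nat]) phi (-1 - s%:Z)
    + \sum_(s \in [set: nat]) psi s%:Z.
  rewrite addr0 /nres; congr (_ + _).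
    by apply: eq_fsbigr => s _; rewrite gm1 -expr2 sqrr_sign scale1r.
  rewrite !(@fsum_nat _ B2); [|by move=> s /HB2; rewrite add0r|by move=> s /HB2; rewrite add0r => ->; rewrite scaler0].
  rewrite -sumrN; apply: eq_bigr => s _; rewrite gm1.
  rewrite (_ : -1 - s%:Z = - s.+1%:Z); last by lia.
  by rewrite -exprnN -exprVn invrN1 exprS mulN1r mulNr -expr2 sqrr_sign scaleN1r opprK.
have -> : nres (-1 + 1%:Z) phi psi = form x (emb a) *: g T v.
  rewrite -(cphi 0) /nres !(@fsum_nat _ 1).
  - by rewrite !big_ord_recl !big_ord0 /= !gbinom0 !addr0 !mulr1 !scale1r.
  - by move=> [//|s] _; rewrite -[(-1 + 1%:Z)%:~R]/(0%:R) gbinom_nat bin_small // mulr0 scale0r.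
  - by move=> [//|s] _; rewrite -[(-1 + 1%:Z)%:~R]/(0%:R) gbinom_nat bin_small // mulr0 scale0r.
rewrite TE scalerA mulNr scaleNr addr0; congr (_ + _ - _).
- apply: eq_fsbigr => s _; rewrite /phi /prodf TE.
  have -> : q + (-1 - s%:Z)%:~R = q - s.+1%:R :> C.
    by rewrite -natr1 intrB mulrNz; ring.
  by congr (f _ (g _ _)); ring.
- apply: eq_fsbigr => s _; rewrite /psi /prodb scale1r TE.
  by congr (g _ _); rewrite -pmulrn; ring.
Qed.

End FromRepresentation.

(** * The differential equation for [X_a(z)] *)

Section CurrentEquation.
Variables (R : realType) (h : graded_space R) (L : lattice_data h).
Variables (A : vertex_superalgebra R) (S : lattice_structure L A).
Variables (V : lmodType R[i]) (M : generalized_module V A).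
Local Notation C := R[i].
Local Notation p := (period h).
Local Notation emb := (lembed L).
Local Notation pi := (gpi M).
Hypothesis tilde_class : forall (i : 'I_p) (x : h), x \in grading i ->
       is_field_class (i%:R / p%:R) (pi (tilde S x)).
Implicit Types (a b : lattice_type h) (x y : h) (v u : V) (m T : C).

Local Notation act := (H_action S M).
Local Notation XX a := (gpi M (X S a)).

Let HH : is_H_module act id := act_H_module tilde_class.

Lemma tilde_sum x : tilde S x = \sum_(i < p) tilde S (hproj i%:Z x).
Proof. by rewrite -{1}[x]hproj_sum (lin_sum (tilde_linear S)). Qed.

Lemma actE_full (k : int) x v : act k x v = pi (tilde S x) (k%:~R / p%:R) v.
Proof.
rewrite [in RHS]tilde_sum gpi_sum (bigD1 (int_class h k)) //= big1 ?addr0.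
  rewrite /H_action; congr (pi (tilde S _) _ _).
  by rewrite -(hproj_class (int_class_ord (int_class h k))).
move=> i ik; apply: (tilde_off tilde_class (hproj_mem i%:Z x)) => j E.
have [j' Ej] := class_shift h k.
case/eqP: ik; rewrite -(int_class_ord i).
apply/eqP; rewrite int_classE; apply/dvdzP; exists (- j).
apply: (@intrC_inj R); rewrite intrB intrM mulrNz.
have p0 := pC_neq0 h; rewrite -[k%:~R](divfK p0) E; field; exact: p0.
Qed.

Lemma act_bound x v : exists N : nat, forall k : nat, (N <= k)%N -> act k%:Z x v = 0.
Proof.
have [B HB] := field_bound (gpi_field M (tilde S x)) v.
exists (Num.truncn (`|B| * p%:R)).+1 => k kN; rewrite actE_full HB //.
have pR : (0 : R) < p%:R by rewrite ltr0n p_gt0.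
have -> : complex.Re (k%:~R / p%:R : C) = k%:R / p%:R.
  have -> : (k%:~R / p%:R : C) = real_complex R (k%:R / p%:R).
    by rewrite rmorphM fmorphV !rmorph_nat.
  by [].
rewrite ler_pdivlMr //; apply: le_trans (_ : `|B| * p%:R <= _).
  by rewrite ler_pM2r // ler_norm.
apply: le_trans (_ : (Num.truncn (`|B| * p%:R)).+1%:R <= _); last by rewrite ler_nat.
by rewrite ltW // truncnS_gt.
Qed.

Lemma Re_addZp m (k : int) : complex.Re (m + k%:~R / p%:R) = complex.Re m + k%:~R / p%:R.
Proof.
rewrite cReD; congr (_ + _).
have -> : (k%:~R / p%:R : C) = real_complex R (k%:~R / p%:R).
  by rewrite rmorphM fmorphV rmorph_nat rmorph_int.
by [].
Qed.

Lemma X_bound_nat a T v : exists N : nat, forall k : nat, (N <= k)%N ->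
  XX a (T + k%:R / p%:R) v = 0.
Proof.
have [B HB] := X_bound S M a v.
exists (Num.truncn (`|B - complex.Re T| * p%:R)).+1 => k kN; apply: HB.
have pR : (0 : R) < p%:R by rewrite ltr0n p_gt0.
rewrite (Re_addZp T k%:Z) -lerBlDl ler_pdivlMr //.
apply: le_trans (_ : `|B - complex.Re T| * p%:R <= _).
  by rewrite ler_pM2r // ler_norm.
apply: le_trans (_ : (Num.truncn (`|B - complex.Re T| * p%:R)).+1%:R <= _).
  by rewrite ltW // truncnS_gt.
by rewrite ler_nat.
Qed.

Definition primed (x : h) : h := x - hproj 0 x.

Definition conf_weight a : C := form (primed (emb a)) (primed (emb a)) / 2.

Lemma form_primed x y : form (primed x) (primed y) = form x y - form (hproj 0 x) y.
Proof.
rewrite /primed hformDl hformNl !hformDr !hformNr.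
have -> : form x (hproj 0 y) = form (hproj 0 x) y.
  by rewrite form_hprojC oppr0.
have -> : form (hproj 0 x) (hproj 0 y) = form (hproj 0 x) y.
  by rewrite -[RHS]form_hprojN oppr0.
by ring.
Qed.

(** The origin of the exponent [(a'|a')/2]: the left side adds up the corrections of [X_current].
    The classes i and p - i have the same [(a_i|a)], and their weights i/p and (p-i)/p add up to
    1. *)
Lemma conf_weightE a :
  \sum_(i < p) i%:R / p%:R * form (hproj i%:Z (emb a)) (emb a) = conf_weight a.
Proof.
rewrite /conf_weight form_primed.
set g := fun k : nat => form (hproj k%:Z (emb a)) (emb a).
have gE (k : nat) : (k < p)%N -> g (p - k)%N = g k.
  move=> kp; rewrite /g form_hprojC form_sym.
  have -> // : @hproj R h (- (p - k)%N%:Z) = hproj k%:Z.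
  apply: hproj_class; apply/eqP; rewrite int_classE.
  by rewrite (_ : - (p - k)%N%:Z - k%:Z = - p%:Z) ?rpredN ?dvdzz //; lia.
have -> : form (emb a) (emb a) = \sum_(0 <= i < p) g i.
  by rewrite big_mkord -{1}[emb a]hproj_sum form_suml.
rewrite (_ : \sum_(i < p) _ * _ = \sum_(0 <= i < p) i%:R / p%:R * g i).
  2: by rewrite big_mkord.
rewrite !(big_ltn (p_gt0 h)) !mul0r add0r [g 0%N + _]addrC addrK.
have two0 : (2 : C) != 0 by rewrite pnatr_eq0.
apply: (mulIf two0); rewrite divfK // mulr_natr mulr2n {2}big_nat_rev /= -big_split /=.
rewrite big_nat [RHS]big_nat; apply: eq_bigr => i /andP[i1 ip].
rewrite add1n subSS gE // -mulrDl -mulrDl -natrD subnKC ?(ltnW ip) // divff ?mul1r //.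
exact: pC_neq0.
Qed.

(** [D X_a = a_(-1) X_a], summed over the homogeneous components of a. A class i and an integer s
    merge into the single mode number [s p + i]. *)
Lemma X_ode a T v :
  (- T - 1) *: XX a T v =
  \sum_(k \in [set: nat]) act (- k.+1%:Z) (emb a) (XX a (T + k.+1%:R / p%:R) v)
  + \sum_(k \in [set: nat]) XX a (T - k%:R / p%:R) (act k%:Z (emb a) v)
  - conf_weight a *: XX a T v.
Proof.
have -> : - T - 1 = - (T + 1) by rewrite opprD.
rewrite -{2}(addrK 1 T) -X_derivative D_X tilde_sum.
rewrite (lin_sum (nprod_linear_l (-1) (X S a))) gpi_sum.
have xi (i : 'I_p) : hproj i%:Z (emb a) \in grading i.
  by rewrite -{2}(int_class_ord i) hproj_mem.
under eq_bigr => i _ do rewrite (X_current tilde_class a _ _ (xi i)) addrK.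
rewrite -conf_weightE scaler_suml !big_split /= sumrN; congr (_ + _ - _).
- have [N HN] := X_bound_nat a T v.
  have pB (k : nat) : (N * p <= k)%N -> (N <= k.+1)%N.
    by have := p_gt0 h; nia.
  rewrite [RHS](@fsum_nat _ (N * p)) => [|k kN]; last first.
    by rewrite HN ?(lin0 (act_linear HH _ _)) // pB.
  rewrite (sum_divmod p N (fun k => act (- k.+1%:Z) (emb a) (XX a (T + k.+1%:R / p%:R) v))).
  (* Classes are taken in reverse: class [p-i-1] at integer [s+1] gives the mode
     [-(s p + i + 1)/p]. *)
  rewrite exchange_big /= (reindex_inj rev_ord_inj) /=.
  apply: eq_bigr => i _; have ip := ltn_ord i.
  have E (s : nat) : (p - i.+1)%:R / p%:R - s.+1%:R = (- (s * p + i).+1%:Z)%:~R / p%:R :> C.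
    rewrite mulrNz -pmulrn natrB // -!natr1 !natrD natrM.
    by have := pC_neq0 h; move: (p%:R : C) => q q0; field.
  have E2 (s : nat) : T - (p - i.+1)%:R / p%:R + s.+1%:R = T + (s * p + i).+1%:R / p%:R.
    by rewrite -addrA [- _ + s.+1%:R]addrC -opprB E mulrNz mulNr opprK -pmulrn.
  have G (s : nat) u : pi (tilde S (hproj (p - i.+1)%N%:Z (emb a)))
       ((p - i.+1)%:R / p%:R - s.+1%:R) u = act (- (s * p + i).+1%:Z) (emb a) u.
    rewrite E /H_action; congr (pi (tilde S _) _ _).
    have -> // : @hproj R h (p - i.+1)%N%:Z = hproj (- (s * p + i).+1%:Z).
    apply: hproj_class; apply/eqP; rewrite int_classE.
    by apply/dvdzP; exists (s%:Z + 1); rewrite -subzn //; nia.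
  rewrite (@fsum_nat _ N) => [|s sN]; first by apply: eq_bigr => s _; rewrite G E2.
  by rewrite G E2 HN ?(lin0 (act_linear HH _ _)) //; have := p_gt0 h; nia.
- have [N HN] := act_bound (emb a) v.
  have pB (k : nat) : (N * p <= k)%N -> (N <= k)%N.
    by have := p_gt0 h; nia.
  rewrite [RHS](@fsum_nat _ (N * p)) => [|k kN]; last first.
    by rewrite HN ?pB // (lin0 (gpi_lin M _ _)).
  rewrite (sum_divmod p N (fun k => XX a (T - k%:R / p%:R) (act k%:Z (emb a) v))).
  rewrite exchange_big /=; apply: eq_bigr => i _; have ip := ltn_ord i.
  have E (s : nat) : i%:R / p%:R + s%:R = (s * p + i)%N%:Z%:~R / p%:R :> C.
    rewrite -pmulrn natrD natrM.
    by have := pC_neq0 h; move: (p%:R : C) => q q0; field.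
  have G (s : nat) u : pi (tilde S (hproj i%:Z (emb a))) (i%:R / p%:R + s%:R) u =
      act (s * p + i)%N%:Z (emb a) u.
    rewrite E /H_action; congr (pi (tilde S _) _ _).
    have -> // : @hproj R h i%:Z = hproj (s * p + i)%N%:Z.
    apply: hproj_class; apply/eqP; rewrite int_classE.
    by apply/dvdzP; exists (- s%:Z); rewrite PoszD PoszM; ring.
  have E2 (s : nat) : T - i%:R / p%:R - s%:R = T - (s * p + i)%:R / p%:R.
    by rewrite -addrA -opprD E -pmulrn.
  rewrite (@fsum_nat _ N) => [|s sN]; first by apply: eq_bigr => s _; rewrite G E2.
  by rewrite G HN ?(lin0 (gpi_lin M _ _)) //; have := p_gt0 h; nia.
Qed.

End CurrentEquation.

(** * Local nilpotency of the positive modes *)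

Section Nilpotency.
Variables (R : realType) (h : graded_space R) (L : lattice_data h).
Variables (A : vertex_superalgebra R) (S : lattice_structure L A).
Variables (V : lmodType R[i]) (M : generalized_module V A).
Local Notation C := R[i].
Local Notation p := (period h).
Local Notation emb := (lembed L).
Local Notation pi := (gpi M).
Hypothesis tilde_class : forall (i : 'I_p) (x : h), x \in grading i ->
       is_field_class (i%:R / p%:R) (pi (tilde S x)).
Implicit Types (a : lattice_type h) (x y : h) (v u : V) (m T : C).

Local Notation act := (H_action S M).
Local Notation XX a := (gpi M (X S a)).

Let HH : is_H_module act id := act_H_module tilde_class.

Lemma varkappa_neq0 a b : varkappa L a b != 0.
Proof.
rewrite /varkappa !mulf_neq0 ?cocycle_neq0 ?expfz_neq0 ?pC_neq0 //.
rewrite prodf_seq_neq0; apply/allP => s; rewrite mem_index_iota => /andP[s1 sp] /=.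
rewrite expfz_neq0 // subr_eq0 eq_sym -(prim_order_dvd (omega_primitive R (p_gt0 h))).
by rewrite gtnNdvd.
Qed.

Lemma X_localN a b : exists N, localN N
  (odd `|to_int (form (emb a) (emb a))|) (odd `|to_int (form (emb b) (emb b))|) (XX a) (XX b).
Proof. by apply/local_localN/gpi_local; exact: X_parity. Qed.

(** The product of index [-(a|b) - 1], the first nonzero one, through [gnprodE]. N may exceed any
    prescribed bound, in particular every [|m_s|], which clears the poles of the exchange factor. *)
Lemma X_product a b N0 : exists N : nat,
  [/\ (N0 <= N)%N,
      forall s, (s < p)%N -> - N%:Z <= mexp L s a b,
      forall T v, exists2 r : seq C, uniq r & forall c, c \notin r ->
        iter N (@fdiff R V C) (prodf (XX a) (XX b) T v) c = 0
    & forall T v,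
      varkappa L a b *: XX (a + b) (T + (mexp L 0 a b)%:~R + 1) v =
      \sum_(c \in [set: C]) gbinom (- c - 1) (absz (mexp L 0 a b + N%:Z)%R) *:
         iter N (@fdiff R V C) (prodf (XX a) (XX b) T v) c].
Proof.
have [N1 HN1] := X_localN a b.
have [B Bs] : exists B : nat, forall s, (s < p)%N -> (absz (mexp L s a b) <= B)%N.
  exists (\sum_(s < p) absz (mexp L s a b))%N => s sp.
  by rewrite (bigD1 (Ordinal sp)) //= leq_addr.
exists (N0 + N1 + B)%N.
have HN := localN_le (leq_trans (leq_addl N0 N1) (leq_addr B (N0 + N1)%N)) HN1.
split; first by rewrite -addnA leq_addr.
- by move=> s /Bs; lia.
- by move=> T v; exact: (local_support (gpi_field M _) (gpi_field M _) HN).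
move=> T v; have B0 := Bs 0%N (p_gt0 h).
have := X_X S a b 0; rewrite -mexp0 subr0 fact0 divr1 /= => E.
rewrite -gpiZ -E (gpi_nprod M _ _ _ (X_parity S a) (X_parity S b)).
rewrite (gnprodE (gpi_field M _) (gpi_field M _) HN) ifF; last first.
  by lia.
have -> : (T + (mexp L 0 a b)%:~R + 1 + (- mexp L 0 a b - 1)%:~R) = T :> C.
  by rewrite intrD !mulrNz; ring.
by apply: eq_fsbigr => c _; congr (gbinom _ (absz _) *: _); ring.
Qed.

(** If both thresholds are low, every term of the product formula vanishes: below b in the order
    X_(-a) X_a, because X_a kills u there, and from b on in the other order, available by
    locality. *)
Lemma X_nonvanish a : exists K : R, forall (B b : R) u, B + b <= K ->
  (forall m, B <= complex.Re m -> XX a m u = 0) ->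
  (forall m, b <= complex.Re m -> XX (- a) m u = 0) -> u = 0.
Proof.
have [N1 HN1] := X_localN (- a) a.
have [N' [N'le _ _ HK]] := X_product (- a) a N1.
have HN := localN_le N'le HN1.
(* With this total index the product is read at index -1, the only one where the constant series is
   nonzero. *)
pose T : C := -1 - 1 - (mexp L 0 (- a) a)%:~R.
exists (complex.Re T - N'%:R) => B b u BbK HB Hb.
have {HK} := HK T u; rewrite addNr X_0.
have -> : T + (mexp L 0 (- a) a)%:~R + 1 = -1 by rewrite /T; ring.
rewrite gpiZ gpi_vacuum /one_series eqxx scalerA fsbig1 => [/eqP|c _].
  rewrite scaler_eq0 mulf_eq0 (negbTE (varkappa_neq0 _ _)) (negbTE (cocycle_neq0 _ _ _)).
  by move=> /eqP.
case: (ltP (complex.Re c) b) => cb.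
  rewrite iter_fdiffE big1 ?scaler0 // => s _.
  rewrite /prodf HB ?(lin0 (gpi_lin M _ _)) ?scaler0 //.
  have sN : (s%:R <= N'%:R :> R) by rewrite ler_nat -ltnS.
  by rewrite cReB [complex.Re (c + _)]cReD cRe_nat; lra.
rewrite HN iter_fdiffE big1 ?scaler0 // => s _.
rewrite /prodb Hb ?(lin0 (gpi_lin M _ _)) ?scaler0 //.
by rewrite cReD cRe_nat; have : (0 <= s%:R :> R) by []; lra.
Qed.

Definition wt (xi : weight h) x : C := xi (vsproj (hcomp h 0) (hproj 0 x)).

Lemma act0_weight xi x v : weight_space act xi v -> act 0 x v = wt xi x *: v.
Proof.
move=> Hv; rewrite (act_hproj HH) -[hproj 0 x](vsprojK (hproj_mem 0 x)).
exact: Hv.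
Qed.

Lemma weight_act xi (k : int) x v : weight_space act xi v -> weight_space act xi (act k x v).
Proof.
move=> Hv y; case: (eqVneq k 0) => [->|k0].
  have := act_comm HH 0 0 (vsval y) x v; rewrite addr0 eqxx !mul0r scale0r => /eqP.
  by rewrite subr_eq0 => /eqP ->; rewrite Hv (linZ (act_linear HH _ _)).
by rewrite (act_commute HH) ?add0r // Hv (linZ (act_linear HH _ _)).
Qed.

Lemma weight_lin xi (c : C) u v : weight_space act xi u -> weight_space act xi v ->
  weight_space act xi (c *: u + v).
Proof.
by move=> Hu Hv x; rewrite (act_linear HH) Hu Hv scalerDr !scalerA mulrC.
Qed.

(* Every sequence of positive modes of a eventually kills u. *)
Inductive lnil a : V -> Prop :=
| lnil0 : lnil a 0
| lnilS u : (forall k : nat, lnil a (act k.+1%:Z (emb a) u)) -> lnil a u.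

(** The state of the nilpotency induction: B and b are the thresholds fed to [X_nonvanish], and N is
    the induction variable. Positive modes of a preserve the whole set. *)
Definition nilset a xi (B b : R) (N : nat) u :=
  [/\ weight_space act xi u,
      forall m, B <= complex.Re m -> XX a m u = 0,
      forall m, b <= complex.Re m -> XX (- a) m u = 0
    & forall k : nat, (N < k)%N -> act k%:Z (emb a) u = 0].

Lemma pR_gt0 : (0 : R) < p%:R.
Proof. by rewrite ltr0n p_gt0. Qed.

Lemma nilset_act a xi B b N (k : nat) u : nilset a xi B b N u ->
  nilset a xi B b N (act k.+1%:Z (emb a) u).
Proof.
have le_shift m (c : R) : c <= complex.Re m -> c <= complex.Re (m + k.+1%:Z%:~R / p%:R).
  move=> cm; rewrite Re_addZp (le_trans cm) // lerDl divr_ge0 ?ler0z ?ler0n //.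
move=> [Hw HB Hb Hk]; split.
- exact: weight_act.
- move=> m Bm; have := X_act tilde_class k.+1%:Z (emb a) a m u.
  rewrite HB // (lin0 (act_linear HH _ _)) [XX a (m + _) u]HB ?le_shift //.
  by rewrite scaler0 addr0.
- move=> m Bm; have := X_act tilde_class k.+1%:Z (emb a) (- a) m u.
  rewrite Hb // (lin0 (act_linear HH _ _)) [XX (- a) (m + _) u]Hb ?le_shift //.
  by rewrite scaler0 addr0.
- move=> j Nj; rewrite (act_commute HH); last by lia.
  by rewrite Hk // (lin0 (act_linear HH _ _)).
Qed.

(* In the differential equation at index m + (N+1)/p only the term X_a(m) a((N+1)/p) u survives. *)
Lemma nilset_top a xi B b N u : nilset a xi B b N.+1 u ->
  nilset a xi (B - p%:R^-1) b N.+1 (act N.+1%:Z (emb a) u).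
Proof.
move=> Hu; have := nilset_act N Hu => -[H1 H2 H3 H4]; split=> // m Bm.
have [Hw HB Hb Hk] := Hu.
have pi0 : 0 < p%:R^-1 :> R by rewrite invr_gt0 pR_gt0.
have ReS (k : nat) : complex.Re (m + k%:R / p%:R) = complex.Re m + k%:R / p%:R.
  exact: (Re_addZp h m k).
have invS (k : nat) : (k.+1%:R / p%:R : R) = k%:R / p%:R + p%:R^-1.
  by rewrite -natr1 mulrDl mul1r.
have ge0p (k : nat) : 0 <= (k%:R / p%:R : R) by rewrite divr_ge0 ?ler0n.
have BT : B <= complex.Re (m + N.+1%:R / p%:R).
  by rewrite ReS invS; have := ge0p N; lra.
have := X_ode tilde_class a (m + N.+1%:R / p%:R) u.
rewrite HB // !scaler0 subr0 fsbig1 ?add0r => [|k _]; last first.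
  rewrite HB ?(lin0 (act_linear HH _ _)) //.
  by rewrite (Re_addZp h _ k.+1) (le_trans BT) // lerDl; exact: ge0p.
rewrite (@fsum_nat _ N.+2) => [|k Nk]; last by rewrite Hk ?(lin0 (gpi_lin M _ _)).
rewrite big_ord_recr /= addrK big1 ?add0r => [/esym//|[k /= kN] _].
case: k kN => [|k] kN.
  by rewrite mul0r subr0 (act0_weight _ Hw) (linZ (gpi_lin M _ _)) HB // scaler0.
have [_ HB' _ _] := nilset_act k Hu; apply: HB'.
have -> : m + N.+1%:R / p%:R - k.+1%:R / p%:R = m + (N - k)%N%:R / p%:R :> C.
  have kN' : (k <= N)%N by lia.
  by rewrite natrB // -!natr1; ring.
have -> : (N - k = (N - k).-1.+1)%N by lia.
by rewrite ReS invS; have := ge0p (N - k).-1; lra.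
Qed.

Lemma nilset_iter a xi B b N d u : nilset a xi B b N.+1 u ->
  nilset a xi (B - d%:R / p%:R) b N.+1 (iter d (act N.+1%:Z (emb a)) u).
Proof.
elim: d => [|d IH] Hu; first by rewrite mul0r subr0.
have := nilset_top (IH Hu); rewrite iterS.
by rewrite -natr1 mulrDl mul1r opprD addrA.
Qed.

(** Induction on N. Each application of the top mode lowers B by 1/p, so by [X_nonvanish] some power
    of it kills u; then induction on that power. The last nonzero iterate is killed by the top mode,
    so it is covered by the smaller N. *)
Lemma nilset_lnil a xi B b N u : nilset a xi B b N u -> lnil a u.
Proof.
elim: N u => [|N IH] u Hu.
  by have [_ _ _ Hk] := Hu; apply: lnilS => k; rewrite Hk //; exact: lnil0.
have [K HK] := X_nonvanish a.
pose d := (Num.truncn (`|B + b - K| * p%:R)).+1.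
have : iter d (act N.+1%:Z (emb a)) u = 0.
  have [_ H1 H2 _] := nilset_iter d Hu; apply: HK H1 H2.
  have : B + b - K <= d%:R / p%:R; last by lra.
  rewrite ler_pdivlMr ?pR_gt0 //; apply: le_trans (_ : `|B + b - K| * p%:R <= _).
    by rewrite ler_pM2r ?pR_gt0 // ler_norm.
  by rewrite ltW // truncnS_gt.
move: d => d; elim: d u Hu => [|d IHd] u Hu; first by move=> /= ->; exact: lnil0.
move=> Ed; have : lnil a (iter d (act N.+1%:Z (emb a)) u).
  have : nilset a xi B b N.+1 (iter d (act N.+1%:Z (emb a)) u).
    by elim: {IHd Ed} d => //= d; exact: nilset_act.
  case=> W1 W2 W3 W4; apply: IH; split=> // k Nk.
  case: (ltnP N.+1 k) => [/W4//|kN]; have -> : k = N.+1 by lia.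
  by rewrite -iterS.
(* The property is carried back from the d-th iterate to u by induction on its derivation, for all u
   at once. Positive modes commute with the top one, so the hypotheses pass to [a(k) u]; a zero
   iterate is the case of a smaller power. *)
move E: (iter d _ u) => w Hw; elim: Hw u Hu Ed E => {w} [|w Hw IHw] u Hu Ed E.
  exact: IHd.
apply: lnilS => k; apply: IHw; first exact: nilset_act.
  have -> : forall n, iter n (act N.+1%:Z (emb a)) (act k.+1%:Z (emb a) u) =
      act k.+1%:Z (emb a) (iter n (act N.+1%:Z (emb a)) u).
    by elim=> //= n ->; rewrite (act_commute HH) //; lia.
  by rewrite Ed (lin0 (act_linear HH _ _)).
rewrite -E; elim: (d) => //= n ->; rewrite (act_commute HH) //; lia.
Qed.

Lemma weight_lnil a xi u : weight_space act xi u -> lnil a u.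
Proof.
move=> Hw; have [B HB] := X_bound S M a u; have [b Hb] := X_bound S M (- a) u.
have [N HN] := act_bound tilde_class (emb a) u.
by apply: (@nilset_lnil a xi B b N); split=> // k /ltnW; exact: HN.
Qed.

(** By the recursion, degree j+1 on u is a combination of degrees j-k on the vectors obtained by the
    (k+1)-st mode. Only k < N matters, so a common bound J for these vectors gives [J + N + 1] for
    u. *)
Lemma lnil_E_plus a u : lnil a u -> exists J : nat, forall j, (J <= j)%N ->
  E_plus L act a j u = 0.
Proof.
elim=> {u} [|u _ IH]; first by exists 0%N => j _; rewrite (lin0 (E_plus_linear L HH _ _)).
have [N HN] := act_bound tilde_class (emb a) u.
have [J HJ] : exists J : nat, forall k j, (k < N)%N -> (J <= j)%N ->
    E_plus L act a j (act k.+1%:Z (emb a) u) = 0.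
  elim: {HN} N => [|N [J HJ]]; first by exists 0%N.
  have [J' HJ'] := IH N; exists (maxn J J') => k j kN; rewrite geq_max => /andP[j1 j2].
  by move: kN; rewrite ltnS leq_eqVlt => /orP[/eqP ->|kN]; [exact: HJ'|exact: HJ].
exists (J + N).+1 => -[//|j] jJ; apply: (@natS_scaleI _ _ j).
rewrite scaler0 (E_plus_opexp L HH a).2 big1 // => k _; rewrite subSS.
rewrite /Bplus (act_E_plus L HH); case: (ltnP k N) => kN.
  by rewrite HJ ?scaler0 //; have := ltn_ord k; lia.
by rewrite HN ?(lin0 (E_plus_linear L HH _ _)) ?scaler0 // leqW.
Qed.

Lemma weight_E_plus_bound a xi u : weight_space act xi u ->
  exists J : nat, forall j, (J <= j)%N -> E_plus L act a j u = 0.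
Proof. by move=> /(weight_lnil a)/lnil_E_plus. Qed.

End Nilpotency.

(** * The operators e(a) *)

Section EventuallyZero.
Variables (R : realType) (V : lmodType R[i]).
Implicit Types F G : nat -> V.

Definition ev0 F := exists N : nat, forall i, (N <= i)%N -> F i = 0.

Lemma ev0_all (P : nat -> nat -> Prop) K :
  (forall k, exists N : nat, forall i, (N <= i)%N -> P k i) ->
  exists N : nat, forall k i, (k < K)%N -> (N <= i)%N -> P k i.
Proof.
move=> H; elim: K => [|K [N HN]]; first by exists 0%N.
have [N' HN'] := H K; exists (maxn N N') => k i kK; rewrite geq_max => /andP[i1 i2].
by move: kK; rewrite ltnS leq_eqVlt => /orP[/eqP ->|kK]; [exact: HN'|exact: HN].
Qed.

Lemma fsumD F G : ev0 F -> ev0 G ->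
  \sum_(i \in [set: nat]) (F i + G i) =
  \sum_(i \in [set: nat]) F i + \sum_(i \in [set: nat]) G i.
Proof.
move=> [N HN] [N' HN']; rewrite !(@fsum_nat _ (maxn N N')) ?big_split // => i;
  by rewrite geq_max => /andP[i1 i2]; rewrite ?HN ?HN' ?addr0.
Qed.

Lemma lin_fsum (O : V -> V) F : linear O -> ev0 F ->
  O (\sum_(i \in [set: nat]) F i) = \sum_(i \in [set: nat]) O (F i).
Proof.
move=> lO [N HN]; rewrite !(@fsum_nat _ N) ?(lin_sum lO) // => i iN.
by rewrite HN // (lin0 lO).
Qed.

Lemma fsumZ (c : R[i]) F : ev0 F ->
  c *: (\sum_(i \in [set: nat]) F i) = \sum_(i \in [set: nat]) c *: F i.
Proof.
by apply: (lin_fsum (O := fun w => c *: w)) => d w w'; rewrite scalerDr !scalerA mulrC.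
Qed.

Lemma ev0Z (c : R[i]) F : ev0 F -> ev0 (fun i => c *: F i).
Proof. by move=> [N HN]; exists N => i iN; rewrite HN // scaler0. Qed.

Lemma ev0D F G : ev0 F -> ev0 G -> ev0 (fun i => F i + G i).
Proof.
move=> [N HN] [N' HN']; exists (maxn N N') => i; rewrite geq_max => /andP[i1 i2].
by rewrite HN // HN' // addr0.
Qed.

Lemma fsum_shift (k : nat) F : ev0 F -> (forall i, (i < k)%N -> F i = 0) ->
  \sum_(i \in [set: nat]) F i = \sum_(i \in [set: nat]) F (k + i)%N.
Proof.
move=> [N HN] F0; rewrite (@fsum_nat _ (k + N)) => [|i iN]; last first.
  by rewrite HN // (leq_trans _ iN) // leq_addl.
rewrite (@fsum_nat _ N) => [|i iN]; last first.
  by rewrite HN // (leq_trans iN) // leq_addl.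
by rewrite big_split_ord /= big1 ?add0r // => i _; rewrite F0.
Qed.

End EventuallyZero.

(** * The series [E_-(-a,z) X_a(z)] *)

Section DressedOperators.
Variables (R : realType) (h : graded_space R) (L : lattice_data h).
Variables (A : vertex_superalgebra R) (S : lattice_structure L A).
Variables (V : lmodType R[i]) (M : generalized_module V A).
Local Notation C := R[i].
Local Notation p := (period h).
Local Notation emb := (lembed L).
Local Notation pi := (gpi M).
Hypothesis tilde_class : forall (i : 'I_p) (x : h), x \in grading i ->
       is_field_class (i%:R / p%:R) (pi (tilde S x)).
Implicit Types (a : lattice_type h) (x y : h) (v u : V) (m T : C) (xi : weight h).

Local Notation act := (H_action S M).
Local Notation XX a := (gpi M (X S a)).
Local Notation Em := (E_minus L act).
Local Notation Ez := (E_minusz L act).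
Local Notation Wt := (weight_space act).
Local Notation c_ := (conf_weight L).

Let HH : is_H_module act id := act_H_module tilde_class.
Let p0 : (p%:R : C) != 0 := pC_neq0 h.
Let lEm a k := E_minus_linear L HH a k.
Let lact k x := act_linear HH k x.
Let lX a m := gpi_lin M (X S a) m.

Lemma idxD (i j : nat) : ((i + j)%N%:R / p%:R : C) = i%:R / p%:R + j%:R / p%:R.
Proof. by rewrite natrD mulrDl. Qed.

(* The coefficient of z^(-m-1) in E_-(-a,z) X_a(z) v *)
Definition Wop a m v : V := \sum_(i \in [set: nat]) Em (- a) i (XX a (m + i%:R / p%:R) v).

Lemma Wop_ev0 a m v : ev0 (fun i => Em (- a) i (XX a (m + i%:R / p%:R) v)).
Proof.
by have [N HN] := X_bound_nat S M a m v; exists N => i iN; rewrite HN // (lin0 (lEm _ _)).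
Qed.

Lemma Wop_linear a m : linear (Wop a m).
Proof.
move=> c u v; rewrite /Wop (fsumZ c (Wop_ev0 a m u)).
rewrite -(fsumD (ev0Z c (Wop_ev0 a m u)) (Wop_ev0 a m v)).
by apply: eq_fsbigr => i _; rewrite (lX a) (lEm (- a)).
Qed.

Lemma Wop_bound a m v : exists N : nat, forall k, (N <= k)%N -> Wop a (m + k%:R / p%:R) v = 0.
Proof.
have [N HN] := X_bound_nat S M a m v; exists N => k kN; apply: fsbig1 => i _.
by rewrite -addrA -idxD HN ?(lin0 (lEm _ _)) // (leq_trans kN) // leq_addr.
Qed.

(** Passing X_a costs [(x|a)] (the term [G]), passing E_-(-a,z) costs [-(x|a)] (the term [F3]); they
    cancel after a shift by k+1. *)
Lemma Wop_act_pos a m (k : nat) x v :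
  act k.+1%:Z x (Wop a m v) = Wop a m (act k.+1%:Z x v).
Proof.
rewrite /Wop (lin_fsum (lact _ _) (Wop_ev0 a m v)).
set f := form (hproj k.+1%:Z x) (emb a).
pose F i := Em (- a) i (XX a (m + i%:R / p%:R) (act k.+1%:Z x v)).
pose G i := f *: Em (- a) i (XX a (m + (k.+1 + i)%:R / p%:R) v).
pose F3 i := - f *: Ez (- a) (i%:Z - k.+1%:Z) (XX a (m + i%:R / p%:R) v).
have [N HN] := X_bound_nat S M a m v.
have eF : ev0 F := Wop_ev0 a m _.
have eG : ev0 G.
  by exists N => i iN; rewrite /G HN ?(lin0 (lEm _ _)) ?scaler0 // (leq_trans iN) // leq_addl.
have eH : ev0 F3.
  by exists N => i iN; rewrite /F3 HN // (lin0 (E_minusz_linear L HH _ _)) scaler0.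
have E i : act k.+1%:Z x (Em (- a) i (XX a (m + i%:R / p%:R) v)) = F i + G i + F3 i.
  rewrite -[Em _ _ _]/(Ez (- a) i%:Z _) (act_E_minusz L HH) X_act // embN hformNr.
  rewrite /F /G /F3 /= (linD (lEm _ _)) (linZ (lEm _ _)).
  by rewrite -[k.+1%:~R]/(k.+1%:R) addnC idxD addrA.
under eq_fsbigr => i _ do rewrite E.
rewrite (fsumD (ev0D eF eG) eH) (fsumD eF eG) -addrA -[RHS]addr0; congr (_ + _).
rewrite (fsum_shift (k := k.+1) eH) => [|i ik].
  rewrite -(fsumD eG).
    apply: fsbig1 => i _; rewrite /G /F3 (_ : (k.+1 + i)%N%:Z - k.+1%:Z = i%:Z); last by lia.
    by rewrite -scalerDl subrr scale0r.
  by have [N2 H2] := eH; exists N2 => i iN; rewrite H2 // (leq_trans iN) // leq_addl.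
by rewrite /F3 E_minusz_lt0 ?scaler0 //; lia.
Qed.

Lemma Wop_act_neg a m (k : nat) x v :
  act (- k%:Z) x (Wop a m v) =
  Wop a m (act (- k%:Z) x v) +
  form (hproj (- k%:Z) x) (emb a) *: Wop a (m - k%:R / p%:R) v.
Proof.
rewrite /Wop (lin_fsum (lact _ _) (Wop_ev0 a m v)).
set f := form _ (emb a).
have e1 := Wop_ev0 a (m - k%:R / p%:R) v.
rewrite (fsumZ f e1) -(fsumD (Wop_ev0 a m _) (ev0Z f e1)).
apply: eq_fsbigr => i _; rewrite (actN_E_minus L HH) X_act // (linD (lEm _ _)) (linZ (lEm _ _)).
by rewrite mulrNz mulNr -[k%:~R]/(k%:R) addrAC.
Qed.

(** [E_-(a,z) E_-(-a,z) = E_-(0,z) = 1]; cutting at the truncation bound of X_a leaves a triangular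
    double sum. *)
Lemma Wop_inv a m v :
  XX a m v = \sum_(i \in [set: nat]) Em a i (Wop a (m + i%:R / p%:R) v).
Proof.
have [N HN] := X_bound_nat S M a m v.
have x0 (k : nat) i : (N <= k + i)%N -> XX a (m + k%:R / p%:R + i%:R / p%:R) v = 0.
  by move=> ki; rewrite -addrA -idxD HN.
rewrite (@fsum_nat _ N.+1) => [|i iN]; last first.
  rewrite /Wop fsbig1 ?(lin0 (lEm _ _)) // => j _.
  by rewrite x0 ?(lin0 (lEm _ _)) // (leq_trans (ltnW iN)) // leq_addr.
rewrite (eq_bigr (fun i : 'I_N.+1 => \sum_(j < N.+1 - i)
   Em a i (Em (- a) j (XX a (m + (i + j)%:R / p%:R) v)))); last first.
  move=> i _; rewrite /Wop (@fsum_nat _ (N.+1 - i)) => [|j jN].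
    by rewrite (lin_sum (lEm _ _)); apply: eq_bigr => j _; rewrite idxD addrA.
  by rewrite x0 ?(lin0 (lEm _ _)) //; lia.
rewrite (sum_tri N.+1 (fun i j => Em a i (Em (- a) j (XX a (m + (i + j)%:R / p%:R) v)))).
rewrite (eq_bigr (fun k : 'I_N.+1 => @opone R V k (XX a (m + k%:R / p%:R) v))).
  rewrite big_ord_recl /opone /= mul0r addr0 big1 ?addr0 //.
move=> k _; rewrite -(E_minus_lattice0 L HH) -(addrN a) (E_minusD L HH) /opmul.
by apply: eq_bigr => i _; rewrite subnKC // -ltnS.
Qed.

(** Differentiating the factor E_-(-a,z) removes all negative modes from [X_ode]. On a weight vector
    the zero mode is a scalar, so only positive modes remain. *)
Lemma Wop_ode a xi m v : Wt xi v ->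
  (- m - 1 - wt xi (emb a) + c_ a) *: Wop a m v =
  \sum_(k \in [set: nat]) Wop a (m - k.+1%:R / p%:R) (act k.+1%:Z (emb a) v).
Proof.
move=> Hw; set mu := - m - 1 - _ + _.
have [K HK] := act_bound tilde_class (emb a) v.
have [N1 HN1] := X_bound_nat S M a m v.
have [N2 HN2] := ev0_all K (fun k =>
  X_bound_nat S M a (m - k.+1%:R / p%:R) (act k.+1%:Z (emb a) v)).
pose N := maxn N1 N2.
have x0 i : (N <= i)%N -> XX a (m + i%:R / p%:R) v = 0.
  by rewrite geq_max => /andP[i1 _]; exact: HN1.
have y0 k i : (k < K)%N -> (N <= i)%N ->
   XX a (m - k.+1%:R / p%:R + i%:R / p%:R) (act k.+1%:Z (emb a) v) = 0.
  by move=> kK; rewrite geq_max => /andP[_]; exact: HN2.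
have aK k : (K <= k)%N -> act k.+1%:Z (emb a) v = 0 by move=> /leqW; exact: HK.
have ode i : mu *: XX a (m + i%:R / p%:R) v =
    (i%:R / p%:R) *: XX a (m + i%:R / p%:R) v +
    \sum_(k < N - i) act (- k.+1%:Z) (emb a) (XX a (m + (i + k).+1%:R / p%:R) v) +
    \sum_(k < K) XX a (m - k.+1%:R / p%:R + i%:R / p%:R) (act k.+1%:Z (emb a) v).
  have := X_ode tilde_class a (m + i%:R / p%:R) v.
  rewrite (@fsum_nat _ (N - i)) => [|k kN]; last first.
    rewrite -addrA -idxD x0 ?(lin0 (lact _ _)) //; lia.
  rewrite (@fsum_nat _ K.+1) => [|k kK]; last by rewrite HK ?(lin0 (lX _ _)) // ltnW.
  rewrite big_ord_recl mul0r subr0 (act0_weight tilde_class _ Hw) (linZ (lX _ _)).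
  move=> E; have -> : mu = (- (m + i%:R / p%:R) - 1) + i%:R / p%:R + (c_ a - wt xi (emb a)).
    by rewrite /mu; ring.
  rewrite 2!scalerDl E scalerBl.
  set s1 := \sum_(k < N - i) _; set s2 := \sum_(k < K) _.
  have -> : \sum_(k < N - i) act (- k.+1%:Z) (emb a) (XX a (m + (i + k).+1%:R / p%:R) v) = s1.
    by apply: eq_bigr => k _; rewrite -addnS idxD addrA.
  have -> : \sum_(k < K) XX a (m - k.+1%:R / p%:R + i%:R / p%:R) (act k.+1%:Z (emb a) v) = s2.
    by apply: eq_bigr => k _; rewrite addrAC.
  set w1 := wt _ _ *: _; set w2 := c_ a *: _; set w3 := (i%:R / p%:R) *: _.
  rewrite addrA (addrAC _ w3) subrK (addrC w1) addrA (addrAC _ w1) addrK.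
  by rewrite addrC addrA.
have WE : Wop a m v = \sum_(i < N) Em (- a) i (XX a (m + i%:R / p%:R) v).
  by rewrite /Wop (@fsum_nat _ N) // => i iN; rewrite x0 ?(lin0 (lEm _ _)).
rewrite WE scaler_sumr.
under eq_bigr => i _ do rewrite -(linZ (lEm _ _)) ode !(linD (lEm _ _)).
rewrite !big_split /=.
(* The derivative of E_-(-a,z), by its recursion: exactly the opposite of the sum of negative modes
   treated next. *)
have -> : \sum_(i < N) Em (- a) i ((i%:R / p%:R) *: XX a (m + i%:R / p%:R) v) =
   - \sum_(n < N) \sum_(j < n.+1) act (- j.+1%:Z) (emb a)
       (Em (- a) (n - j)%N (XX a (m + n.+1%:R / p%:R) v)).
  transitivity (\sum_(i < N.+1) (i%:R / p%:R) *: Em (- a) i (XX a (m + i%:R / p%:R) v)).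
    rewrite big_ord_recr /= x0 ?(lin0 (lEm _ _)) ?scaler0 ?addr0 //.
    by apply: eq_bigr => i _; rewrite (linZ (lEm _ _)).
  rewrite big_ord_recl mul0r scale0r add0r -sumrN; apply: eq_bigr => n _.
  rewrite lift0 mulrC -scalerA (E_minus_opexp L HH (- a)).2 scaler_sumr -sumrN.
  apply: eq_bigr => j _; rewrite /Bminus scalerA mulVf // scale1r embN subSS.
  exact: (linN (act_linear_arg HH _ _)).
have -> : \sum_(i < N) Em (- a) i (\sum_(k < N - i) act (- k.+1%:Z) (emb a)
      (XX a (m + (i + k).+1%:R / p%:R) v)) =
   \sum_(n < N) \sum_(j < n.+1) act (- j.+1%:Z) (emb a)
       (Em (- a) (n - j)%N (XX a (m + n.+1%:R / p%:R) v)).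
  under eq_bigr => i _ do rewrite (lin_sum (lEm _ _)).
  rewrite (sum_tri N (fun i k => Em (- a) i (act (- k.+1%:Z) (emb a)
      (XX a (m + (i + k).+1%:R / p%:R) v)))).
  apply: eq_bigr => n _; rewrite (reindex_inj rev_ord_inj) /=; apply: eq_bigr => j _.
  have jn : (j <= n)%N by rewrite -ltnS.
  by rewrite subSS subKn // subnK // (actN_E_minus L HH).
rewrite addNr add0r (@fsum_nat _ K) => [|k kK]; last by rewrite aK // (lin0 (Wop_linear _ _)).
under eq_bigr => i _ do rewrite (lin_sum (lEm _ _)).
rewrite exchange_big; apply: eq_bigr => k _ /=.
rewrite /Wop (@fsum_nat _ N) // => i iN.
by rewrite y0 ?(lin0 (lEm _ _)).
Qed.

End DressedOperators.

(** * Linear maps glued along a direct sum *)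

Section DirectSums.
Variables (K : fieldType) (V V' : lmodType K) (I : choiceType) (W : I -> set V).
Hypothesis ds : direct_sum W.

Lemma finite_support_seq (U : zmodType) (F : I -> U) :
  finite_set [set i | F i != 0]%classic ->
  exists2 r : seq I, uniq r & forall i, i \notin r -> F i = 0.
Proof.
move=> fF; exists (fset_set [set i | F i != 0]%classic); first exact: fset_uniq.
move=> i; rewrite in_fset_set // => /negP iN; apply/eqP/negPn/negP => Fi.
by apply: iN; rewrite inE.
Qed.

Lemma seq_finite_support (U : zmodType) (F : I -> U) (r : seq I) :
  (forall i, i \notin r -> F i = 0) -> finite_set [set i | F i != 0]%classic.
Proof.
move=> Fr; apply: (@sub_finite_set _ _ [set` r]%classic); last exact: finite_seq.
by move=> i /= Fi; apply: contraNT Fi => /Fr ->.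
Qed.

Lemma direct_sum_glue (F : I -> V -> V') : (forall i, linear (F i)) ->
  exists G : V -> V', linear G /\ forall i v, W i v -> G v = F i v.
Proof.
move=> lF; case: ds => sW dW.
have F0 i : F i 0 = 0.
  by have := lF i (-1) 0 0; rewrite scaler0 addr0 scaleN1r addNr.
pose w v := projT1 (cid (dW v)).
have wP v := projT2 (cid (dW v)).
exists (fun v => \sum_(i \in [set: I]) F i (w v i)); split=> [c u v|i v Wv].
  have [[Wu /finite_support_seq[ru ruU ru0] Eu] _] := wP u.
  have [[Wv /finite_support_seq[rv rvU rv0] Ev] _] := wP v.
  pose r := undup (ru ++ rv); have ur : uniq r by exact: undup_uniq.
  have r1 i : i \notin r -> w u i = 0.
    by rewrite mem_undup mem_cat negb_or => /andP[/ru0].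
  have r2 i : i \notin r -> w v i = 0.
    by rewrite mem_undup mem_cat negb_or => /andP[_ /rv0].
  have wE : w (c *: u + v) = fun i => c *: w u i + w v i.
    have [_ H] := wP (c *: u + v); apply: H; split.
    - by move=> i; apply: (sW i).2.
    - by apply: (@seq_finite_support _ _ r) => i ir; rewrite r1 // r2 // scaler0 addr0.
    - rewrite (@fsum_seq _ _ r) // => [|i ir]; last by rewrite r1 // r2 // scaler0 addr0.
      rewrite big_split /= -scaler_sumr {1}Eu {1}Ev.
      by rewrite (@fsum_seq _ _ r (w u)) // (@fsum_seq _ _ r (w v)).
  rewrite !(@fsum_seq _ _ r) ?wE // => [|i ir|i ir|i ir].
  - by rewrite scaler_sumr -big_split; apply: eq_bigr => i _ /=; rewrite lF.
  - by rewrite r2.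
  - by rewrite r1.
  - by rewrite r1 // r2 // scaler0 addr0.
have wE : w v = fun j => if j == i then v else 0.
  have [_ H] := wP v; apply: H; split.
  - by move=> j; case: eqP => [->|_] //; exact: (sW j).1.
  - apply: (@seq_finite_support _ _ [:: i]) => j; rewrite inE => /negbTE ->.
    by [].
  - rewrite (@fsum_seq _ _ [:: i]) ?big_seq1 ?eqxx // => j; rewrite inE => /negbTE ->.
    by [].
rewrite (@fsum_seq _ _ [:: i]) ?big_seq1 ?wE ?eqxx // => j; rewrite inE => /negbTE ->.
exact: F0.
Qed.

Lemma direct_sum_agree (G G' : V -> V') : linear G -> linear G' ->
  (forall i v, W i v -> G v = G' v) -> forall v, G v = G' v.
Proof.
have sum_lin (O : V -> V') (F : I -> V) (r : seq I) : linear O ->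
    O (\sum_(i <- r) F i) = \sum_(i <- r) O (F i).
  move=> lO; have O0 : O 0 = 0.
    by have := lO (-1) 0 0; rewrite scaler0 addr0 scaleN1r addNr.
  elim/big_rec2: _ => [//|i y1 y2 _ <-]; have := lO 1 (F i) y2.
  by rewrite !scale1r.
move=> lG lG' GG' v; case: ds => _ /(_ v)[w [[Ww /finite_support_seq[r ur r0] ->] _]].
rewrite (@fsum_seq _ _ r) // !sum_lin //; apply: eq_bigr => i _.
exact: (GG' i).
Qed.

End DirectSums.

Section WeightShift.
Variables (R : realType) (h : graded_space R) (L : lattice_data h).
Variable a : lattice_type h.

Definition form_on (x : subvs_of (hcomp h 0)) : R[i]^o := form (vsval x) (lembed L a).

Lemma form_on_linear : linear form_on.
Proof. by move=> c x y; rewrite /form_on linearP hformZDl. Qed.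

HB.instance Definition _ := GRing.isLinear.Build R[i] (subvs_of (hcomp h 0)) R[i]^o _
  form_on form_on_linear.

Definition weight_shift (xi : weight h) : weight h := xi + linfun form_on.

Lemma weight_shiftE xi x : weight_shift xi x = xi x + form (vsval x) (lembed L a).
Proof. by rewrite add_lfunE lfunE. Qed.

End WeightShift.

(** * Construction of e(a) and the vertex operator formula *)

Section LatticeOperators.
Variables (R : realType) (h : graded_space R) (L : lattice_data h).
Variables (A : vertex_superalgebra R) (S : lattice_structure L A).
Variables (V : lmodType R[i]) (M : generalized_module V A).
Local Notation C := R[i].
Local Notation p := (period h).
Local Notation emb := (lembed L).
Local Notation pi := (gpi M).
Hypothesis tilde_class : forall (i : 'I_p) (x : h), x \in grading i ->
       is_field_class (i%:R / p%:R) (pi (tilde S x)).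
Implicit Types (a : lattice_type h) (x y : h) (v u : V) (m T : C) (xi : weight h).

Local Notation act := (H_action S M).
Local Notation XX a := (gpi M (X S a)).
Local Notation Em := (E_minus L act).
Local Notation Ep := (E_plus L act).
Local Notation Ez := (E_minusz L act).
Local Notation Wt := (weight_space act).
Local Notation c_ := (conf_weight L).

Let HH : is_H_module act id := act_H_module tilde_class.
Let p0 : (p%:R : C) != 0 := pC_neq0 h.
Let lEm a k := E_minus_linear L HH a k.
Let lEp a k := E_plus_linear L HH a k.
Let lEz a k := E_minusz_linear L HH a k.
Let lact k x := act_linear HH k x.
Let lW a m := Wop_linear tilde_class a m.

Lemma nat_divp_inj (k l : nat) : (k%:R / p%:R = l%:R / p%:R :> C) -> k = l.
Proof. by move/(mulIf (invr_neq0 p0))/eqP; rewrite eqr_nat => /eqP. Qed.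

(* For v of weight xi, X_a(z) v has exponents in -1 - top a xi + (1/p)Z. *)
Definition top a xi : C := -1 - wt xi (emb a) + c_ a.

(** Induction along [lnil]: the scalar in [Wop_ode] vanishes only at [m = top a xi], and its right
    side involves the vectors [a(k) u] at lower indices, still outside the allowed set. *)
Lemma Wop_vanish a xi u m : Wt xi u -> (forall r : nat, m <> top a xi + r%:R / p%:R) ->
  Wop S M a m u = 0.
Proof.
move=> Hw; have := weight_lnil tilde_class a Hw => nu.
elim: nu m Hw => {u} [|u _ IH] m Hw Hm.
  exact: (lin0 (lW _ _)).
have := Wop_ode tilde_class a m Hw.
rewrite fsbig1 => [/eqP|k _]; last first.
  apply: IH; first exact: (weight_act tilde_class).
  move=> r E; apply: (Hm (k.+1 + r)%N); rewrite idxD //.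
  by rewrite [_ / _ + _]addrC addrA -E subrK.
rewrite scaler_eq0 => /orP[|/eqP//] /eqP E; case: (Hm 0%N).
by rewrite mul0r addr0 /top -[RHS]subr0 -E; ring.
Qed.

(** At [top + r/p] the scalar in [Wop_ode] is [-r/p], which turns the equation into the recursion
    that defines [E_plus]; terms with k beyond r drop out by [Wop_vanish]. *)
Lemma Wop_top a xi u (r : nat) : Wt xi u ->
  Wop S M a (top a xi + r%:R / p%:R) u = Wop S M a (top a xi) (Ep a r u).
Proof.
elim/ltn_ind: r u => -[|r] IH u Hw; first by rewrite mul0r addr0 (E_plus0 L HH).
have := Wop_ode tilde_class a (top a xi + r.+1%:R / p%:R) Hw.
have -> : - (top a xi + r.+1%:R / p%:R) - 1 - wt xi (emb a) + c_ a = - (r.+1%:R / p%:R).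
  by rewrite /top; ring.
rewrite (@fsum_nat _ r.+1) => [|k rk]; last first.
  apply: (Wop_vanish (xi := xi)); first exact: (weight_act tilde_class).
  move=> s /eqP; rewrite -addrA (inj_eq (addrI _)) subr_eq -idxD // => /eqP.
  by move/nat_divp_inj; lia.
move=> E; apply: (@natS_scaleI _ _ r).
rewrite -(linZ (lW _ _)) (E_plus_opexp L HH a).2 (lin_sum (lW _ _)).
have -> : r.+1%:R *: Wop S M a (top a xi + r.+1%:R / p%:R) u =
   - p%:R *: (- (r.+1%:R / p%:R) *: Wop S M a (top a xi + r.+1%:R / p%:R) u).
  by rewrite scalerA mulrNN mulrCA divff // mulr1.
rewrite E scaler_sumr; apply: eq_bigr => k _; have kr := ltn_ord k.
have -> : top a xi + r.+1%:R / p%:R - k.+1%:R / p%:R = top a xi + (r.+1 - k.+1)%:R / p%:R.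
  by rewrite natrB // mulrBl addrA.
rewrite IH ?subSS ?ltnS ?leq_subr //; last exact: (weight_act tilde_class).
by rewrite /Bplus (linZ (lW _ _)) (act_E_plus L HH).
Qed.

Lemma weight_E_plus a k xi v : Wt xi v -> Wt xi (Ep a k v).
Proof. by move=> Hw x; rewrite (act_E_plus L HH a 0) Hw (linZ (lEp _ _)). Qed.

Hypothesis diag : h0_diagonalizable act.

(** The index [top a xi] varies with the weight, so no single coefficient of the series is e(a) on
    all of V. *)
Lemma lattice_operators : exists e : lattice_type h -> V -> V,
  (forall a, linear (e a)) /\
  forall a xi v, Wt xi v -> e a v = Wop S M a (top a xi) v.
Proof.
have H a : exists G : V -> V, linear G /\ forall xi v, Wt xi v -> G v = Wop S M a (top a xi) v.
  by apply: (direct_sum_glue diag) => xi; exact: lW.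
exists (fun a => projT1 (cid (H a))); split=> a; first exact: (projT2 (cid (H a))).1.
exact: (projT2 (cid (H a))).2.
Qed.

(* The coefficient of z^(r/p) in E_-(a,z) E_+(a,z) v *)
Definition Ncoef a (r : int) v : V := \sum_(j \in [set: nat]) Ez a (r + j%:Z) (Ep a j v).

(** With the identity in place of e, only the exponentials and powers of z are left. By the choice
    of [top], the condition on exponents is [i = r + j], and nilpotency bounds j. *)
Lemma vertex_sum a xi v m (r : int) : Wt xi v -> m = top a xi - r%:~R / p%:R ->
  vertex_operator L act (fun _ u => u) a xi m v = Ncoef a r v.
Proof.
move=> Hw mE; have [J HJ] := weight_E_plus_bound tilde_class a Hw.
rewrite /Ncoef (@fsum_nat _ J) => [|j jJ]; last by rewrite HJ // (lin0 (lEz _ _)).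
rewrite /vertex_operator -/(wt xi (emb a)) -/(primed (emb a)) -/(c_ a).
have D (ij : nat * nat) : (ij.1%:R - ij.2%:R) / p%:R + wt xi (emb a) - c_ a = - m - 1 <->
    ij.1%:Z = r + ij.2%:Z.
  have -> : - m - 1 = r%:~R / p%:R + wt xi (emb a) - c_ a by rewrite mE /top; ring.
  split=> [/addIr/addIr/(mulIf (invr_neq0 p0)) E|E].
    by apply: (@intrC_inj R); rewrite intrD -E /= subrK.
  by rewrite (pmulrn 1 ij.1) E intrD addrK.
pose F (j : nat) := (absz (r + j%:Z)%R, j).
rewrite (fsbigE [seq F j | j <- iota 0 J & 0 <= r + j%:Z]).
- rewrite big_map big_filter_cond.
  rewrite -[J in iota _ J]subn0 -/(index_iota 0 J) big_mkord big_mkcond.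
  apply: eq_bigr => j _; case: ifP => [/andP[rj _]|/negbT].
    by rewrite /F /=; case: (r + j%:Z) rj.
  rewrite negb_and => /orP[|]; first by rewrite -ltNge => /E_minusz_lt0 ->.
  rewrite notin_setE => jN; rewrite E_minusz_lt0 // ltNge; apply/negP => rj.
  by apply: jN; apply/D; rewrite /F /=; lia.
- by rewrite map_inj_uniq ?filter_uniq ?iota_uniq // => j j' [].
- move=> ij /= /mapP[j]; rewrite mem_filter => /andP[rj _] ->; apply/D.
  by rewrite /F /=; lia.
- move=> -[i j] Dij ijN; have /= E := (D (i, j)).1 Dij; rewrite HJ ?(lin0 (lEm _ _)) //.
  rewrite leqNgt; apply: contra ijN => jJ; apply/mapP; exists j.
    by rewrite mem_filter mem_iota; lia.
  by rewrite /F -E.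
Qed.

Lemma vertex_sum0 a xi v m : (forall r : int, m <> top a xi - r%:~R / p%:R) ->
  vertex_operator L act (fun _ u => u) a xi m v = 0.
Proof.
move=> Hm; rewrite /vertex_operator fsbig1 // => -[i j] /= E.
case: (Hm (i%:Z - j%:Z)); rewrite intrB /top.
move: E; rewrite -/(wt xi (emb a)) -/(primed (emb a)) -/(c_ a) => E.
have -> : m = -1 - (- m - 1) by ring.
by rewrite -E /=; ring.
Qed.

Section Operators.
Variable e : lattice_type h -> V -> V.
Hypothesis le : forall a, linear (e a).
Hypothesis eW : forall a xi v, Wt xi v -> e a v = Wop S M a (top a xi) v.

(** Checked on weight vectors. For a negative mode the extra term of [Wop_act_neg] lies below [top],
    where [Wop_vanish] applies; for the zero mode it is the shift [(x|a)]. *)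
Lemma act_lattice (k : int) x a v : act k x (e a v) =
  e a (act k x v) + (if k == 0 then form (hproj 0 x) (emb a) *: e a v else 0).
Proof.
pose G v := e a (act k x v) + (if k == 0 then form (hproj 0 x) (emb a) *: e a v else 0).
apply: (direct_sum_agree diag (G := fun v => act k x (e a v)) (G' := G)) => [c u w|c u w|xi {}v Hw].
- by rewrite le lact.
- rewrite /G lact !le; case: ifP => _; last by rewrite !addr0.
  by rewrite !scalerDr !scalerA [form _ _ * c]mulrC addrACA.
rewrite /G {G} (eW _ Hw) (eW _ (weight_act tilde_class k x Hw)).
case: k => k; last first.
  rewrite NegzE Wop_act_neg // ?ifF //=; congr (_ + _).
  rewrite (Wop_vanish Hw) ?scaler0 // => r /eqP; rewrite (inj_eq (addrI _)) eq_sym.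
  rewrite -subr_eq0 opprK -idxD // mulf_eq0 invr_eq0 (negbTE p0) orbF.
  by rewrite pnatr_eq0 addnS.
case: k => [|k]; last by rewrite Wop_act_pos // addr0.
by have := Wop_act_neg tilde_class a (top a xi) 0 x v; rewrite oppr0 mul0r subr0.
Qed.

Lemma lattice_weight a xi v : Wt xi v -> Wt (weight_shift L a xi) (e a v).
Proof.
move=> Hw x; rewrite act_lattice eqxx weight_shiftE scalerDl; congr (_ + _).
  by rewrite Hw (linZ (le a)).
by rewrite hproj_id //; exact: subvsP.
Qed.

Lemma lattice_E_minus a b j v : e a (Em b j v) = Em b j (e a v).
Proof.
by apply: (E_minus_comm HH (le a)) => k u; rewrite act_lattice addr0.
Qed.

Lemma lattice_E_plus a b j v : e a (Ep b j v) = Ep b j (e a v).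
Proof.
by apply: (E_plus_comm HH (le a)) => k u; rewrite act_lattice addr0.
Qed.

Lemma lattice_Ez a b r v : e a (Ez b r v) = Ez b r (e a v).
Proof. by case: r => n /=; [exact: lattice_E_minus|exact: (lin0 (le a))]. Qed.

(** [Wop_inv] restores E_-(a,z), and by [Wop_top] the coefficient at [top + k/p] is e(a) applied to
    degree k of [E_plus]. According to the sign of r, the first terms of one sum or of the other
    vanish. *)
Lemma X_lattice a xi v (r : int) : Wt xi v ->
  XX a (top a xi - r%:~R / p%:R) v = e a (Ncoef a r v).
Proof.
move=> Hw; have [J HJ] := weight_E_plus_bound tilde_class a Hw.
have eN : ev0 (fun j : nat => Ez a (r + j%:Z) (Ep a j v)).
  by exists J => j jJ; rewrite HJ // (lin0 (lEz _ _)).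
have wE k : Wop S M a (top a xi + k%:R / p%:R) v = e a (Ep a k v).
  by rewrite (Wop_top a k Hw) (eW _ (weight_E_plus a k Hw)).
have w0 m : (forall k : nat, m <> top a xi + k%:R / p%:R) -> Wop S M a m v = 0.
  exact: Wop_vanish.
rewrite (Wop_inv tilde_class) /Ncoef (lin_fsum (le a) eN).
case: r eN => n eN.
- rewrite (fsum_shift (k := n)).
  + apply: eq_fsbigr => j _; rewrite lattice_Ez.
    by rewrite idxD // addrA subrK wE.
  + have [N HN] := Wop_bound tilde_class a (top a xi - n%:~R / p%:R) v.
    by exists N => i iN; rewrite HN // (lin0 (lEm _ _)).
  + move=> i iN; rewrite w0 ?(lin0 (lEm _ _)) // => k /eqP.
    rewrite -addrA (inj_eq (addrI _)) addrC subr_eq -idxD // => /eqP/nat_divp_inj; lia.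
- rewrite [RHS](fsum_shift (k := n.+1)).
  + apply: eq_fsbigr => j _; rewrite lattice_Ez.
    have -> : Negz n + (n.+1 + j)%N%:Z = j%:Z by lia.
    rewrite NegzE mulrNz mulNr opprK -[n.+1%:~R]/(n.+1%:R) -addrA -idxD // wE.
    by [].
  + by have [N HN] := eN; exists N => i iN; rewrite HN // (lin0 (le _)).
  + by move=> i iN; rewrite lattice_Ez E_minusz_lt0 //; lia.
Qed.

Lemma X_lattice0 a xi v m : Wt xi v -> (forall r : int, m <> top a xi - r%:~R / p%:R) ->
  XX a m v = 0.
Proof.
move=> Hw Hm; rewrite (Wop_inv tilde_class) fsbig1 // => i _.
rewrite (Wop_vanish Hw) ?(lin0 (lEm _ _)) // => k E.
apply: (Hm (i%:Z - k%:Z)); rewrite intrB mulrBl opprB addrA -E addrK //.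
Qed.

Lemma X_vertex a xi v m : Wt xi v -> XX a m v = vertex_operator L act e a xi m v.
Proof.
move=> Hw; rewrite -[RHS]/(e a (vertex_operator L act (fun _ u => u) a xi m v)).
case: (pselect (exists r : int, m = top a xi - r%:~R / p%:R)) => [[r mE]|Nr].
  by rewrite (vertex_sum Hw mE) mE (X_lattice a r Hw).
rewrite (X_lattice0 Hw) ?vertex_sum0 ?(lin0 (le _)) //.
  by move=> r E; apply: Nr; exists r.
by move=> r E; apply: Nr; exists r.
Qed.

End Operators.
End LatticeOperators.

(** * The group algebra relations *)

Lemma sum_tri_rect (V : zmodType) (K J I : nat) (F : nat -> nat -> V) : (K + J <= I)%N ->
  (forall k j, (K <= k)%N -> F k j = 0) -> (forall k j, (J <= j)%N -> F k j = 0) ->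
  \sum_(i < I) \sum_(k < i.+1) F k (i - k)%N = \sum_(k < K) \sum_(j < J) F k j.
Proof.
move=> KJI FK FJ; rewrite -sum_tri.
have KI : (K <= I)%N by apply: leq_trans KJI; exact: leq_addr.
rewrite [RHS](big_ord_widen I (fun k => \sum_(j < J) F k j) KI) [RHS]big_mkcond.
apply: eq_bigr => k _ /=; case: ltnP => kK; last first.
  by rewrite big1 // => j _; exact: FK.
have JI : (J <= I - k)%N by lia.
rewrite (big_ord_widen (I - k) (fun j => F k j) JI) [RHS]big_mkcond.
by apply: eq_bigr => j _ /=; case: ltnP => // jJ; exact: FJ.
Qed.

Section GroupAlgebraRelations.
Variables (R : realType) (h : graded_space R) (L : lattice_data h).
Variables (A : vertex_superalgebra R) (S : lattice_structure L A).
Variables (V : lmodType R[i]) (M : generalized_module V A).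
Local Notation C := R[i].
Local Notation p := (period h).
Local Notation emb := (lembed L).
Local Notation pi := (gpi M).
Hypothesis tilde_class : forall (i : 'I_p) (x : h), x \in grading i ->
       is_field_class (i%:R / p%:R) (pi (tilde S x)).
Implicit Types (x y : h) (u : V) (m T : C).

Local Notation act := (H_action S M).
Local Notation Em := (E_minus L act).
Local Notation Ep := (E_plus L act).
Local Notation Ez := (E_minusz L act).
Local Notation Wt := (weight_space act).
Local Notation c_ := (conf_weight L).
Local Notation Nc := (Ncoef S M).

Let HH : is_H_module act id := act_H_module tilde_class.
Let lEm a k := E_minus_linear L HH a k.
Let lEp a k := E_plus_linear L HH a k.
Let lEz a k := E_minusz_linear L HH a k.
Let lact k x := act_linear HH k x.

Lemma weight0 xi : Wt xi 0.
Proof. by move=> x; rewrite (lin0 (lact _ _)) scaler0. Qed.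

Lemma weight_Ez a r xi v : Wt xi v -> Wt xi (Ez a r v).
Proof.
move=> Hw x; have := actN_E_minusz L HH a 0 (vsval x) r v; rewrite oppr0 => ->.
by rewrite Hw (linZ (lEz _ _)).
Qed.

Lemma weight_sum (I : Type) (r : seq I) (F : I -> V) xi : (forall i, Wt xi (F i)) ->
  Wt xi (\sum_(i <- r) F i).
Proof.
move=> HF; elim/big_rec: _ => [|i u _ Hu]; first exact: weight0.
by have := weight_lin tilde_class 1 (HF i) Hu; rewrite scale1r.
Qed.

Lemma Ncoef_finite a xi v : Wt xi v -> exists J : nat, forall K r, (J <= K)%N ->
  Nc a r v = \sum_(j < K) Ez a (r + j%:Z) (Ep a j v).
Proof.
move=> Hw; have [J HJ] := weight_E_plus_bound tilde_class a Hw.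
exists J => K r JK; rewrite /Ncoef (@fsum_nat _ K) // => j Kj.
by rewrite HJ ?(lin0 (lEz _ _)) // (leq_trans JK).
Qed.

Lemma weight_Ncoef a r xi v : Wt xi v -> Wt xi (Nc a r v).
Proof.
move=> Hw; have [J HJ] := Ncoef_finite a Hw; rewrite (HJ J) //.
by apply: weight_sum => j; apply/weight_Ez/(weight_E_plus tilde_class).
Qed.

(* Descending induction on j shows that D kills the coefficients of E_+(a,z) v. *)
Lemma Ncoef_inj a (D : V -> V) xi v : linear D ->
  (forall (k : nat) u, D (act (- k.+1%:Z) (emb a) u) = act (- k.+1%:Z) (emb a) (D u)) ->
  Wt xi v -> (forall r, D (Nc a r v) = 0) -> D v = 0.
Proof.
move=> lD cD Hw HD; have [J HJ] := weight_E_plus_bound tilde_class a Hw.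
have cE j u : D (Em a j u) = Em a j (D u) by exact: (E_minus_comm HH lD cD).
suff H n : forall j, (J <= j + n)%N -> D (Ep a j v) = 0.
  by rewrite -(H J 0%N) ?leq_addl // (E_plus0 L HH).
elim: n => [|n IH] j jn; first by rewrite HJ ?(lin0 lD) // -[j]addn0.
(* With r = -j the terms i < j have negative degree in E_-, the term i = j has degree 0, and the
   terms i > j are known to be killed. *)
have := HD (- j%:Z); rewrite /Ncoef (@fsum_nat _ (j + J).+1) => [|i iJ]; last first.
  by rewrite HJ ?(lin0 (lEz _ _)) //; lia.
rewrite (lin_sum lD) => E; rewrite -{}[RHS]E.
have jJ : (j < (j + J).+1)%N by lia.
rewrite (bigD1 (Ordinal jJ)) //= addNr /= cE (E_minus0 L HH) big1 ?addr0 // => i ij.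
have {}ij : (i != j :> nat)%N by [].
case: (ltnP i j) => lij; first by rewrite E_minusz_lt0 ?(lin0 lD) //; lia.
have -> : - j%:Z + i%:Z = (i - j)%N%:Z by lia.
by rewrite /= cE IH ?(lin0 (lEm _ _)) //; lia.
Qed.

Hypothesis diag : h0_diagonalizable act.
Variable e : lattice_type h -> V -> V.
Hypothesis le : forall a, linear (e a).
Hypothesis eW : forall a xi v, Wt xi v -> e a v = Wop S M a (top L a xi) v.

(** X_0 is [cocycle L 0 0] times the vacuum and the exponentials of 0 are trivial; the two sides are
    compared at index -1, which is [top] for the zero lattice element. *)
Lemma lattice_unit v : e 0 v = cocycle L 0 0 *: v.
Proof.
apply: (direct_sum_agree diag (G := e 0) (G' := fun v => cocycle L 0 0 *: v)) => //.
  by move=> c u w; rewrite scalerDr !scalerA mulrC.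
move=> xi {}v Hw.
have := X_lattice tilde_class diag le eW 0 0 Hw; rewrite X_0 gpiZ gpi_vacuum /one_series.
have wt0 : wt xi (emb 0) = 0.
  by rewrite /wt emb0 (lin0 (hproj_linear 0)) !linear0.
have c0 : c_ 0 = 0.
  by rewrite /conf_weight form_primed emb0 !hform0r subr0 mul0r.
rewrite mul0r subr0 /top wt0 c0 subr0 addr0 eqxx => ->; congr (e 0 _).
rewrite /Ncoef (@fsum_nat _ 1) => [|[//|j] _]; last first.
  by rewrite (E_plus_lattice0 L HH) /opone /= (lin0 (lEm _ _)).
by rewrite big_ord_recl big_ord0 addr0 /= (E_plus0 L HH) (E_minus0 L HH).
Qed.

Section Product.
Variables (a b : lattice_type h) (xi : weight h) (v : V) (Q : int).
Hypothesis Hw : Wt xi v.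

Variable J : nat.
Hypothesis J1 : forall j, (J <= j)%N -> Ep b j v = 0.
Hypothesis J2 : forall i j, (J <= i)%N -> Ep a i (Ep b j v) = 0.

(* The coefficient of z^(r/p) w^((Q-r)/p) in E_-(a,z) E_-(b,w) E_+(a,z) E_+(b,w) v *)
Definition Fcoef (r : int) : V :=
  \sum_(j < J) \sum_(j' < J) Ez a (r + j%:Z) (Ez b (Q - r + j'%:Z) (Ep a j (Ep b j' v))).

Lemma Fcoef0 r : `|Q|%:Z + J%:Z < `|r| -> Fcoef r = 0.
Proof.
move=> rQ; rewrite /Fcoef big1 // => j _; rewrite big1 // => j' _.
have jJ := ltn_ord j; have jJ' := ltn_ord j'.
case: (ltP r 0) => r0; first by rewrite E_minusz_lt0 //; lia.
by rewrite [X in Ez a _ X]E_minusz_lt0 ?(lin0 (lEz _ _)) //; lia.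
Qed.

Lemma Ez_conv (n : int) u (B : nat) : `|n| <= B%:Z ->
  \sum_(r <- int_seq B B.+1) Ez a r (Ez b (n - r) u) = Ez (a + b) n u.
Proof.
move=> nB; rewrite big_cat -[LHS]/(_ + _) !big_map big1 ?add0r => [|i _]; last first.
  by rewrite E_minusz_lt0 //; lia.
rewrite -[X in iota _ X]subn0 -/(index_iota 0 B.+1) big_mkord.
case: n nB => n nB; last first.
  rewrite big1 // => i _; rewrite [X in Ez a _ X]E_minusz_lt0 ?(lin0 (lEz _ _)) //; lia.
rewrite /= (E_minusD L HH) /opmul.
have nB' : (n.+1 <= B.+1)%N by lia.
rewrite (big_ord_widen B.+1 (fun i => Em a i (Em b (n - i)%N u)) nB') [RHS]big_mkcond.
apply: eq_bigr => i _ /=; case: ltnP => ni.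
  by rewrite subzn // -ltnS.
by rewrite [X in Em a _ X]E_minusz_lt0 ?(lin0 (lEm _ _)) //; lia.
Qed.

(** This is the substitution w = z, after which E_- and E_+ of a and b multiply to those of a +
    b. *)
Lemma Fcoef_sum (B : nat) : `|Q|%:Z + J%:Z + J%:Z <= B%:Z ->
  \sum_(r <- int_seq B B.+1) Fcoef r = Nc (a + b) Q v.
Proof.
move=> QB; rewrite /Fcoef.
have E (j j' : 'I_J) :
   \sum_(r <- int_seq B B.+1) Ez a (r + j%:Z) (Ez b (Q - r + j'%:Z) (Ep a j (Ep b j' v))) =
   Ez (a + b) (Q + j%:Z + j'%:Z) (Ep a j (Ep b j' v)).
  have jJ := ltn_ord j; have jJ' := ltn_ord j'.
  set u := Ep a j _; pose f r := Ez a r (Ez b (Q + j%:Z + j'%:Z - r) u).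
  have f0 r : r \notin int_seq (B + J) (B + J).+1 -> f r = 0.
    rewrite mem_int_seq => /negP rB; rewrite /f.
    case: (ltP r 0) => r0; first by rewrite E_minusz_lt0.
    by rewrite [X in Ez a _ X]E_minusz_lt0 ?(lin0 (lEz _ _)) //; lia.
  have g0 r : r \notin int_seq B B.+1 -> f (r + j%:Z) = 0.
    rewrite mem_int_seq => /negP rB; rewrite /f.
    case: (ltP (r + j%:Z) 0) => r0; first by rewrite E_minusz_lt0.
    by rewrite [X in Ez a _ X]E_minusz_lt0 ?(lin0 (lEz _ _)) //; lia.
  rewrite -(@Ez_conv _ _ (B + J)%N); last by lia.
  rewrite -(fsum_seq (int_seq_uniq _ _) f0).
  rewrite (@reindex_fsbigT _ _ _ _ _ (fun r : int => r + j%:Z)); last first.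
    by exists (fun r => r - j%:Z) => r; rewrite ?addrK ?subrK.
  rewrite (fsum_seq (int_seq_uniq _ _) g0); apply: eq_bigr => r _; rewrite /f.
  by congr (Ez a _ (Ez b _ _)); lia.
rewrite exchange_big /=.
under eq_bigr => j _.
  rewrite exchange_big /=.
  under eq_bigr => j' _ do rewrite E.
  over.
have HNc := weight_E_plus_bound tilde_class (a + b) Hw.
have PD n : Ep (a + b) n v = \sum_(j < n.+1) Ep a j (Ep b (n - j)%N v).
  exact: (E_plusD L HH).
rewrite /Ncoef (@fsum_nat _ (J + J)%N) => [|n nJ]; last first.
  rewrite PD big1 ?(lin0 (lEz _ _)) // => j _; case: (leqP J j) => jJ.
    by rewrite J2.
  by rewrite J1 ?(lin0 (lEp _ _)) //; lia.
rewrite -(@sum_tri_rect _ J J (J + J) (fun j j' =>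
   Ez (a + b) (Q + j%:Z + j'%:Z) (Ep a j (Ep b j' v)))) //.
- apply: eq_bigr => n _; rewrite PD (lin_sum (lEz _ _)); apply: eq_bigr => j _.
  by congr (Ez _ _ _); have := ltn_ord j; lia.
- by move=> j j' Jj; rewrite J2 // (lin0 (lEz _ _)).
- by move=> j j' Jj; rewrite J1 // (lin0 (lEp _ _)) (lin0 (lEz _ _)).
Qed.

Variable c : nat -> C.
Hypothesis c0 : c 0%N = 1.
Hypothesis cS : forall k : nat, k%:R * c k =
  \sum_(i < k) - p%:R * form (hproj i.+1%:Z (emb a)) (emb b) * c (k - i.+1)%N.

(** Exchanging E_+(a,z) with E_-(b,w) inserts [c_k (w/z)^(k/p)], which moves the exponent r to r +
    k. The bound on K makes all further terms vanish. *)
Lemma Ncoef_Ncoef r (K : nat) : `|Q - r|%:Z + J%:Z <= K%:Z ->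
  Nc a r (Nc b (Q - r) v) = \sum_(k < K) c k *: Fcoef (r + k%:Z).
Proof.
move=> rK; set s := Q - r.
have Nb : Nc b s v = \sum_(j' < J) Ez b (s + j'%:Z) (Ep b j' v).
  by rewrite /Ncoef (@fsum_nat _ J) // => j jJ; rewrite J1 // (lin0 (lEz _ _)).
have EN i : Ep a i (Nc b s v) =
    \sum_(j' < J) \sum_(k < i.+1) c k *: Ez b (s + j'%:Z - k%:Z) (Ep a (i - k)%N (Ep b j' v)).
  rewrite Nb (lin_sum (lEp _ _)); apply: eq_bigr => j' _.
  exact: (E_plus_E_minusz HH c0 cS).
have z1 j' k u : (j' < J)%N -> (K <= k)%N -> Ez b (s + j'%:Z - k%:Z) u = 0.
  by move=> j'J kK; rewrite E_minusz_lt0 //; lia.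
rewrite /Ncoef (@fsum_nat _ (K + J)) => [|i iKJ]; last first.
  rewrite EN big1 ?(lin0 (lEz _ _)) // => j' _; rewrite big1 // => k _.
  case: (leqP K k) => kK; first by rewrite z1 ?scaler0.
  by rewrite J2 ?(lin0 (lEz _ _)) ?scaler0 //; lia.
under eq_bigr => i _.
  rewrite EN (lin_sum (lEz _ _)).
  under eq_bigr => j' _ do rewrite (lin_sum (lEz _ _)).
  over.
rewrite exchange_big /=.
pose F (j' k j : nat) := c k *: Ez a (r + k%:Z + j%:Z) (Ez b (Q - (r + k%:Z) + j'%:Z)
  (Ep a j (Ep b j' v))).
transitivity (\sum_(j' < J) \sum_(k < K) \sum_(j < J) F j' k j).
  apply: eq_bigr => j' _; rewrite -(@sum_tri_rect _ K J (K + J) (F j')) //.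
  - apply: eq_bigr => i _; apply: eq_bigr => k _; have ki := ltn_ord k.
    by rewrite (linZ (lEz _ _)) /F /s; congr (_ *: Ez a _ (Ez b _ _)); lia.
  - move=> k j kK; have := z1 j' k (Ep a j (Ep b j' v)) (ltn_ord j') kK.
    rewrite (_ : s + j'%:Z - k%:Z = Q - (r + k%:Z) + j'%:Z); last by rewrite /s; lia.
    by rewrite /F => ->; rewrite (lin0 (lEz _ _)) scaler0.
  - by move=> k j jJ; rewrite /F J2 // !(lin0 (lEz _ _)) scaler0.
rewrite exchange_big /=; apply: eq_bigr => k _.
rewrite exchange_big scaler_sumr; apply: eq_bigr => j _ /=.
by rewrite scaler_sumr.
Qed.

End Product.
End GroupAlgebraRelations.

(** * The relation between e(a) e(b) and e(a + b) *)

Section LatticeProduct.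
Variables (R : realType) (h : graded_space R) (L : lattice_data h).
Variables (A : vertex_superalgebra R) (S : lattice_structure L A).
Variables (V : lmodType R[i]) (M : generalized_module V A).
Local Notation C := R[i].
Local Notation p := (period h).
Local Notation emb := (lembed L).
Local Notation pi := (gpi M).
Hypothesis tilde_class : forall (i : 'I_p) (x : h), x \in grading i ->
       is_field_class (i%:R / p%:R) (pi (tilde S x)).
Implicit Types (x y : h) (u : V) (m T : C).

Local Notation act := (H_action S M).
Local Notation XX a := (gpi M (X S a)).
Local Notation Ep := (E_plus L act).
Local Notation Wt := (weight_space act).
Local Notation c_ := (conf_weight L).
Local Notation Nc := (Ncoef S M).

Let HH : is_H_module act id := act_H_module tilde_class.
Let p0 : (p%:R : C) != 0 := pC_neq0 h.
Let lEp a k := E_plus_linear L HH a k.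
Let lact k x := act_linear HH k x.

Hypothesis diag : h0_diagonalizable act.
Variable e : lattice_type h -> V -> V.
Hypothesis le : forall a, linear (e a).
Hypothesis eW : forall a xi v, Wt xi v -> e a v = Wop S M a (top L a xi) v.

Lemma lattice_Ncoef a b r xi v : Wt xi v -> e b (Nc a r v) = Nc a r (e b v).
Proof.
move=> Hw; have [J HJ] := Ncoef_finite tilde_class a Hw.
have [J' HJ'] := Ncoef_finite tilde_class a (lattice_weight tilde_class diag le eW b Hw).
rewrite (HJ (J + J')%N) ?leq_addr // (HJ' (J + J')%N) ?leq_addl //.
rewrite (lin_sum (le b)); apply: eq_bigr => j _.
by rewrite (lattice_Ez tilde_class diag le eW) (lattice_E_plus tilde_class diag le eW).
Qed.

(** e(b) shifts the weight by [(a_0|b)], and the quadratic term contributes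
    [(a'|b') = (a|b) - (a_0|b)]; together they give [(a|b)]. *)
Lemma topD a b xi :
  top L a (weight_shift L b xi) + top L b xi + form (emb a) (emb b) + 1 = top L (a + b) xi.
Proof.
have E1 : wt (weight_shift L b xi) (emb a) =
    wt xi (emb a) + form (hproj 0 (emb a)) (emb b).
  by rewrite /wt weight_shiftE vsprojK // hproj_mem.
have E2 : wt xi (emb (a + b)) = wt xi (emb a) + wt xi (emb b).
  by rewrite /wt embD (linD (hproj_linear 0)) !linearD.
have E3 : c_ (a + b) = c_ a + c_ b + form (primed (emb a)) (primed (emb b)).
  have pD : primed (emb (a + b)) = primed (emb a) + primed (emb b).
    by rewrite /primed embD (linD (hproj_linear 0)) opprD addrACA.
  rewrite /conf_weight pD; move: (primed (emb a)) (primed (emb b)) => x y.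
  rewrite hformDl !hformDr [form y x]form_sym.
  by field.
by rewrite /top E1 E2 E3 form_primed; ring.
Qed.

Section Coefficients.
Variables (a b : lattice_type h) (xi : weight h) (v : V) (Q : int).
Hypothesis Hw : Wt xi v.
Local Notation xi' := (weight_shift L b xi).
Local Notation T := (top L a xi' + top L b xi - Q%:~R / p%:R).
Local Notation phi := (prodf (XX a) (XX b) T v).

Lemma X_X_lattice (r : int) : phi (top L a xi' - r%:~R / p%:R) =
  e a (e b (Nc a r (Nc b (Q - r) v))).
Proof.
rewrite /prodf.
have -> : T - (top L a xi' - r%:~R / p%:R) = top L b xi - (Q - r)%:~R / p%:R.
  by rewrite intrB; ring.
have HN := weight_Ncoef tilde_class b (Q - r) Hw.
rewrite (X_lattice tilde_class diag le eW b _ Hw).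
rewrite (X_lattice tilde_class diag le eW a r (lattice_weight tilde_class diag le eW b HN)).
by rewrite (lattice_Ncoef _ _ _ HN).
Qed.

Lemma X_X_lattice0 m : (forall r : int, m <> top L a xi' - r%:~R / p%:R) -> phi m = 0.
Proof.
move=> Hm; rewrite /prodf (X_lattice0 tilde_class (a := b) Hw) ?(lin0 (gpi_lin M _ _)) //.
move=> r E; apply: (Hm (Q - r)); have -> : m = T - (T - m) by ring.
by rewrite E intrB; ring.
Qed.

Variables (J : nat).
Hypothesis J1 : forall j, (J <= j)%N -> Ep b j v = 0.
Hypothesis J2 : forall i j, (J <= i)%N -> Ep a i (Ep b j v) = 0.
Local Notation Fc := (Fcoef S M a b v Q J).

Variables (c : nat -> C) (N : nat) (P : {poly C}) (n0 : nat).
Hypothesis c0 : c 0%N = 1.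
Hypothesis cS : forall k : nat, k%:R * c k =
  \sum_(i < k) - p%:R * form (hproj i.+1%:Z (emb a)) (emb b) * c (k - i.+1)%N.
Hypothesis P1 : forall k, \sum_(s < N.+1) ((-1) ^+ s * ('C(N, s))%:R) *
  (if (p * s <= k)%N then c (k - p * s)%N else 0) = P`_k.
Hypothesis P2 : forall k, (n0 <= k)%N -> P`_k = 0.

(** Multiplication by [(1 - w/z)^N = (1 - t^p)^N], which replaces the infinite series c by the
    polynomial P. *)
Lemma sum_Ncoef_Ncoef (r : int) :
  \sum_(s < N.+1) ((-1) ^+ s * ('C(N, s))%:R) *:
     Nc a (r + (p * s)%N%:Z) (Nc b (Q - (r + (p * s)%N%:Z)) v) =
  \sum_(k < n0) P`_k *: Fc (r + k%:Z).
Proof.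
pose K := (n0 + (absz (Q - r)%R + 2 * (p * N) + J))%N.
have n0K : (n0 <= K)%N by exact: leq_addr.
rewrite (big_ord_widen K (fun k => P`_k *: Fc (r + k%:Z)) n0K) [RHS]big_mkcond /=.
rewrite [RHS](eq_bigr (fun k : 'I_K => \sum_(s < N.+1) ((-1) ^+ s * ('C(N, s))%:R) *:
    (if (p * s <= k)%N then c (k - p * s)%N *: Fc (r + k%:Z) else 0))); last first.
  move=> k _; have -> : (if (k < n0)%N then P`_k *: Fc (r + k%:Z) else 0) =
      P`_k *: Fc (r + k%:Z).
    by case: ltnP => // /P2 ->; rewrite scale0r.
  rewrite -P1 scaler_suml; apply: eq_bigr => s _; rewrite -[LHS]scalerA; congr (_ *: _).
  by case: (_ <= _)%N; rewrite ?scale0r.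
rewrite exchange_big; apply: eq_bigr => s _ /=; rewrite -scaler_sumr; congr (_ *: _).
have psN : (p * s <= p * N)%N by rewrite leq_mul2l -ltnS ltn_ord orbT.
have psK : (p * s <= K)%N by rewrite /K; lia.
rewrite (Ncoef_Ncoef tilde_class J1 J2 c0 cS (K := (K - p * s)%N)); last by rewrite /K; lia.
rewrite -[in RHS](subnKC psK) [RHS]big_split_ord -[RHS]/(_ + _) [X in _ = X + _]big1 ?add0r => [|i _]; last first.
  by rewrite ifF //= leqNgt ltn_ord.
apply: eq_bigr => i _ /=; rewrite leq_addr addKn; congr (_ *: Fcoef _ _ _ _ _ _ _ _).
by lia.
Qed.

Local Notation G := (iter N (@fdiff R V C) phi).

(** [(z - w)^N = z^N (1 - w/z)^N]: the factor [z^N] is the shift by N in the index and reverses the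
    order of the differences. *)
Lemma diff_X_X (r : int) : G (top L a xi' - r%:~R / p%:R - N%:R) =
  \sum_(k < n0) P`_k *: e a (e b (Fc (r + k%:Z))).
Proof.
rewrite iter_fdiffE scaler_sumr (reindex_inj rev_ord_inj) /=.
transitivity (e a (e b (\sum_(k < n0) P`_k *: Fc (r + k%:Z)))); last first.
  rewrite (lin_sum (le b)) (lin_sum (le a)); apply: eq_bigr => k _.
  by rewrite (linZ (le b)) (linZ (le a)).
rewrite -sum_Ncoef_Ncoef (lin_sum (le b)) (lin_sum (le a)); apply: eq_bigr => s _.
have sN : (s <= N)%N by rewrite -ltnS.
rewrite subSS (linZ (le b)) (linZ (le a)) -X_X_lattice scalerA mulrA -exprD bin_sub //.
congr (_ * _ *: phi _).
  by rewrite -signr_odd oddD oddB // addKb signr_odd.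
have -> : (r + (p * s)%N%:Z)%:~R / p%:R = r%:~R / p%:R + s%:R :> C.
  by rewrite intrD -pmulrn mulrDl natrM [p%:R * _]mulrC mulfK.
by rewrite natrB //; ring.
Qed.

Lemma diff_X_X0 m : (forall r : int, m <> top L a xi' - r%:~R / p%:R - N%:R) -> G m = 0.
Proof.
move=> Hm; rewrite iter_fdiffE big1 ?scaler0 // => s _; rewrite X_X_lattice0 ?scaler0 //.
move=> r E; apply: (Hm (r - (p * N)%N%:Z + (p * s)%N%:Z)).
have -> : m = m + s%:R - s%:R by rewrite addrK.
rewrite E intrD intrB -!pmulrn !mulrDl mulNr !natrM ![p%:R * _]mulrC !mulfK //; ring.
Qed.

Variable B : nat.
Hypothesis QB : `|Q|%:Z + J%:Z + J%:Z <= B%:Z.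

(** After regrouping by the index of [Fc], the sum over k is the same constant K for every r, so
    what remains is the plain sum of the [Fc]. *)
Lemma sum_diff_X_X (K : C) l :
  (forall (t : C), \sum_(k < n0) P`_k * gbinom (t - k%:R / p%:R) l = K) ->
  \sum_(m \in [set: C]) gbinom (- m - 1) l *: G m = K *: e a (e b (Nc (a + b) Q v)).
Proof.
move=> HK; pose g (r : int) := top L a xi' - r%:~R / p%:R - N%:R.
pose t (r : int) : C := - top L a xi' + r%:~R / p%:R + N%:R - 1.
have ig : injective g.
  by move=> r r' /addIr/addrI/oppr_inj/(mulIf (invr_neq0 p0)); exact: intrC_inj.
have F0 r : r \notin int_seq B B.+1 -> Fc r = 0.
  by rewrite mem_int_seq => /negP rB; apply: Fcoef0 => //; lia.
have Fn0 (k : 'I_n0) r : r \notin int_seq (B + n0) B.+1 -> Fc (r + k%:Z) = 0.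
  rewrite mem_int_seq => /negP rB; have := ltn_ord k => kn.
  by apply: F0; rewrite mem_int_seq; apply/negP; lia.
rewrite (fsum_inj (int_seq_uniq (B + n0) B.+1) ig); last first.
  move=> m Hm; case: (pselect (exists r, m = g r)) => [[r mE]|Nr].
    rewrite mE diff_X_X big1 ?scaler0 // => k _; rewrite Fn0.
      by rewrite (lin0 (le b)) (lin0 (le a)) scaler0.
    by apply: contra Hm => rI; rewrite mE map_f.
  by rewrite diff_X_X0 ?scaler0 // => r E; apply: Nr; exists r.
transitivity (\sum_(k < n0) \sum_(r <- int_seq B B.+1)
    (P`_k * gbinom (t r - k%:R / p%:R) l) *: e a (e b (Fc r))).
  under eq_bigr => r _ do rewrite diff_X_X scaler_sumr.
  rewrite exchange_big /=; apply: eq_bigr => k _.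
  pose f (r : int) := (P`_k * gbinom (t r - k%:R / p%:R) l) *: e a (e b (Fc r)).
  rewrite -[RHS]/(\sum_(r <- int_seq B B.+1) f r).
  rewrite -(@fsum_seq _ _ _ f (int_seq_uniq B B.+1)) => [|r /F0]; last first.
    by rewrite /f => ->; rewrite (lin0 (le b)) (lin0 (le a)) scaler0.
  rewrite (@reindex_fsbigT _ _ _ _ _ (fun r : int => r + k%:Z)); last first.
    by exists (fun r => r - k%:Z) => r; rewrite ?addrK ?subrK.
  rewrite (@fsum_seq _ _ (int_seq (B + n0) B.+1)) ?int_seq_uniq // => [|r /(Fn0 k)]; last first.
    by rewrite /f => ->; rewrite (lin0 (le b)) (lin0 (le a)) scaler0.
  apply: eq_bigr => r _; rewrite /f scalerA mulrC; congr (_ * gbinom _ _ *: _).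
  by rewrite /g /t intrD mulrDl /=; ring.
rewrite exchange_big /= -(Fcoef_sum tilde_class Hw J1 J2 QB).
rewrite (lin_sum (le b)) (lin_sum (le a)) scaler_sumr; apply: eq_bigr => r _.
by rewrite -scaler_suml HK.
Qed.

End Coefficients.
Lemma act_lattice_neg a (k : nat) x v : e a (act (- k.+1%:Z) x v) = act (- k.+1%:Z) x (e a v).
Proof. by rewrite (act_lattice tilde_class diag le eW) addr0. Qed.

(** The difference of the two sides commutes with the negative modes, so by [Ncoef_inj] it is enough
    to treat the coefficients [Nc (a + b) Q v], where the product formula for X_a X_b computes
    it. *)
Lemma lattice_product a b v : e a (e b v) = cocycle L a b *: e (a + b) v.
Proof.
apply: (direct_sum_agree diag (G := fun v => e a (e b v))
   (G' := fun v => cocycle L a b *: e (a + b) v)) => [d u w|d u w|xi {}v Hw].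
- by rewrite !le.
- by rewrite le scalerDr !scalerA mulrC.
pose D u := e a (e b u) - cocycle L a b *: e (a + b) u.
suff: D v = 0 by move/eqP; rewrite subr_eq0 => /eqP.
have lD : linear D.
  move=> d u w; rewrite /D !le !scalerDr scalerN opprD addrACA !scalerA.
  by rewrite [_ * d]mulrC.
apply: (@Ncoef_inj _ _ _ _ _ _ _ tilde_class (a + b) D xi v lD _ Hw) => [k u|Q].
  by rewrite /D !act_lattice_neg (linB (lact _ _)) (linZ (lact _ _)).
have [J0 HJ0] := weight_E_plus_bound tilde_class b Hw.
have [J HJ] : exists J : nat, forall i j, (J <= i)%N -> Ep a i (Ep b j v) = 0.
  have [Jf HJf] : exists Jf : nat -> nat, forall j i, (Jf j <= i)%N -> Ep a i (Ep b j v) = 0.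
    exists (fun j => projT1 (cid (weight_E_plus_bound tilde_class a
       (weight_E_plus tilde_class b j Hw)))) => j i.
    exact: (projT2 (cid (weight_E_plus_bound tilde_class a (weight_E_plus tilde_class b j Hw)))).
  exists (\sum_(j < J0) Jf j)%N => i j iJ; case: (ltnP j J0) => jJ0.
    apply: HJf; apply: leq_trans iJ.
    by rewrite (bigD1 (Ordinal jJ0)) //= leq_addr.
  by rewrite HJ0 // (lin0 (lEp _ _)).
have [c [c0 cS]] := exchange_seq L a b.
have [N [_ HN _ HX]] := X_product S M a b 0.
have [P [n0 [P1 P2 P3]]] := exchange_poly c0 cS HN.
pose B := (absz Q + (J + J0) + (J + J0))%N.
(* [q] is varkappa without its cocycle factor; both sides of the product formula contain it, and it
   is nonzero. *)
set q := _ * _ in P3.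
have q0 : q != 0.
  apply/eqP => q0; case/eqP: (varkappa_neq0 L a b).
  by rewrite /varkappa -mexp0 -mulrA -/q q0 mulr0.
pose xi' := weight_shift L b xi.
have := HX (top L a xi' + top L b xi - Q%:~R / p%:R) v.
rewrite (@sum_diff_X_X a b xi v Q Hw (J + J0) _ _ c N P n0 c0 cS P1 P2 B _ q) => [|j jJ|i j iJ||t].
- have -> : top L a xi' + top L b xi - Q%:~R / p%:R + (mexp L 0 a b)%:~R + 1 =
      top L (a + b) xi - Q%:~R / p%:R.
    by rewrite -topD mexp0 -int_formE; ring.
  rewrite (X_lattice tilde_class diag le eW _ _ Hw).
  have -> : varkappa L a b = q * cocycle L a b.
    by rewrite /varkappa -mexp0 -mulrA -/q mulrC.
  by rewrite -scalerA => /(scalerI q0); rewrite /D => ->; rewrite subrr.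
- by rewrite HJ0 //; lia.
- by rewrite HJ //; lia.
- by rewrite /B; lia.
- exact: P3.
Qed.

End LatticeProduct.

(** * Existence and uniqueness of the lattice action *)

Theorem theorem3 (R : realType) (h : graded_space R) (L : lattice_data h)
    (A : vertex_superalgebra R) (S : lattice_structure L A)
    (V : lmodType R[i]) (M : generalized_module V A)
    (tilde_class : forall (i : 'I_(period h)) (x : h), x \in grading i ->
       is_field_class (i%:R / (period h)%:R) (gpi M (tilde S x)))
    (diag : h0_diagonalizable (H_action S M)) :
  exists! e : lattice_type h -> V -> V,
    is_HR_module L (H_action S M) id e /\
    forall (a : lattice_type h) (xi : weight h) (v : V),
      weight_space (H_action S M) xi v ->
      forall m : R[i],
        gpi M (X S a) m v = vertex_operator L (H_action S M) e a xi m v.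
Proof.
have HH := act_H_module tilde_class.
have [e [le eW]] := lattice_operators tilde_class diag.
have eM k x a v : x \in hcomp h k ->
    H_action S M k x (e a v) - e a (H_action S M k x v) =
      if k == 0 then form x (lembed L a) *: e a v else 0.
  move=> xk; rewrite (act_lattice tilde_class diag le eW) [e a _ + _]addrC addrK.
  by case: eqP xk => // -> xk; rewrite hproj_id.
exists e; split.
  split; last by move=> a xi v Hw m; exact: (X_vertex tilde_class diag le eW).
  split=> //; split=> // [v|]; last exact: (lattice_product tilde_class diag le eW).
  rewrite (lattice_unit tilde_class diag le eW) scalerA mulVf ?scale1r //.
  exact: cocycle_neq0.
(* For uniqueness, e(a) - e'(a) commutes with the negative modes and kills every coefficient of
   [E_-(a,z) E_+(a,z) v], since both operators send it to the same coefficient of X_a(z) v;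
   [Ncoef_inj] concludes. *)
move=> e' [[_ [le' _ _] e'M] e'X]; apply/funext => a; apply/funext => v.
apply: (direct_sum_agree diag (le a) (le' a)) => xi {}v Hw.
pose D u := e a u - e' a u.
suff: D v = 0 by move/eqP; rewrite subr_eq0 => /eqP.
have lD : linear D.
  by move=> c u w; rewrite /D le le' opprD addrACA -scalerBr.
have cD f k x u : (forall k x a v, x \in hcomp h k ->
    H_action S M k x (f a v) - f a (H_action S M k x v) =
      if k == 0 then form x (lembed L a) *: f a v else 0) ->
    f a (H_action S M (- k.+1%:Z) x u) = H_action S M (- k.+1%:Z) x (f a u).
  move=> fM; have := fM (- k.+1%:Z) _ a u (hproj_mem (- k.+1%:Z) x).
  by rewrite -!(act_hproj HH) => /eqP; rewrite subr_eq0 => /eqP.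
apply: (@Ncoef_inj _ _ _ _ _ _ _ tilde_class a D xi v lD _ Hw) => [k u|r].
  by rewrite /D !cD // (linB (act_linear HH _ _)).
have := e'X a xi v Hw (top L a xi - r%:~R / (period h)%:R).
rewrite (X_lattice tilde_class diag le eW a r Hw).
rewrite -[vertex_operator _ _ e' _ _ _ _]/(e' a (vertex_operator L (H_action S M) (fun _ u => u)
   a xi _ v)) (vertex_sum tilde_class Hw erefl) /D => ->.
by rewrite subrr.
Qed.
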